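(* The operator $L_{dir}$ has a discrete spectrum. There exists $m\in\mathbb{N}$ such that $$\sigma(L_{dir})=\sigma_{(m)}\cup\{\widetilde{\lambda}_{n,dir}:\ n\ge m+1\},$$ where $\sigma_{(m)}$ is a finite set with at most $m$ points, and for the eigenvalues $\widetilde{\lambda}_{n,dir}$, $n\ge m+1$, $$\widetilde{\lambda}_{n,dir}=\Big(\frac{\pi n}{\omega}\Big)^{2k}-\frac1\omega\int_0^\omega q(t)\,dt+\frac1\omega\int_0^\omega q(t)\cos\frac{2\pi n}{\omega}t\,dt-\frac{\omega^{2k}}{2\pi^{2k}}\sum_{\substack{j=1\\ j\ne n}}^{\infty}\frac{(\widetilde q_{|n-j|}-\widetilde q_{n+j})^2}{j^{2k}-n^{2k}}+\eta_{dir}(n),$$ where the sequence $\eta_{dir}:\{n\in\mathbb{N}: n\ge m+1\}\to\mathbb{C}$ satisfies $|\eta_{dir}(n)|\le C\beta_n/n^{4k-3}$ with a constant $C>0$ independent of $n$ and some square summable sequence $(\beta_n)$. If $q$ is a function of bounded variation (or a smooth function), then $$\widetilde{\lambda}_{n,dir}=\Big(\frac{\pi n}{\omega}\Big)^{2k}-\frac1\omega\int_0^\omega q(t)\,dt+\frac1\omega\int_0^\omega q(t)\cos\frac{2\pi n}{\omega}t\,dt-\frac{\omega^{2k}}{2\pi^{2k}}\sum_{\substack{j=1\\ j\ne n}}^{\infty}\frac{(\widetilde q_{|n-j|}-\widetilde q_{n+j})^2}{j^{2k}-n^{2k}}+\mathcal{O}(n^{-4k+2}),\quad n\ge m+1.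$$
   Context: Let $k>1$ be an integer, $\omega>0$, and let $q\in L_2[0,\omega]$ be complex-valued. $L_2[0,\omega]$ is the Hilbert space of square summable complex functions with inner product $(x,y)=\frac1\omega\int_0^\omega x(\tau)\overline{y(\tau)}\,d\tau$. $H^{2k}[0,\omega]$ is the Sobolev space of $y$ with $y^{(2k-1)}$ absolutely continuous and $y^{(2k)}\in L_2[0,\omega]$. The operator $L_{dir}:D(L_{dir})\subset L_2[0,\omega]\to L_2[0,\omega]$ is $L_{dir}y=(-1)^k y^{(2k)}-qy$, with domain consisting of the $y\in H^{2k}[0,\omega]$ satisfying $y(0)=y''(0)=\dots=y^{(2k-2)}(0)=0$ and $y(\omega)=y''(\omega)=\dots=y^{(2k-2)}(\omega)=0$. The numbers $\widetilde q_l$, $l\ge1$, are the cosine coefficients of $q$: $\widetilde q_l=\frac{\sqrt2}{\omega}\int_0^\omega q(t)\cos\frac{\pi l t}{\omega}\,dt$, so that $q(t)-\frac1\omega\int_0^\omega q(\tau)\,d\tau=\sqrt2\sum_{l=1}^\infty\widetilde q_l\cos\frac{\pi l t}{\omega}$ in $L_2[0,\omega]$. Smooth means $q\in C^r[0,\omega]$ for some integer $r\ge1$. *)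

(* Defs.v *)
From mathcomp Require Export all_boot all_order all_algebra.
From mathcomp Require Export all_classical all_reals all_analysis.
From mathcomp Require Export complex.

Set Implicit Arguments.
Unset Strict Implicit.
Unset Printing Implicit Defensive.

Import Order.TTheory GRing.Theory Num.Theory.
Import numFieldNormedType.Exports.

Local Open Scope classical_set_scope.
Local Open Scope ring_scope.
Local Open Scope complex_scope.

(* Complex-valued functions on [0, w] are total functions [R -> R[i]] whose
   values outside [0, w] are never used; elements of L_2[0, w] are such
   functions up to [ae_eq_on].  [R[i]^o] is [R[i]] with its usual topology. *)

Section L2.
Context {R : realType}.
Implicit Types (w : R) (f g : R -> R[i]).

Definition cintegral w f : R[i] :=
  (\int[lebesgue_measure]_(t in `[0, w]) complex.Re (f t))%R +i*
  (\int[lebesgue_measure]_(t in `[0, w]) complex.Im (f t))%R.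

Definition ae_eq_on w f g : Prop :=
  {ae @lebesgue_measure R, forall t, t \in `[0, w] -> f t = g t}.

Definition in_L2 w f : Prop :=
  [/\ measurable_fun `[0, w] (fun t => complex.Re (f t)),
      measurable_fun `[0, w] (fun t => complex.Im (f t)) &
      (\int[lebesgue_measure]_(t in `[0%R, w]) (Normc.normc (f t) ^+ 2)%:E
         < +oo)%E].

Definition inner_L2 w f g : R[i] :=
  w^-1%:C * cintegral w (fun t => f t * (g t)^*).

Definition norm_L2 w f : R := Num.sqrt (complex.Re (inner_L2 w f f)).

End L2.

Section regularity.
Context {R : realType}.
Implicit Types (w : R) (f : R -> R[i]).

Definition diff_quot f (x t : R) : R[i]^o := (f t - f x) / (t - x)%:C.

Definition at_in w (x : R) : set_system R := within `[0, w] x^'.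

(* Differentiability relative to [0, w]: one-sided at the end points. *)
Definition derivable_on w f : Prop :=
  forall x, x \in `[0, w] -> cvg (diff_quot f x t @[t --> at_in w x]).

Definition derive_on w f : R -> R[i] :=
  fun x => lim (diff_quot f x t @[t --> at_in w x]).

Definition deriven_on w n f : R -> R[i] := iter n (derive_on w) f.

Definition abs_continuous w f : Prop :=
  forall e : R, 0 < e -> exists2 d : R, 0 < d &
  forall (n : nat) (a b : 'I_n -> R),
    (forall i, [/\ 0 <= a i, a i <= b i & b i <= w]) ->
    trivIset setT (fun i => [set` `]a i, b i[]) ->
    \sum_(i < n) (b i - a i) < d ->
    \sum_(i < n) Normc.normc (f (b i) - f (a i)) < e.

(* The Sobolev space H^p[0, w], p >= 1. *)
Definition in_Sobolev w (p : nat) f : Prop :=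
  [/\ forall i, (i < p.-1)%N -> derivable_on w (deriven_on w i f),
      abs_continuous w (deriven_on w p.-1 f) &
      in_L2 w (deriven_on w p f)].

Definition in_Cr w (r : nat) f : Prop :=
  (forall i, (i < r)%N -> derivable_on w (deriven_on w i f)) /\
  {within `[0, w], continuous (deriven_on w r f : R -> R[i]^o)}.

(* Same shape as [variation] and [bounded_variation] of numfun, which are
   restricted to real-valued functions. *)
Definition cvariation f (s : seq R) : R :=
  \sum_(x <- zip (0 :: s) s) Normc.normc (f x.2 - f x.1).

Definition cbounded_variation w f : Prop :=
  has_ubound [set cvariation f s | s in itv_partition 0 w].

End regularity.

(* An unbounded operator on L_2[0, w] is given by its domain [D] and its
   action [T] on representatives. *)
Section operators.
Context {R : realType}.
Variables (w : R) (D : set (R -> R[i])) (T : (R -> R[i]) -> (R -> R[i])).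
Implicit Types (l : R[i]) (y z f : R -> R[i]).

Definition shifted l y : R -> R[i] := fun t => T y t - l * y t.

(* T - l is a bijection of D onto L_2[0, w] with bounded inverse. *)
Definition resolvent_set : set R[i]^o := [set l |
  (forall f, in_L2 w f -> exists y,
     [/\ D y, ae_eq_on w (shifted l y) f &
         forall z, D z -> ae_eq_on w (shifted l z) f -> ae_eq_on w z y]) /\
  (exists M : R, forall y, D y -> norm_L2 w y <= M * norm_L2 w (shifted l y))].

Definition spectrum : set R[i]^o := ~` resolvent_set.

Definition eigenvalue l : Prop :=
  exists y, [/\ D y, ~ ae_eq_on w y (fun=> 0) &
                ae_eq_on w (T y) (fun t => l * y t)].

(* y lies in the kernel of (T - l)^p for some p; z i represents (T - l)^i y. *)
Definition root_vector l y : Prop :=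
  exists (p : nat) (z : nat -> R -> R[i]),
    [/\ z 0%N = y, ae_eq_on w (z p) (fun=> 0) &
        forall i, (i < p)%N ->
          D (z i) /\ ae_eq_on w (shifted l (z i)) (z i.+1)].

Definition finite_alg_mult l : Prop :=
  exists (d : nat) (e : 'I_d -> R -> R[i]),
    forall y, root_vector l y ->
      exists c : 'I_d -> R[i], ae_eq_on w y (fun t => \sum_(i < d) c i * e i t).

Definition discrete_spectrum : Prop :=
  limit_point spectrum = set0 /\
  forall l, spectrum l ->
    [/\ isolated spectrum l, eigenvalue l & finite_alg_mult l].

End operators.

Section Dirichlet.
Context {R : realType}.
Variables (k : nat) (w : R) (q : R -> R[i]).

Definition D_dir : set (R -> R[i]) := [set y |
  in_Sobolev w (2 * k) y /\
  forall i, (i < k)%N ->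
    deriven_on w (2 * i) y 0 = 0 /\ deriven_on w (2 * i) y w = 0].

Definition L_dir (y : R -> R[i]) : R -> R[i] :=
  fun t => (-1) ^+ k * deriven_on w (2 * k) y t - q t * y t.

Definition cos_coef (l : nat) : R[i] :=
  (Num.sqrt 2 / w)%:C *
  cintegral w (fun t => q t * (cos (pi * l%:R * t / w))%:C).

(* The terms are O(j^(-2k)), so the limit exists. *)
Definition correction_sum (n : nat) : R[i] :=
  limn ((fun N : nat => \sum_(1 <= j < N | j != n)
    (cos_coef `|n - j|%N - cos_coef (n + j)) ^+ 2
      / (j%:R ^+ (2 * k) - n%:R ^+ (2 * k))) : nat -> R[i]^o).

Definition lambda_main (n : nat) : R[i] :=
  ((pi * n%:R / w) ^+ (2 * k))%:C
  - w^-1%:C * cintegral w q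
  + w^-1%:C * cintegral w (fun t => q t * (cos (2 * pi * n%:R / w * t))%:C)
  - (w ^+ (2 * k) / (2 * pi ^+ (2 * k)))%:C * correction_sum n.

(* q, as an element of L_2[0, w], is of bounded variation or smooth. *)
Definition BV_or_smooth : Prop :=
  exists2 g : R -> R[i], ae_eq_on w q g &
    cbounded_variation w g \/ exists2 r : nat, (1 <= r)%N & in_Cr w r g.

End Dirichlet.

(* Main.v *)
(* In the basis s_j(t) = sin (pi (j+1) t / w) the operator acts on coefficient
   sequences as L v = (a_j v_j - sum_i B_ji v_i)_j with a_j = (pi (j+1) / w)^(2k) and
   the bounded symmetric matrix B_ji = (q~_|i-j| - q~_(i+j+2)) / sqrt 2.  Everything
   spectral is proved for L on the sequences with a_j |v_j| bounded.
   - Near a_n, lambda is an eigenvalue iff lambda = a_n - x_n(lambda), where x solves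
     x_j = B_jn + sum_(i <> n) B_ji x_i / (a_i - lambda).  The right-hand side is a
     contraction, which gives one eigenvalue lam n; expanding x to second order
     yields the displayed terms up to O(eps_n^2), where
     eps_n = sup_j sum_(i <> n) |B_ji| / |a_i - a_n| = O(n^(1-2k)) by Bessel's
     inequality.  The remainder is thus O(n^(2-4k)) for every q in L_2, so that
     beta_n = 1/n and the two estimates of the theorem coincide.
   - For c midway between a_(n-1) and a_n, the real part of (L - c - i s) v against
     (sgn (a_j - c) v_j)_j is positive.  By a Cayley transform the form
     sum_j sgn (a_j - c) |v_j|^2 is then negative on the span of the root vectors for
     eigenvalues with real part below c.  It is nonnegative on the sequences
     vanishing on the n coordinates with a_j < c, so this span has dimension <= n.
     This bounds the exceptional set and the algebraic multiplicities.
   - Functions and sequences are related by integration by parts (for absolutely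
     continuous functions, through the Radon-Nikodym derivative of the
     Lebesgue-Stieltjes measures of their variation), by completeness of the sines
     and by iterating the Green function of y'' = g, y(0) = y(w) = 0. *)

(* Since q is complex, B is symmetric but not Hermitian, so neither min-max nor an orthogonal
   eigenbasis can number the eigenvalues. Yet the theorem needs an exact count: at most m points
   besides the numbered ones. The indefinite form gives it without contour integrals or Riesz
   projections: its negative index is the number of diagonal entries left of the cut, and positivity
   only asks B to be small against the gaps there. The Cayley step replaces the semigroup of the
   usual Lyapunov inertia argument; on finite spans of root vectors it is pure algebra. The
   smallness used everywhere is M theta_n <= 1/4, where theta_n bounds the sum of the reciprocal
   half gaps at a_n. It is O(n^(2-2k)), so k > 1 makes it tend to 0, and this determines m.
   Sequences with a_j |v_j| bounded replace l_2: since 1/a_j is summable they are absolutely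
   summable, so a bounded B acts on them termwise, and after the rescaling x_j = a_j v_j the
   operator L - l is the identity minus a kernel with summably dominated columns. Functions in the
   domain have such coefficients because those of y^(2k) are bounded. *)
Require Import Defs.
From HB Require Import structures.
From mathcomp Require Import measurable_realfun ring lra zify.
Import Order.TTheory GRing.Theory Num.Theory.
Import numFieldNormedType.Exports.
Set Implicit Arguments.
Unset Strict Implicit.
Unset Printing Implicit Defensive.
Local Open Scope classical_set_scope.
Local Open Scope ring_scope.
Local Open Scope complex_scope.

(** * Moduli and limits of complex numbers *)

Notation normc := Normc.normc.

Section complex_facts.
Context {R : realType}.
Implicit Types (x y z : R[i]) (r : R).

Lemma cReD x y : complex.Re (x + y) = complex.Re x + complex.Re y.
Proof. by case: x => a b; case: y. Qed.
Lemma cImD x y : complex.Im (x + y) = complex.Im x + complex.Im y.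
Proof. by case: x => a b; case: y. Qed.
Lemma cReN x : complex.Re (- x) = - complex.Re x. Proof. by case: x. Qed.
Lemma cImN x : complex.Im (- x) = - complex.Im x. Proof. by case: x. Qed.
Lemma cReB x y : complex.Re (x - y) = complex.Re x - complex.Re y.
Proof. by rewrite cReD cReN. Qed.
Lemma cImB x y : complex.Im (x - y) = complex.Im x - complex.Im y.
Proof. by rewrite cImD cImN. Qed.
Lemma cReM x y : complex.Re (x * y) =
  complex.Re x * complex.Re y - complex.Im x * complex.Im y.
Proof. by case: x => a b; case: y. Qed.
Lemma cImM x y : complex.Im (x * y) =
  complex.Re x * complex.Im y + complex.Im x * complex.Re y.
Proof. by case: x => a b; case: y => c d /=; rewrite mulrC. Qed.
Lemma cRe0 : complex.Re (0 : R[i]) = 0. Proof. by []. Qed.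
Lemma cIm0 : complex.Im (0 : R[i]) = 0. Proof. by []. Qed.
Lemma cReJ x : complex.Re x^* = complex.Re x. Proof. by case: x. Qed.
Lemma cImJ x : complex.Im x^* = - complex.Im x. Proof. by case: x. Qed.
Lemma cRe_real r : complex.Re r%:C = r. Proof. by []. Qed.
Lemma cRe_sum I (s : seq I) (P : pred I) (f : I -> R[i]) :
  complex.Re (\sum_(i <- s | P i) f i) = \sum_(i <- s | P i) complex.Re (f i).
Proof. exact: (big_morph (@complex.Re R) cReD cRe0). Qed.
Lemma cIm_sum I (s : seq I) (P : pred I) (f : I -> R[i]) :
  complex.Im (\sum_(i <- s | P i) f i) = \sum_(i <- s | P i) complex.Im (f i).
Proof. exact: (big_morph (@complex.Im R) cImD cIm0). Qed.

Lemma complex_ext x y :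
  complex.Re x = complex.Re y -> complex.Im x = complex.Im y -> x = y.
Proof. by case: x => a b; case: y => c d /= -> ->. Qed.

Lemma normrcE x : `|x| = (normc x)%:C. Proof. by case: x. Qed.

Lemma normc_ge0 x : 0 <= normc x.
Proof. by case: x => a b; exact: sqrtr_ge0. Qed.
Lemma normc0 : normc (0 : R[i]) = 0. Proof. exact: Normc.normc0. Qed.
Lemma normc_eq0 x : (normc x == 0) = (x == 0).
Proof. by apply/eqP/eqP => [/Normc.eq0_normc//|->]; exact: normc0. Qed.
Lemma normcM x y : normc (x * y) = normc x * normc y.
Proof. exact: Normc.normcM. Qed.
Lemma normcV x : normc x^-1 = (normc x)^-1.
Proof. exact: Normc.normcV. Qed.
Lemma normcf x y : normc (x / y) = normc x / normc y.
Proof. by rewrite normcM normcV. Qed.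
Lemma normcD x y : normc (x + y) <= normc x + normc y.
Proof. exact: le_normcD. Qed.
Lemma normcN x : normc (- x) = normc x. Proof. exact: normcN. Qed.
Lemma normcB x y : normc (x - y) <= normc x + normc y.
Proof. by rewrite -(normcN y) normcD. Qed.
Lemma normcBC x y : normc (x - y) = normc (y - x).
Proof. by rewrite -normcN opprB. Qed.
Lemma normc_real r : normc r%:C = `|r|.
Proof. by rewrite /normc /= expr0n /= addr0 sqrtr_sqr. Qed.
Lemma normcJ x : normc x^* = normc x.
Proof. by case: x => a b /=; rewrite sqrrN. Qed.
Lemma normc_sqr x : normc x ^+ 2 = complex.Re x ^+ 2 + complex.Im x ^+ 2.
Proof. by case: x => a b /=; rewrite sqr_sqrtr// addr_ge0 ?sqr_ge0. Qed.
Lemma normc_gt0 x : x != 0 -> 0 < normc x.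
Proof. by move=> x0; rewrite lt_neqAle normc_ge0 eq_sym normc_eq0 x0. Qed.

Lemma ler_Re x : `|complex.Re x| <= normc x.
Proof.
rewrite -(@ler_pXn2r _ 2%N) ?nnegrE ?normc_ge0//.
by rewrite normc_sqr real_normK ?num_real// lerDl sqr_ge0.
Qed.
Lemma ler_Im x : `|complex.Im x| <= normc x.
Proof.
rewrite -(@ler_pXn2r _ 2%N) ?nnegrE ?normc_ge0//.
by rewrite normc_sqr real_normK ?num_real// lerDr sqr_ge0.
Qed.
Lemma normc_le_ReIm x : normc x <= `|complex.Re x| + `|complex.Im x|.
Proof.
case: x => a b /=; rewrite -[leRHS]ger0_norm ?addr_ge0// -[leRHS]sqrtr_sqr.
apply: ler_wsqrtr; rewrite sqrrD !real_normK ?num_real// -addrA lerD2l lerDr.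
by rewrite mulrn_wge0// mulr_ge0.
Qed.

Lemma normc_sum I (s : seq I) (P : pred I) (f : I -> R[i]) :
  normc (\sum_(i <- s | P i) f i) <= \sum_(i <- s | P i) normc (f i).
Proof.
elim/big_ind2 : _ => //; first by rewrite normc0.
by move=> x a y b hx hy; rewrite (le_trans (normcD _ _))// lerD.
Qed.

Lemma normc_small x : (forall e : R, 0 < e -> normc x <= e) -> x = 0.
Proof.
move=> h; apply/eqP; rewrite -normc_eq0 eq_le normc_ge0 andbT.
apply/ler_addgt0Pl => e e0; rewrite addr0; exact: h.
Qed.

End complex_facts.

Section complex_limits.
Context {R : realType}.

(** A positive element of [R[i]] has zero imaginary part in its partial order, so the radii of the
    complex topology are exactly the positive reals. *)
Lemma cvg_normcP {T : Type} (F : set_system T) {FF : Filter F} (f : T -> R[i])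
    (z : R[i]) :
  (f x @[x --> F] --> (z : R[i]^o)) <->
  (forall e : R, 0 < e -> \forall x \near F, normc (f x - z) < e).
Proof.
have E := @cvgrPdist_lt R[i] R[i]^o T F FF f z.
split=> [/E h e e0|h].
  have e0' : (0 : R[i]) < e%:C by rewrite ltcR.
  have := h _ e0'; apply: filterS => x /=.
  by rewrite distrC normrcE ltcR.
apply/E => e; rewrite ltcE /= => /andP[/eqP ie re].
have := h _ re; apply: filterS => x hx.
by rewrite distrC normrcE ltcE /= -ie eqxx.
Qed.

Lemma cvg_ReImP {T : Type} (F : set_system T) {FF : Filter F} (f : T -> R[i])
    (z : R[i]) :
  (f x @[x --> F] --> (z : R[i]^o)) <->
  (complex.Re (f x) @[x --> F] --> complex.Re z) /\
  (complex.Im (f x) @[x --> F] --> complex.Im z).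
Proof.
split=> [/cvg_normcP h|[/cvgrPdist_lt hr /cvgrPdist_lt hi]].
  split; apply/cvgrPdist_lt => e e0; have := h _ e0; apply: filterS => x.
    by apply: le_lt_trans; rewrite distrC -cReB ler_Re.
  by apply: le_lt_trans; rewrite distrC -cImB ler_Im.
apply/cvg_normcP => e e0; have e2 : 0 < e / 2 by rewrite divr_gt0.
near=> x.
rewrite (le_lt_trans (normc_le_ReIm _))// cReB cImB (splitr e) ltrD//.
  by rewrite distrC; near: x; exact: hr.
by rewrite distrC; near: x; exact: hi.
Unshelve. all: by end_near. Qed.

Lemma normc_cvg_unique {T : Type} (F : set_system T) {FF : ProperFilter F}
    (f : T -> R[i]) (z z' : R[i]) :
  (f x @[x --> F] --> (z : R[i]^o)) -> (f x @[x --> F] --> (z' : R[i]^o)) ->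
  z = z'.
Proof.
move=> h h'; rewrite -(cvg_lim (@norm_hausdorff _ R[i]^o) h).
exact: (cvg_lim (@norm_hausdorff _ R[i]^o) h').
Qed.

End complex_limits.

(** * Infinite matrices on bounded sequences *)

Section series_sums.
Context {R : realType}.
Implicit Types (u v : nat -> R[i]) (f g : nat -> R) (c d : R).

(** Sums are total, with a default value on divergence. Convergence is carried by [csummable],
    together with the explicit bound [c] that the estimates need. *)
Definition rsum f : R := limn (series f).
Definition csum u : R[i] :=
  rsum (fun i => complex.Re (u i)) +i* rsum (fun i => complex.Im (u i)).
Definition rsummable f c := forall N, \sum_(i < N) `|f i| <= c.
Definition csummable u c := forall N, \sum_(i < N) normc (u i) <= c.

Lemma rsum_cvg f c : rsummable f c ->
  \sum_(i < N) f i @[N --> \oo] --> rsum f.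
Proof.
move=> h; have : cvgn (series f).
  apply: normed_cvg; apply: nondecreasing_is_cvgn.
    by apply: nondecreasing_series => i _ _; exact: normr_ge0.
  by exists c => _ [N _ <-]; have := h N; rewrite -(big_mkord xpredT (fun i => `|f i|)).
have -> : (fun N => \sum_(i < N) f i) = series f.
  by apply/funext => N; rewrite /series /= big_mkord.
exact.
Qed.

Lemma csummable_ge0 u c : csummable u c -> 0 <= c.
Proof. by move/(_ 0%N); rewrite big_ord0. Qed.

Lemma csummable_Re u c : csummable u c -> rsummable (fun i => complex.Re (u i)) c.
Proof. by move=> h N; apply: le_trans (h N); apply: ler_sum => i _; exact: ler_Re. Qed.
Lemma csummable_Im u c : csummable u c -> rsummable (fun i => complex.Im (u i)) c.
Proof. by move=> h N; apply: le_trans (h N); apply: ler_sum => i _; exact: ler_Im. Qed.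

Lemma csum_cvg u c : csummable u c ->
  \sum_(i < N) u i @[N --> \oo] --> (csum u : R[i]^o).
Proof.
move=> h; apply/cvg_ReImP; split.
  rewrite (_ : (fun N => _) = fun N => \sum_(i < N) complex.Re (u i)); last first.
    by apply/funext => N; rewrite cRe_sum.
  exact: rsum_cvg (csummable_Re h).
rewrite (_ : (fun N => _) = fun N => \sum_(i < N) complex.Im (u i)); last first.
  by apply/funext => N; rewrite cIm_sum.
exact: rsum_cvg (csummable_Im h).
Qed.

Lemma csum_unique u c z : csummable u c ->
  (forall e : R, 0 < e -> exists N0, forall N, (N0 <= N)%N ->
     normc (\sum_(i < N) u i - z) < e) -> csum u = z.
Proof.
move=> h hz; apply: normc_cvg_unique (csum_cvg h) _.
by apply/cvg_normcP => e /hz[N0 h0]; exists N0 => // N /= /h0.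
Qed.

Lemma csum_near u c (e : R) : csummable u c -> 0 < e ->
  exists N0, forall N, (N0 <= N)%N -> normc (\sum_(i < N) u i - csum u) < e.
Proof.
move=> /csum_cvg/cvg_normcP h /h [N0 _ h0]; exists N0 => N; exact: h0.
Qed.

Lemma csum_le u c : csummable u c -> normc (csum u) <= c.
Proof.
move=> h; apply/ler_addgt0Pl => e e0.
have [N0 /(_ N0 (leqnn _)) hN] := csum_near h e0.
rewrite -(subrK (\sum_(i < N0) u i) (csum u)) (le_trans (normcD _ _))//.
rewrite lerD//; first by rewrite normcBC ltW.
exact: le_trans (normc_sum _ _ _) (h _).
Qed.

Lemma csummableZ u c z : csummable u c -> csummable (fun i => z * u i) (normc z * c).
Proof.
move=> h N; under eq_bigr do rewrite normcM.
by rewrite -mulr_sumr ler_wpM2l ?normc_ge0.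
Qed.

Lemma csummableD u v c d : csummable u c -> csummable v d ->
  csummable (fun i => u i + v i) (c + d).
Proof.
move=> h h' N; apply: le_trans (lerD (h N) (h' N)).
by rewrite -big_split; apply: ler_sum => i _; exact: normcD.
Qed.

Lemma csummable_dom u f c : (forall i, normc (u i) <= f i) ->
  (forall N, \sum_(i < N) f i <= c) -> csummable u c.
Proof. by move=> uf fc N; apply: le_trans (fc N); apply: ler_sum. Qed.

Lemma csumD u v c d : csummable u c -> csummable v d ->
  csum (fun i => u i + v i) = csum u + csum v.
Proof.
move=> h h'; apply: (csum_unique (csummableD h h')) => e e0.
have e2 : 0 < e / 2 by rewrite divr_gt0.
have [N1 h1] := csum_near h e2; have [N2 h2] := csum_near h' e2.
exists (maxn N1 N2) => N; rewrite geq_max => /andP[/h1 {}h1 /h2 {}h2].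
rewrite big_split /= opprD addrACA (le_lt_trans (normcD _ _))//.
by rewrite (splitr e) ltrD.
Qed.

Lemma csumZ u c z : csummable u c -> csum (fun i => z * u i) = z * csum u.
Proof.
move=> h; apply: (csum_unique (csummableZ z h)) => e e0.
have e2 : 0 < e / (normc z + 1) by rewrite divr_gt0// ltr_wpDl ?normc_ge0.
have [N1 h1] := csum_near h e2; exists N1 => N /h1 {}h1.
rewrite -mulr_sumr -mulrBr normcM.
rewrite ltr_pdivlMr ?ltr_wpDl ?normc_ge0// in h1.
apply: le_lt_trans h1; rewrite mulrC ler_wpM2l ?normc_ge0//.
by rewrite lerDl.
Qed.

Lemma csumB u v c d : csummable u c -> csummable v d ->
  csum (fun i => u i - v i) = csum u - csum v.
Proof.
move=> h h'; rewrite -mulN1r -(csumZ _ h').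
rewrite -(csumD h (csummableZ (-1) h')).
by congr csum; apply/funext => i; rewrite mulN1r.
Qed.

Lemma csum0 : csum (fun=> 0) = 0.
Proof.
have h : csummable (fun=> 0) 0 by move=> N; rewrite big1// => i _; rewrite normc0.
by apply: (csum_unique h) => e e0; exists 0%N => N _; rewrite big1// subr0 normc0.
Qed.

Lemma csummable_sum n (d : 'I_n -> nat -> R[i]) : (forall p, exists c, csummable (d p) c) ->
  exists c, csummable (fun i => \sum_(p < n) d p i) c.
Proof.
elim: n d => [|n ih] d h.
  exists 0 => N; rewrite big1// => i _; by rewrite big_ord0 normc0.
have [c1 h1] := ih (fun p => d (widen_ord (leqnSn n) p)) (fun p => h _).
have [c2 h2] := h ord_max.
exists (c1 + c2); have := csummableD h1 h2; congr csummable.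
by apply/funext => i; rewrite big_ord_recr.
Qed.

Lemma csum_sum n (d : 'I_n -> nat -> R[i]) : (forall p, exists c, csummable (d p) c) ->
  csum (fun i => \sum_(p < n) d p i) = \sum_(p < n) csum (d p).
Proof.
elim: n d => [|n ih] d h.
  by rewrite big_ord0 -[RHS]csum0; congr csum; apply/funext => i; rewrite big_ord0.
have hw p := h (widen_ord (leqnSn n) p).
have [c1 h1] := csummable_sum hw; have [c2 h2] := h ord_max.
rewrite big_ord_recr /= -(ih _ hw) -(csumD h1 h2).
by congr csum; apply/funext => i; rewrite big_ord_recr.
Qed.

Lemma sum_ord_trunc (V : nmodType) (F : nat -> V) n N : (n <= N)%N ->
  \sum_(i < N) (if (i < n)%N then F i else 0) = \sum_(i < n) F i.
Proof.
move=> nN; rewrite -big_mkcond /=.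
rewrite -(big_mkord (fun i => (i < n)%N) F) -(big_mkord xpredT F).
rewrite [in RHS](big_nat_widen _ _ _ _ _ nN) [RHS]big_mkcond [LHS]big_mkcond /=.
by apply: eq_bigr.
Qed.

Lemma csum_fin u n : csum (fun i => if (i < n)%N then u i else 0) = \sum_(i < n) u i.
Proof.
have h : csummable (fun i => if (i < n)%N then u i else 0) (\sum_(i < n) normc (u i)).
  move=> N; rewrite -(sum_ord_trunc (fun i => normc (u i)) (leq_maxr N n)).
  rewrite -(big_mkord xpredT (fun i => normc (if (i < n)%N then u i else 0))).
  rewrite -(big_mkord xpredT (fun i => if (i < n)%N then normc (u i) else 0)).
  rewrite [leRHS](@big_cat_nat _ _ _ N) ?leq_maxl//= -[leLHS]addr0 lerD//.
    by apply: ler_sum => i _; case: ifP; rewrite ?normc0.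
  by apply: sumr_ge0 => i _; case: ifP; rewrite ?normc_ge0.
apply: (csum_unique h) => e e0; exists n => N nN.
by rewrite sum_ord_trunc// subrr normc0.
Qed.

Lemma csummable_mask u c (P : pred nat) : csummable u c ->
  csummable (fun i => if P i then u i else 0) c.
Proof.
move=> h N; apply: le_trans (h N); apply: ler_sum => i _.
by case: ifP => _; rewrite ?normc0 ?normc_ge0.
Qed.

Lemma csum_split u c n : csummable u c ->
  csum u = \sum_(i < n) u i + csum (fun i => if (i < n)%N then 0 else u i).
Proof.
move=> h; rewrite -csum_fin.
have -> : (fun i => if (i < n)%N then 0 else u i) =
          (fun i => if ~~ (i < n)%N then u i else 0).
  by apply/funext => i; case: ifP.
rewrite -(csumD (csummable_mask (fun i => i < n)%N h)
               (csummable_mask (fun i => ~~ (i < n)%N) h)).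
by congr csum; apply/funext => i; case: ifP; rewrite /= ?addr0 ?add0r.
Qed.

Lemma csum_delta u n : (forall i, i != n -> u i = 0) -> csum u = u n.
Proof.
move=> h; have -> : u = fun i => if (i < n.+1)%N then u i else 0.
  apply/funext => i; case: ifP => // /negbT; rewrite -leqNgt => ni.
  by rewrite h// gtn_eqF.
rewrite csum_fin ltnSn big_ord_recr /= big1 ?add0r// => i _.
by rewrite h// ltn_eqF.
Qed.

End series_sums.

Lemma half_pow_small {R : realType} (c e : R) : 0 < e -> exists P, c / 2 ^+ P <= e.
Proof.
move=> e0; exists (Num.bound (c / e)).
rewrite ler_pdivrMr ?exprn_gt0// mulrC -ler_pdivrMr//.
by rewrite ltW//; apply: upper_nthrootP.
Qed.

(** * Neumann series and the Fredholm alternative for dominated kernels *)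

Section kernels.
Context {R : realType}.
Implicit Types (x y b : nat -> R[i]) (K : nat -> nat -> R[i]) (c theta : R).

Definition bounded x c := forall i, normc (x i) <= c.
Definition kapp K x (j : nat) : R[i] := csum (fun i => K j i * x i).
(* Row-wise domination by one summable sequence: K maps bounded sequences to bounded
   ones and can be approximated in norm by kernels with finitely many columns. *)
Definition kdom K (kap : nat -> R) theta :=
  (forall j i, normc (K j i) <= kap i) /\ forall N, \sum_(i < N) kap i <= theta.

Lemma bounded_ge0 x c : bounded x c -> 0 <= c.
Proof. by move/(_ 0%N); apply: le_trans; exact: normc_ge0. Qed.

Lemma boundedD x y c d : bounded x c -> bounded y d ->
  bounded (fun i => x i + y i) (c + d).
Proof. by move=> h h' i; rewrite (le_trans (normcD _ _))// lerD. Qed.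

Lemma boundedB x y c d : bounded x c -> bounded y d ->
  bounded (fun i => x i - y i) (c + d).
Proof. by move=> h h' i; rewrite (le_trans (normcB _ _))// lerD. Qed.

Lemma boundedZ x c z : bounded x c -> bounded (fun i => z * x i) (normc z * c).
Proof. by move=> h i; rewrite normcM ler_wpM2l ?normc_ge0. Qed.

Lemma bounded_sum n (d : nat -> nat -> R[i]) :
  (forall p, exists c, bounded (d p) c) ->
  exists c, bounded (fun i => \sum_(p < n) d p i) c.
Proof.
move=> h; elim: n => [|n [c hc]].
  by exists 0 => i; rewrite big_ord0 normc0.
have [c' hc'] := h n; exists (c + c') => i.
by rewrite big_ord_recr /=; exact: (boundedD hc hc' i).
Qed.

Section dominated.
Variables (K : nat -> nat -> R[i]) (kap : nat -> R) (theta : R).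
Hypothesis hK : kdom K kap theta.

Lemma kapp_summable x c j : bounded x c -> csummable (fun i => K j i * x i) (theta * c).
Proof.
move=> hx; apply: (@csummable_dom _ _ (fun i => kap i * c)) => [i|N].
  by rewrite normcM ler_pM ?normc_ge0// hK.1.
by rewrite -mulr_suml ler_wpM2r ?(bounded_ge0 hx)// hK.2.
Qed.

Lemma kapp_bounded x c : bounded x c -> bounded (kapp K x) (theta * c).
Proof. by move=> hx j; apply: csum_le; exact: kapp_summable. Qed.

Lemma kappD x y c d j : bounded x c -> bounded y d ->
  kapp K (fun i => x i + y i) j = kapp K x j + kapp K y j.
Proof.
move=> hx hy; rewrite /kapp -(csumD (kapp_summable j hx) (kapp_summable j hy)).
by congr csum; apply/funext => i; rewrite mulrDr.
Qed.

Lemma kappZ x c z j : bounded x c -> kapp K (fun i => z * x i) j = z * kapp K x j.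
Proof.
move=> hx; rewrite /kapp -(csumZ _ (kapp_summable j hx)).
by congr csum; apply/funext => i; rewrite mulrCA.
Qed.

Lemma kappB x y c d j : bounded x c -> bounded y d ->
  kapp K (fun i => x i - y i) j = kapp K x j - kapp K y j.
Proof.
move=> hx hy; rewrite -mulN1r -(kappZ _ _ hy).
rewrite -(kappD _ hx (boundedZ (-1) hy)).
by congr (kapp K _ j); apply/funext => i; rewrite mulN1r.
Qed.

Lemma kapp0 j : kapp K (fun=> 0) j = 0.
Proof. by rewrite /kapp -[RHS](@csum0 R); congr csum; apply/funext => i; rewrite mulr0. Qed.

Lemma kapp_sum n (d : nat -> nat -> R[i]) j :
  (forall p, exists c, bounded (d p) c) ->
  kapp K (fun i => \sum_(p < n) d p i) j = \sum_(p < n) kapp K (d p) j.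
Proof.
move=> h; elim: n => [|n ih].
  rewrite big_ord0 -[RHS](kapp0 j); congr (kapp K _ j).
  by apply/funext => i; rewrite big_ord0.
have [c hc] := bounded_sum n h; have [c' hc'] := h n.
rewrite big_ord_recr /= -ih -(kappD j hc hc').
by congr (kapp K _ j); apply/funext => i; rewrite big_ord_recr.
Qed.

End dominated.

Lemma geometric_tail (c : R) n N : 0 <= c ->
  \sum_(p < N) (if (p < n)%N then 0 else c / 2 ^+ p) <= 2 * c / 2 ^+ n.
Proof.
(* The bound alone is not stable under adding a term; the induction carries the exact value of the
   partial tail. *)
move=> c0; have h : \sum_(p < N) (if (p < n)%N then 0 else c / 2 ^+ p) <=
    if (N <= n)%N then 0 else 2 * c / 2 ^+ n - 2 * c / 2 ^+ N.
  elim: N => [|N ih]; first by rewrite big_ord0 leq0n.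
  rewrite big_ord_recr /=; case: (ltngtP N n) ih => [Nn|nN|->] ih.
  - by rewrite addr0.
  - rewrite (le_trans (lerD ih (lexx _)))// exprS.
    have : (2 : R) ^+ N != 0 by rewrite expf_neq0.
    move=> h2; rewrite -addrA lerD2l.
    by rewrite le_eqVlt; apply/orP; left; apply/eqP; field.
  - rewrite (le_trans (lerD ih (lexx _)))// add0r exprS.
    have : (2 : R) ^+ n != 0 by rewrite expf_neq0.
    by move=> h2; rewrite le_eqVlt; apply/orP; left; apply/eqP; field.
apply: le_trans h _; case: ifP => _.
  by rewrite divr_ge0 ?exprn_ge0// mulr_ge0.
by rewrite gerBl divr_ge0 ?exprn_ge0// mulr_ge0.
Qed.

Section small.
Variables (K : nat -> nat -> R[i]) (kap : nat -> R) (theta : R).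
Hypothesis hK : kdom K kap theta.
Hypothesis htheta : theta <= 1 / 2.

Lemma kapp_half x c : bounded x c -> bounded (kapp K x) (c / 2).
Proof.
move=> hx j; apply: le_trans (kapp_bounded hK hx j) _.
by rewrite mulrC ler_wpM2l ?(bounded_ge0 hx)// -div1r.
Qed.

Lemma kapp_fix0 x c : bounded x c -> (forall j, x j = kapp K x j) -> forall j, x j = 0.
Proof.
move=> hx hfix j; apply: normc_small => e e0.
have hp p : bounded x (c / 2 ^+ p).
  elim: p => [|p ih]; first by rewrite expr0 divr1.
  move=> i; rewrite hfix exprSr invfM mulrA; exact: kapp_half.
by have [P hP] := half_pow_small c e0; exact: le_trans (hp P j) hP.
Qed.

Lemma neumann b c : bounded b c ->
  exists2 x, bounded x (2 * c) & forall j, x j = b j + kapp K x j.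
Proof.
move=> hb; have c0 := bounded_ge0 hb.
pose d p := iter p (kapp K) b.
have hd p : bounded (d p) (c / 2 ^+ p).
  elim: p => [|p ih]; first by rewrite expr0 divr1.
  rewrite exprSr invfM mulrA; exact: kapp_half.
have sd j : csummable (fun p => d p j) (2 * c).
  apply: (csummable_dom (fun p => hd p j)) => N.
  by have := @geometric_tail c 0 N c0; rewrite expr0 divr1.
pose x j := csum (fun p => d p j).
have hx : bounded x (2 * c) by move=> j; exact: csum_le.
exists x => // j; apply/eqP; rewrite -subr_eq0; apply/eqP; apply: normc_small => e e0.
pose r P i := x i - \sum_(p < P) d p i.
have hr P : bounded (r P) (2 * c / 2 ^+ P).
  move=> i; rewrite /r /x (csum_split P (sd i)) addrAC subrr add0r.
  apply: csum_le; apply: (@csummable_dom _ _ (fun p => if (p < P)%N then 0 else c / 2 ^+ p)).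
    by move=> p; case: ifP => _; rewrite ?normc0// hd.
  by move=> N; exact: geometric_tail.
have [P hP] := half_pow_small (2 * c) e0.
have hs := bounded_sum P (fun p => ex_intro _ _ (hd p)).
(* The defect of the series in the equation is a combination of two geometric remainders, hence
   arbitrarily small. *)
have -> : x j - (b j + kapp K x j) = r P.+1 j - kapp K (r P) j.
  have -> : kapp K x j = kapp K (r P) j + \sum_(p < P) d p.+1 j.
    have [c' hc'] := hs.
    transitivity (kapp K (fun i => r P i + \sum_(p < P) d p i) j).
      by congr (kapp K _ j); apply/funext => i; rewrite subrK.
    rewrite (kappD hK _ (hr P) hc') (kapp_sum hK)// => p.
    by eexists; exact: hd.
  by rewrite /r big_ord_recl /=; under eq_bigr do rewrite /bump /=; ring.
apply: le_trans (normcB _ _) _; apply: le_trans (lerD (hr _ _) (kapp_half (hr P) _)) _.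
apply: le_trans hP; rewrite exprSr.
have h2 : (2 : R) ^+ P != 0 by rewrite expf_neq0.
by rewrite le_eqVlt; apply/orP; left; apply/eqP; field.
Qed.

(** By uniqueness any bounded solution is the Neumann solution and inherits its bound, whatever
    bound it came with. *)
Lemma kapp_inv_bounded x b c c0 : bounded x c0 -> bounded b c ->
  (forall j, x j = b j + kapp K x j) -> bounded x (2 * c).
Proof.
move=> hx hb e; have [y hy ey] := neumann hb.
suff xy : forall j, x j - y j = 0.
  by move=> j; have /eqP := xy j; rewrite subr_eq0 => /eqP ->.
apply: (kapp_fix0 (boundedB hx hy)) => j /=.
by rewrite (kappB hK _ hx hy) {1}e {1}ey; ring.
Qed.

End small.

Lemma small_tail (kap : nat -> R) theta (e : R) : 0 < e -> (forall i, 0 <= kap i) ->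
  (forall N, \sum_(i < N) kap i <= theta) ->
  exists n, forall N, \sum_(i < N) (if (i < n)%N then 0 else kap i) <= e.
Proof.
move=> e0 k0 kt; pose S := [set \sum_(i < N) kap i | N in setT].
have hS : has_sup S.
  by split; [exists (\sum_(i < 0) kap i), 0%N|exists theta => _ [N _ <-]].
have [_ [n _ <-] hn] := sup_adherent e0 hS; exists n => N.
have [Nn|nN] := leqP N n.
  by rewrite big1 ?ltW// => i _; rewrite (leq_trans (ltn_ord i)).
have : \sum_(i < N) kap i <= sup S by apply: ub_le_sup; [exact: hS.2|exists N].
have -> : \sum_(i < N) kap i = \sum_(i < n) kap i +
    \sum_(i < N) (if (i < n)%N then 0 else kap i).
  rewrite -(sum_ord_trunc kap (ltnW nN)) -big_split; apply: eq_bigr => i _ /=.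
  by case: ifP; rewrite ?addr0 ?add0r.
lra.
Qed.

(* The columns beyond some n form a contraction; the Schur complement on the
   first n coordinates is an n x n matrix, injective hence invertible. *)
Lemma fredholm K (kap : nat -> R) theta : kdom K kap theta ->
  (forall x c, bounded x c -> (forall j, x j = kapp K x j) -> forall j, x j = 0) ->
  exists2 C : R, 0 <= C & forall b c, bounded b c ->
    exists2 x, bounded x (C * c) & forall j, x j = b j + kapp K x j.
Proof.
move=> hK inj; have k0 i : 0 <= kap i by apply: le_trans (normc_ge0 _) (hK.1 0%N i).
have [|n hn] := @small_tail kap theta (1 / 2) _ k0 hK.2; first by rewrite divr_gt0.
pose K' j i := if (i < n)%N then 0 else K j i.
have hK' : kdom K' (fun i => if (i < n)%N then 0 else kap i) (1 / 2).
  by split => // j i; rewrite /K'; case: ifP => _; rewrite ?normc0// hK.1.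
have KK' x c j : bounded x c ->
    kapp K x j = \sum_(i < n) x i * K j i + kapp K' x j.
  move=> hx; rewrite /kapp (csum_split n (kapp_summable hK j hx)).
  congr (_ + _); first by apply: eq_bigr => i _; rewrite mulrC.
  by congr csum; apply/funext => i; rewrite /K'; case: ifP; rewrite ?mul0r.
have hcol i : bounded (K ^~ i) (kap i) by move=> j; exact: hK.1.
have /choice[r hr] i : exists y, bounded y (2 * kap i) /\
    forall j, y j = K j i + kapp K' y j.
  by have [y hy e] := neumann hK' (lexx _) (hcol i); exists y.
(* With r_i solving r_i = K_i + K' r_i for the column K_i, a solution has the form x = y + sum_(i <
   n) xi_i r_i with xi_i = x_i; these n consistency conditions read xi A = y. *)
pose A : 'M[R[i]]_n := \matrix_(i, j) ((i == j)%:R - r i j).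
have comb (xi : 'I_n -> R[i]) : exists c,
    bounded (fun j => \sum_(i < n) xi i * r i j) c /\
    forall j, kapp K' (fun j => \sum_(i < n) xi i * r i j) j =
              \sum_(i < n) xi i * (r i j - K j i).
  pose xi' i := if insub i is Some i' then xi i' else 0.
  have e : (fun j => \sum_(i < n) xi i * r i j) =
           (fun j => \sum_(i < n) (xi' i * r i j)).
    by apply/funext => j; apply: eq_bigr => i _; rewrite /xi' valK.
  have hb i : exists c, bounded (fun j => xi' i * r i j) c.
    by eexists; apply: boundedZ; exact: (hr i).1.
  have [c hc] := bounded_sum n hb; exists c; rewrite e; split => // j.
  rewrite (kapp_sum hK' n j hb); apply: eq_bigr => i _.
  rewrite (kappZ hK' _ _ (hr i).1) /xi' valK; congr (_ * _).
  by apply/eqP; rewrite eq_sym subr_eq addrC; apply/eqP; exact: (hr i).2.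
have uA : A \in unitmx.
  rewrite unitmxE unitfE; apply/negP => /det0P[v v0 vA].
  pose x j := \sum_(i < n) v 0 i * r i j.
  have xv (j : 'I_n) : x j = v 0 j.
    have /matrixP/(_ 0 j) := vA; rewrite !mxE /=.
    under eq_bigr do rewrite mxE mulrBr.
    rewrite sumrB (bigD1 j)//= eqxx mulr1 big1 ?addr0; last first.
      by move=> i /negbTE ->; rewrite mulr0.
    by move/eqP; rewrite subr_eq0 => /eqP ->.
  have [c [hc hx]] := comb (fun i => v 0 i).
  have x0 : forall j, x j = 0.
    apply: (inj _ c hc) => j; rewrite (KK' _ _ _ hc) hx -big_split.
    by apply: eq_bigr => i _ /=; rewrite -/(x i) xv mulrBr addrC subrK.
  by case/eqP: v0; apply/rowP => j; rewrite mxE -xv x0.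
pose D : R := \sum_(i < n) \sum_(j < n) normc (invmx A i j).
have D0 : 0 <= D by apply: sumr_ge0 => i _; apply: sumr_ge0 => j _; exact: normc_ge0.
(* The 2 bounds y, 2 D bounds each coordinate of xi = y A^(-1), and 2 kap_i bounds r_i. *)
exists (2 + \sum_(i < n) 2 * D * (2 * kap i)).
  by rewrite addr_ge0//; apply: sumr_ge0 => i _; rewrite !mulr_ge0.
move=> b c hb; have c0 := bounded_ge0 hb.
have [y hy ey] := neumann hK' (lexx _) hb.
have [xi xiE] : {xi : 'rV[R[i]]_n | xi = (\row_j y j) *m invmx A} by eexists.
have exi (j : 'I_n) : xi 0 j = y j + \sum_(i < n) xi 0 i * r i j.
  have : xi *m A = \row_j y j by rewrite xiE mulmxKV.
  move/matrixP/(_ 0 j); rewrite [LHS]mxE [RHS]mxE.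
  under eq_bigr do rewrite mxE mulrBr.
  rewrite sumrB (bigD1 j)//= eqxx mulr1 big1 ?addr0; last first.
    by move=> i /negbTE ->; rewrite mulr0.
  by move=> <-; rewrite subrK.
have [d [hd ed]] := comb (fun i => xi 0 i).
pose x j := y j + \sum_(i < n) xi 0 i * r i j.
have hxd := boundedD hy hd.
exists x => [j|j].
  rewrite /x (le_trans (normcD _ _))// mulrDl lerD//.
  rewrite mulr_suml (le_trans (normc_sum _ _ _))//; apply: ler_sum => i _.
  rewrite normcM mulrAC ler_pM ?normc_ge0 ?(hr i).1//.
  rewrite xiE mxE (le_trans (normc_sum _ _ _))// [leRHS]mulrAC mulr_sumr.
  apply: ler_sum => l _; rewrite mxE normcM ler_pM ?normc_ge0//.
  by rewrite (bigD1 i)//= lerDl; apply: sumr_ge0 => p _; exact: normc_ge0.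
rewrite (KK' _ _ _ hxd) (kappD hK' _ hy hd) ed /x {1}ey.
have -> : \sum_(i < n) (y i + \sum_(l < n) xi 0 l * r l i) * K j i =
          \sum_(i < n) xi 0 i * K j i by apply: eq_bigr => i _; rewrite -exi.
have -> : \sum_(i < n) xi 0 i * (r i j - K j i) =
    \sum_(i < n) xi 0 i * r i j - \sum_(i < n) xi 0 i * K j i.
  by rewrite -sumrB; apply: eq_bigr => i _; rewrite mulrBr.
by ring.
Qed.

End kernels.

Lemma complex_contraction {R : realType} (g : R[i] -> R[i]) (z0 : R[i]) (r : R) :
  0 <= r ->
  (forall z, normc (z - z0) <= r -> normc (g z - z0) <= r) ->
  (forall z z', normc (z - z0) <= r -> normc (z' - z0) <= r ->
     normc (g z - g z') <= normc (z - z') / 2) ->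
  exists2 z, normc (z - z0) <= r & g z = z.
Proof.
move=> r0 gr gl; pose z p := iter p g z0.
have hz p : normc (z p - z0) <= r.
  by elim: p => [|p ih]; rewrite ?subrr ?normc0//; exact: gr.
have hd p : normc (z p.+1 - z p) <= r / 2 ^+ p.
  elim: p => [|p ih]; first by rewrite expr0 divr1; exact: hz 1%N.
  change (normc (g (z p.+1) - g (z p)) <= r / 2 ^+ p.+1).
  apply: le_trans (gl _ _ (hz _) (hz _)) _.
  by rewrite exprSr invfM mulrA ler_pM2r.
have zsum p : z p = z0 + \sum_(i < p) (z i.+1 - z i).
  elim: p => [|p ih]; first by rewrite big_ord0 addr0.
  by rewrite big_ord_recr /= addrA -ih addrC subrK.
have sd : csummable (fun p => z p.+1 - z p) (2 * r).
  apply: (csummable_dom hd) => N.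
  by have := @geometric_tail R r 0 N r0; rewrite expr0 divr1.
pose l := z0 + csum (fun p => z p.+1 - z p).
have cl (e : R) : 0 < e -> exists N0, forall N, (N0 <= N)%N -> normc (z N - l) < e.
  move=> /(csum_near sd)[N0 h]; exists N0 => N /h; congr (normc _ < e).
  by rewrite zsum /l; ring.
have hl : normc (l - z0) <= r.
  apply/ler_addgt0Pl => e /cl[N0 /(_ _ (leqnn _)) h].
  have -> : l - z0 = (l - z N0) + (z N0 - z0) by ring.
  by rewrite (le_trans (normcD _ _))// lerD// normcBC ltW.
exists l => //; apply/eqP; rewrite -subr_eq0; apply/eqP; apply: normc_small => e e0.
have e2 : 0 < e / 2 by rewrite divr_gt0.
have [N0 h] := cl _ e2.
have -> : g l - l = (g l - g (z N0)) + (z N0.+1 - l) by rewrite /z /=; ring.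
rewrite (le_trans (normcD _ _))// (splitr e) lerD// ?(ltW (h _ _))//.
apply: le_trans (gl _ _ hl (hz _)) _; rewrite normcBC.
have := h _ (leqnn N0); have := normc_ge0 (z N0 - l); lra.
Qed.

(** * Diagonal plus bounded matrices *)

Section real_sums.
Context {R : realType}.
Implicit Types (f g : nat -> R).

Lemma rsumE f : rsum f = complex.Re (csum (fun i => (f i)%:C)).
Proof. by []. Qed.

Lemma rsummable_csum f c : rsummable f c -> csummable (fun i => (f i)%:C) c.
Proof.
by move=> h N; apply: le_trans (h N); apply: ler_sum => i _; rewrite normc_real.
Qed.

Lemma rsumB f g c d : rsummable f c -> rsummable g d ->
  rsum (fun i => f i - g i) = rsum f - rsum g.
Proof.
move=> /rsummable_csum h /rsummable_csum h'; rewrite !rsumE -cReB -(csumB h h').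
by congr (complex.Re (csum _)); apply/funext => i; rewrite rmorphB.
Qed.

Lemma rsumZ f c k : rsummable f c -> rsum (fun i => k * f i) = k * rsum f.
Proof.
move=> /rsummable_csum h; rewrite !rsumE.
rewrite (_ : (fun i => (k * f i)%:C) = (fun i => k%:C * (f i)%:C)); last first.
  by apply/funext => i; rewrite rmorphM.
by rewrite (csumZ _ h) cReM mul0r subr0.
Qed.

Lemma rsum_ge f c l N0 : rsummable f c ->
  (forall N, (N0 <= N)%N -> l <= \sum_(i < N) f i) -> l <= rsum f.
Proof.
move=> /rsum_cvg h hl; rewrite -(cvg_lim _ h)//.
by apply: limr_ge; [exact: cvgP h|exists N0].
Qed.

(** Expand the nonnegative sum of d_i (x_i - t / d_i)^2 at t = X / theta; dividing by the majorant
    theta, and not by the sum of 1 / d_i, is safe also for the empty sum. *)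
Lemma cauchy_schwarz_weight (d x : nat -> R) (theta A : R) N : (forall i, 0 < d i) ->
  0 < theta -> \sum_(i < N) (d i)^-1 <= theta -> \sum_(i < N) d i * x i ^+ 2 <= A ->
  (\sum_(i < N) x i) ^+ 2 <= A * theta.
Proof.
move=> d0 t0 ht hA; set X := \sum_(i < N) x i; pose t := X / theta.
have : 0 <= \sum_(i < N) d i * (x i - t / d i) ^+ 2.
  by apply: sumr_ge0 => i _; rewrite mulr_ge0 ?sqr_ge0// ltW.
have -> : \sum_(i < N) d i * (x i - t / d i) ^+ 2 =
    \sum_(i < N) d i * x i ^+ 2 - 2 * t * X + t ^+ 2 * \sum_(i < N) (d i)^-1.
  rewrite /X !mulr_sumr -sumrB -big_split; apply: eq_bigr => i _ /=.
  by have := d0 i => /gt_eqF/negbT di; field.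
have -> : 2 * t * X = 2 * (t ^+ 2 * theta) by rewrite /t; field; rewrite gt_eqF.
move=> h; have h2 : t ^+ 2 * theta <= A.
  by have := ler_wpM2l (sqr_ge0 t) ht; lra.
have -> : X ^+ 2 = t ^+ 2 * theta * theta by rewrite /t; field; rewrite gt_eqF.
by rewrite ler_pM2r.
Qed.

End real_sums.

Section diagonal_plus_bounded.
Context {R : realType}.
Variables (a : nat -> R) (B : nat -> nat -> R[i]) (M Sa : R).
Hypothesis a0 : forall i, 0 < a i.
Hypothesis sa : forall N, \sum_(i < N) (a i)^-1 <= Sa.
Hypothesis hB : forall j i, normc (B j i) <= M.
Implicit Types (v x y : nat -> R[i]) (l : R[i]).

(** The domain on the side of sequences: the image of the bounded sequences under division by a. As
    1/a is summable, its elements are absolutely summable and the row sums in [Lseq] converge. *)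
Definition inX v := exists c, forall i, a i * normc (v i) <= c.
Definition Lseq v (j : nat) : R[i] := (a j)%:C * v j - csum (fun i => B j i * v i).
Definition eigseq l v := inX v /\ forall j, Lseq v j = l * v j.
Definition iseig l := exists2 v, eigseq l v & exists j, v j != 0.

Lemma M_ge0 : 0 <= M. Proof. exact: le_trans (normc_ge0 _) (hB 0 0). Qed.
Lemma inX_summable v : inX v -> exists c, csummable v c.
Proof.
case=> c hc; exists (Sa * c); have c0 : 0 <= c.
  by apply: le_trans (hc 0%N); rewrite mulr_ge0 ?normc_ge0 ?ltW.
apply: (@csummable_dom _ _ (fun i => (a i)^-1 * c)) => [i|N].
  by rewrite mulrC ler_pdivlMr// mulrC.
by rewrite -mulr_suml ler_wpM2r.
Qed.

Lemma summable_bounded v c : csummable v c -> bounded v c.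
Proof.
move=> h i; apply: le_trans (h i.+1); rewrite big_ord_recr /= lerDr.
by apply: sumr_ge0 => j _; exact: normc_ge0.
Qed.

Lemma row_summable v c j : csummable v c -> csummable (fun i => B j i * v i) (M * c).
Proof.
move=> h; apply: (@csummable_dom _ _ (fun i => M * normc (v i))) => [i|N].
  by rewrite normcM ler_wpM2r ?normc_ge0.
by rewrite -mulr_sumr ler_wpM2l ?M_ge0.
Qed.

Lemma inXD x y : inX x -> inX y -> inX (fun i => x i + y i).
Proof.
move=> [c hc] [d hd]; exists (c + d) => i.
apply: le_trans (lerD (hc i) (hd i)).
by rewrite -mulrDr ler_wpM2l ?normcD// ltW.
Qed.

Lemma inXZ z x : inX x -> inX (fun i => z * x i).
Proof.
move=> [c hc]; exists (normc z * c) => i.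
by rewrite normcM mulrCA ler_wpM2l ?normc_ge0.
Qed.

Lemma inX0 : inX (fun=> 0).
Proof. by exists 0 => i; rewrite normc0 mulr0. Qed.

Lemma LseqD x y j : inX x -> inX y -> Lseq (fun i => x i + y i) j = Lseq x j + Lseq y j.
Proof.
move=> /inX_summable[c hc] /inX_summable[d hd]; rewrite /Lseq.
rewrite [X in _ - csum X](_ : _ = fun i => B j i * x i + B j i * y i); last first.
  by apply/funext => i; rewrite mulrDr.
rewrite (csumD (row_summable j hc) (row_summable j hd)).
by rewrite mulrDr; ring.
Qed.

Lemma LseqZ z x j : inX x -> Lseq (fun i => z * x i) j = z * Lseq x j.
Proof.
move=> /inX_summable[c hc]; rewrite /Lseq.
rewrite [X in _ - csum X](_ : _ = fun i => z * (B j i * x i)); last first.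
  by apply/funext => i; rewrite mulrCA.
by rewrite (csumZ _ (row_summable j hc)); ring.
Qed.

Lemma Lseq0 j : Lseq (fun=> 0) j = 0.
Proof.
rewrite /Lseq mulr0 sub0r -[RHS]oppr0; congr (- _).
by rewrite -[RHS](@csum0 R); congr csum; apply/funext => i; rewrite mulr0.
Qed.

Lemma inX_sum p (v : nat -> nat -> R[i]) : (forall i, (i < p)%N -> inX (v i)) ->
  inX (fun j => \sum_(i < p) v i j).
Proof.
elim: p => [|p ih] h.
  rewrite (_ : (fun _ => _) = fun=> 0); first exact: inX0.
  by apply/funext => j; rewrite big_ord0.
rewrite (_ : (fun _ => _) = fun j => \sum_(i < p) v i j + v p j); last first.
  by apply/funext => j; rewrite big_ord_recr.
by apply: inXD; [apply: ih => i ip; apply: h; exact: ltnW|exact: h].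
Qed.

Lemma Lseq_sum p (v : nat -> nat -> R[i]) j : (forall i, (i < p)%N -> inX (v i)) ->
  Lseq (fun j => \sum_(i < p) v i j) j = \sum_(i < p) Lseq (v i) j.
Proof.
elim: p => [|p ih] h.
  rewrite big_ord0 -[RHS](Lseq0 j); congr Lseq.
  by apply/funext => i; rewrite big_ord0.
have h' i : (i < p)%N -> inX (v i) by move=> ip; apply: h; exact: ltnW.
rewrite (_ : (fun _ => _) = fun j => \sum_(i < p) v i j + v p j); last first.
  by apply/funext => i; rewrite big_ord_recr.
by rewrite LseqD ?ih ?big_ord_recr//; [exact: inX_sum|exact: h].
Qed.

(** The substitution x_i = a_i v_i turns L v - l v = b into x = b + K x, with K dominated by the
    summable sequence (|l| + M) / a_i. A bounded fixed point of K is an eigensequence for l, so the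
    Fredholm alternative applies. *)
Lemma seq_fredholm l : ~ iseig l -> exists2 C : R, 0 <= C & forall b c, bounded b c ->
  exists2 v, forall j, a j * normc (v j) <= C * c &
    forall j, Lseq v j - l * v j = b j.
Proof.
move=> nl; pose K j i : R[i] := (l * (i == j)%:R + B j i) / (a i)%:C.
have an i : (a i)%:C != 0 by rewrite -normc_eq0 normc_real normr_eq0 gt_eqF.
have hK : kdom K (fun i => (normc l + M) / a i) ((normc l + M) * Sa).
  split=> [j i|N]; last by rewrite -mulr_sumr ler_wpM2l ?addr_ge0 ?normc_ge0 ?M_ge0.
  rewrite normcf normc_real gtr0_norm// ler_pM2r ?invr_gt0//.
  rewrite (le_trans (normcD _ _))// lerD//; case: (_ == _).
    by rewrite mulr1.
  by rewrite mulr0 normc0 normc_ge0.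
pose V x i := x i / (a i)%:C.
have aV x i : (a i)%:C * V x i = x i by rewrite /V mulrC divfK.
have nV x i : a i * normc (V x i) = normc (x i).
  by rewrite -(aV x) normcM normc_real gtr0_norm.
have XV x c : bounded x c -> inX (V x) by move=> hx; exists c => i; rewrite nV.
have KE x c j : bounded x c -> kapp K x j = l * V x j + csum (fun i => B j i * V x i).
  move=> /XV hx; have [d hd] := inX_summable hx.
  have sdl : csummable (fun i => l * (i == j)%:R * V x i) (normc l * d).
    move=> N; apply: le_trans (csummableZ l hd N); apply: ler_sum => i _.
    rewrite -mulrA !normcM ler_wpM2l ?normc_ge0//; case: (_ == _).
      by rewrite normc_real normr1 mul1r.
    by rewrite mulr0n normc0 mul0r mulr_ge0 ?normc_ge0.
  rewrite /kapp (_ : (fun i => _) =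
      fun i => l * (i == j)%:R * V x i + B j i * V x i); last first.
    by apply/funext => i; rewrite /K /V -mulrDl; ring.
  rewrite (csumD sdl (row_summable j hd)); congr (_ + _).
  rewrite (@csum_delta _ _ j) ?eqxx ?mulr1// => i /negbTE ->.
  by rewrite mulr0 mul0r.
have [|C C0 hC] := fredholm hK.
  move=> x c hx fx j; apply: contrapT => /eqP xj.
  apply: nl; exists (V x); last first.
    by exists j; apply: contra xj => /eqP V0; rewrite -aV V0 mulr0.
  split; first exact: XV hx.
  by move=> i; rewrite /Lseq aV {1}fx (KE _ _ _ hx) addrK.
exists C => // b c hb; have [x hx ex] := hC b c hb.
exists (V x) => [j|j]; first by rewrite nV.
by rewrite /Lseq aV {1}ex (KE _ _ _ hx); ring.
Qed.

(** * Inertia of an indefinite form: counting root vectors in a half-plane *)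

Section lyapunov.
Variables (n : nat) (c theta : R) (d : nat -> R).
Let s j : R := if (j < n)%N then -1 else 1.
Hypothesis d0 : forall j, 0 < d j.
Hypothesis dac : forall j, d j <= s j * (a j - c).
Hypothesis hd : forall N, \sum_(i < N) (d i)^-1 <= theta.
Hypothesis Mt : M * theta <= 1 / 2.

Let ss j : `|s j| = 1.
Proof. by rewrite /s; case: ifP; rewrite ?normrN normr1. Qed.

(* The form sum_j s_j |v_j|^2, of negative index n. *)
Definition krein v : R := rsum (fun j => s j * normc (v j) ^+ 2).

Lemma krein_summable v : inX v -> exists C, rsummable (fun j => s j * normc (v j) ^+ 2) C.
Proof.
move=> /inX_summable[C hC]; have hb := summable_bounded hC.
exists (C * C) => N; apply: (@le_trans _ _ (\sum_(i < N) C * normc (v i))).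
  apply: ler_sum => i _; rewrite normrM ss mul1r normrX ger0_norm ?normc_ge0//.
  by rewrite expr2 ler_wpM2r ?normc_ge0.
by rewrite -mulr_sumr ler_wpM2l// (csummable_ge0 hC).
Qed.

(** The diagonal contributes at least S = sum_j d_j |v_j|^2, and i sg nothing, to the real part. The
    matrix B costs at most M (sum_j |v_j|)^2 <= M theta S <= S / 2, by the weighted Cauchy-Schwarz
    inequality. *)
Lemma lyapunov v sg : inX v -> (exists j, v j != 0) ->
  0 < rsum (fun j => s j * complex.Re ((Lseq v j - (c +i* sg) * v j) * (v j)^*)).
Proof.
move=> Xv [j0 vj0]; have [C hC] := inX_summable Xv; have hb := summable_bounded hC.
have [A hA] := Xv; have C0 := csummable_ge0 hC.
have t0 : 0 < theta by apply: lt_le_trans (hd 1); rewrite big_ord1 invr_gt0.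
have A0 : 0 <= A by apply: le_trans (hA 0%N); rewrite mulr_ge0 ?normc_ge0 ?ltW.
pose q j := d j * normc (v j) ^+ 2.
have q0 j : 0 <= q j by rewrite mulr_ge0 ?sqr_ge0 ?ltW.
have qub N : \sum_(j < N) q j <= (A + `|c| * C) * C.
  apply: (@le_trans _ _ (\sum_(j < N) (A + `|c| * C) * normc (v j))).
    apply: ler_sum => i _; rewrite /q expr2 mulrA ler_wpM2r ?normc_ge0//.
    apply: (@le_trans _ _ ((a i + `|c|) * normc (v i))).
      rewrite ler_wpM2r ?normc_ge0// (le_trans (dac i))//.
      rewrite (le_trans (ler_norm _))// normrM ss mul1r (le_trans (ler_normB _ _))//.
      by rewrite gtr0_norm.
    by rewrite mulrDl lerD// ler_wpM2l.
  by rewrite -mulr_sumr ler_wpM2l// addr_ge0// mulr_ge0.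
pose Q := [set \sum_(j < N) q j | N in setT]; pose S := sup Q.
have hQ : has_sup Q.
  split; first by exists (\sum_(j < 0) q j), 0%N.
  by exists ((A + `|c| * C) * C) => _ [N _ <-].
have qS N : \sum_(j < N) q j <= S by apply: ub_le_sup; [exact: hQ.2|exists N].
have S0 : 0 < S.
  apply: lt_le_trans (qS j0.+1); rewrite big_ord_recr /= ltr_wpDl ?sumr_ge0//.
  by rewrite mulr_gt0// exprn_gt0// normc_gt0.
pose T := Num.sqrt (S * theta).
have T0 : 0 <= T by exact: sqrtr_ge0.
have TT : T * T = S * theta by rewrite -expr2 sqr_sqrtr// mulr_ge0 ?ltW.
have vT : csummable v T.
  move=> N; rewrite -(@ler_pXn2r _ 2%N) ?nnegrE ?sumr_ge0// => [|i _]; last exact: normc_ge0.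
  rewrite (expr2 T) TT; exact: (cauchy_schwarz_weight (x := fun i => normc (v i)) d0 t0 (hd N) (qS N)).
pose w j := csum (fun i => B j i * v i).
have wT j : normc (w j) <= M * T by apply: csum_le; exact: row_summable.
have uE j : complex.Re ((Lseq v j - (c +i* sg) * v j) * (v j)^*) =
    (a j - c) * normc (v j) ^+ 2 - complex.Re (w j * (v j)^*).
  rewrite normc_sqr /Lseq -/(w j); case: (v j) => p r; case: (w j) => p' r' /=.
  by ring.
have sm : rsummable (fun j => s j * complex.Re ((Lseq v j - (c +i* sg) * v j) * (v j)^*))
    ((A + M * T + normc (c +i* sg) * C) * C).
  move=> N; apply: (@le_trans _ _ (\sum_(j < N) (A + M * T + normc (c +i* sg) * C) * normc (v j))).
    apply: ler_sum => j _; rewrite normrM ss mul1r (le_trans (ler_Re _))//.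
    rewrite normcM normcJ ler_wpM2r ?normc_ge0//.
    rewrite (le_trans (normcB _ _))// lerD//.
      rewrite /Lseq (le_trans (normcB _ _))//; apply: lerD; last exact: wT.
      by rewrite normcM normc_real gtr0_norm.
    by rewrite normcM ler_wpM2l ?normc_ge0.
  rewrite -mulr_sumr ler_wpM2l// !addr_ge0// mulr_ge0 ?M_ge0 ?normc_ge0//.
(* Past N0 the diagonal sum exceeds 3 S / 4 and B takes away at most S / 2, so a margin of S / 4
   survives in the limit. *)
have [|_ [N0 _ <-] hN0] := @sup_adherent _ Q (S / 4) _ hQ; first by rewrite divr_gt0.
apply: (@lt_le_trans _ _ (S / 4)); first by rewrite divr_gt0.
apply: (rsum_ge (N0 := N0) sm) => N N0N.
have qN : S - S / 4 < \sum_(j < N) q j.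
  apply: lt_le_trans hN0 _; rewrite -(sum_ord_trunc q N0N); apply: ler_sum => i _.
  by case: ifP.
have vTN := vT N; have MT : M * T * T <= S / 2.
  by rewrite -mulrA TT; have := ler_wpM2l (ltW S0) Mt; lra.
apply: (@le_trans _ _ (\sum_(j < N) (q j - M * T * normc (v j)))).
  rewrite sumrB -mulr_sumr.
  have := ler_wpM2l (mulr_ge0 M_ge0 T0) vTN; lra.
apply: ler_sum => j _; rewrite uE mulrBr lerD//.
  by rewrite /q [leRHS]mulrA ler_wpM2r ?sqr_ge0.
rewrite lerN2 (le_trans (ler_norm _))// normrM ss mul1r (le_trans (ler_Re _))//.
by rewrite normcM normcJ ler_wpM2r ?normc_ge0.
Qed.

(** The real part of (y_j - x_j) times the conjugate of x_j + y_j is |y_j|^2 - |x_j|^2, so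
    [lyapunov] at x + y compares the two forms. *)
Lemma cayley_lt x y sg kp : inX x -> inX y -> 0 < kp ->
  (forall j, Lseq (fun i => x i + y i) j - (c +i* sg) * (x j + y j) = kp%:C * (y j - x j)) ->
  (exists j, x j + y j != 0) -> krein x < krein y.
Proof.
move=> Xx Xy k0 e nz; have := lyapunov sg (inXD Xx Xy) nz.
have [Cx hx] := krein_summable Xx; have [Cy hy] := krein_summable Xy.
have E : (fun j => s j * complex.Re ((Lseq (fun i => x i + y i) j -
      (c +i* sg) * (x j + y j)) * (x j + y j)^*)) =
    (fun j => kp * (s j * normc (y j) ^+ 2 - s j * normc (x j) ^+ 2)).
  apply/funext => j; rewrite e !normc_sqr; case: (x j) => p r; case: (y j) => p' r' /=.
  by ring.
rewrite [X in rsum X]E.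
have hyx : rsummable (fun j => s j * normc (y j) ^+ 2 - s j * normc (x j) ^+ 2) (Cy + Cx).
  move=> N; apply: le_trans (lerD (hy N) (hx N)); rewrite -big_split /=.
  by apply: ler_sum => j _; exact: ler_normB.
by rewrite (rsumZ _ hyx) (rsumB hy hx) pmulr_rgt0// subr_gt0.
Qed.

Lemma krein0 : krein (fun=> 0) = 0.
Proof.
rewrite /krein rsumE -[RHS](@cRe0 R) -[in RHS](@csum0 R); congr (complex.Re (csum _)).
by apply/funext => i; rewrite normc0 expr0n mulr0.
Qed.

Lemma kreinN x : krein (fun i => - x i) = krein x.
Proof. by congr rsum; apply/funext => j; rewrite normcN. Qed.

Lemma krein_ge0 x : inX x -> (forall j, (j < n)%N -> x j = 0) -> 0 <= krein x.
Proof.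
move=> Xx x0; have [C h] := krein_summable Xx; apply: (rsum_ge (N0 := 0) h) => N _.
apply: sumr_ge0 => i _; rewrite /s; case: ifPn => [/x0 ->|_].
  by rewrite normc0 expr0n mulr0.
by rewrite mul1r sqr_ge0.
Qed.

Definition krein_neg x := krein x < 0 \/ forall j, x j = 0.

Lemma krein_neg_inj x : inX x -> krein_neg x ->
  (forall j, (j < n)%N -> x j = 0) -> forall j, x j = 0.
Proof. by move=> Xx [h|//] /(krein_ge0 Xx); rewrite leNgt h. Qed.

(* One Cayley step: x and y with (2 kp - N) y = N x, where N = L - l. *)
Lemma cayley_neg x y l : inX x -> inX y -> complex.Re l < c -> krein_neg y ->
  (forall j, (2 * (c - complex.Re l))%:C * y j - (Lseq y j - l * y j) =
             Lseq x j - l * x j) -> krein_neg x.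
Proof.
move=> Xx Xy lc ny e; pose kp := c - complex.Re l.
have k0 : 0 < kp by rewrite subr_gt0.
case: (pselect (exists j, x j + y j != 0)) => [nz|z].
  left; have : krein x < krein y.
    (* With kp = c - Re l the point c + i Im l equals l + kp, and the hypothesis becomes (N - kp) (x
       + y) = kp (y - x). *)
    apply: (cayley_lt (sg := complex.Im l) (kp := kp)) => // j.
    rewrite LseqD//; have := e j; rewrite -/kp => ej.
    have -> : c +i* complex.Im l = l + kp%:C.
      by apply: complex_ext; rewrite /kp; case: (l) => p r /=; ring.
    have E2 : (2 * kp)%:C = 2 * kp%:C :> R[i] by rewrite rmorphM rmorph_nat.
    rewrite E2 in ej.
    apply/eqP; rewrite -subr_eq0; move/eqP: ej; rewrite -subr_eq0 => /eqP ej.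
    apply/eqP; rewrite -[RHS]oppr0 -ej; ring.
  by case: ny => [y0 /lt_trans|y0]; [exact|rewrite (_ : y = fun=> 0) ?krein0//; exact/funext].
have xy j : x j = - y j.
  by apply/eqP; rewrite -addr_eq0; apply/negPn/negP => h; apply: z; exists j.
case: ny => [y0|y0]; [left|right] => [|j]; last by rewrite xy y0 oppr0.
by rewrite (_ : x = fun i => - y i) ?kreinN//; exact/funext.
Qed.

(** Induction with one Cayley step at the last eigenvalue: N = L - mu_p kills v_p, so the companion
    y only involves the other vectors, scaled by z_i. The denominators of z_i have real part (c - Re
    mu_p) + (c - Re mu_i) > 0. *)
Lemma eig_sum_neg p (mu : nat -> R[i]) (v : nat -> nat -> R[i]) :
  (forall i, (i < p)%N -> eigseq (mu i) (v i)) ->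
  (forall i, (i < p)%N -> complex.Re (mu i) < c) ->
  krein_neg (fun j => \sum_(i < p) v i j).
Proof.
elim: p v => [|p ih] v hv hc; first by right=> j; rewrite big_ord0.
pose kp := c - complex.Re (mu p).
have kp0 : 0 < kp by rewrite subr_gt0 hc.
pose z i := (mu i - mu p) / ((2 * kp)%:C - (mu i - mu p)).
have znz i : (i < p)%N -> (2 * kp)%:C - (mu i - mu p) != 0.
  move=> ip; apply/eqP => /(congr1 (@complex.Re R)); rewrite !cReB cRe_real cRe0.
  have := hc i (ltnW ip); have := hc p (ltnSn _); rewrite /kp; lra.
have hv' i : (i < p)%N -> eigseq (mu i) (v i) by move=> ip; apply: hv; exact: ltnW.
have hc' i : (i < p)%N -> complex.Re (mu i) < c by move=> ip; apply: hc; exact: ltnW.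
have Xz i : (i < p)%N -> inX (fun j => z i * v i j) by move=> /hv'[h _]; exact: inXZ.
apply: (@cayley_neg _ (fun j => \sum_(i < p) z i * v i j) (mu p)) => //.
- by apply: inX_sum => i /hv[].
- exact: (inX_sum (v := fun i j => z i * v i j)).
- exact: hc.
- apply: (ih (fun i j => z i * v i j)) => // i ip; split; first exact: Xz.
  by move=> j; rewrite LseqZ ?(hv' i ip).2 1?mulrCA//; exact: (hv' i ip).1.
move=> j; rewrite -/kp (Lseq_sum (v := fun i j => z i * v i j))//.
rewrite (Lseq_sum (v := v)); last by move=> i /hv[].
have -> : \sum_(i < p.+1) Lseq (v i) j - mu p * \sum_(i < p.+1) v i j =
    \sum_(i < p) Lseq (v i) j - mu p * \sum_(i < p) v i j.
  by rewrite !big_ord_recr /= (hv p (ltnSn _)).2; ring.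
rewrite !mulr_sumr -!sumrB; apply: eq_bigr => i _ /=.
rewrite LseqZ; last exact: (hv' i (ltn_ord i)).1.
rewrite !(hv' i (ltn_ord i)).2 /z.
move: (znz i (ltn_ord i)); move: ((2 * kp)%:C) (mu i) (mu p) (v i j) => A m m' x.
set D := A - (m - m') => D0.
transitivity ((m - m') * x * (D / D)); first by rewrite /D; ring.
by rewrite divff// mulr1 mulrBl.
Qed.

(** A Jordan chain with z_i = (L - l)^i z_0, indexed by all of [nat] and padded with zeros from p
    on, so that linear combinations of chains of different lengths need no reindexing. *)
Definition chain l p (z : nat -> nat -> R[i]) :=
  [/\ forall i, inX (z i), forall i j, Lseq (z i) j - l * z i j = z i.+1 j &
      forall i j, (p <= i)%N -> z i j = 0].

(** On the chain N is nilpotent, so y = (t - N)^(-1) N z with t = 2 kp is a finite Neumann series.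
    It is again a chain, shorter by one, and the induction hypothesis applies to it. *)
Lemma chain_neg l p z : complex.Re l < c -> chain l p z -> krein_neg (z 0%N).
Proof.
move=> lc; elim: p z => [|p ih] z [Xz ez zp]; first by right=> j; exact: zp.
pose kp := c - complex.Re l.
have k0 : 0 < kp by rewrite subr_gt0.
pose t : R[i] := (2 * kp)%:C.
have t0 : t != 0 by rewrite -normc_eq0 normc_real normr_eq0 mulf_neq0// gt_eqF.
pose y i j := \sum_(r < p) z (i + r.+1)%N j / t ^+ r.+1.
have yE i : y i = fun j => \sum_(r < p) (t ^+ r.+1)^-1 * z (i + r.+1)%N j.
  by apply/funext => j; apply: eq_bigr => r _; rewrite mulrC.
have Xy i : inX (y i).
  by rewrite yE; apply: (inX_sum (v := fun r j => (t ^+ r.+1)^-1 * z (i + r.+1)%N j)) => r _; exact: inXZ.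
have Ly i j : Lseq (y i) j - l * y i j = y i.+1 j.
  rewrite !yE (Lseq_sum (v := fun r j => (t ^+ r.+1)^-1 * z (i + r.+1)%N j)); last first.
    by move=> r _; exact: inXZ.
  rewrite mulr_sumr -sumrB; apply: eq_bigr => r _.
  by rewrite LseqZ// mulrCA -mulrBr ez addSn.
apply: (@cayley_neg _ (y 0%N) l) => //.
  apply: ih; split => // i j pi; rewrite /y big1// => r _.
  by rewrite zp ?mul0r// addnS ltnS (leq_trans pi)// leq_addr.
move=> j; rewrite Ly ez -/kp -/t /y mulr_sumr.
case: p {ih Xy Ly yE y} zp => [|p] zp; first by rewrite !big_ord0 subr0 zp.
rewrite big_ord_recl [X in _ - X]big_ord_recr /= !add0n expr1 mulrC divfK//.
have -> : z (1 + p.+1)%N j = 0 by rewrite zp.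
rewrite mul0r addr0.
set S1 := (X in _ + X - _); set S2 := (X in _ - X).
have -> : S1 = S2; last by rewrite addrK.
apply: eq_bigr => r _; change (t * (z r.+2 j / t ^+ r.+2) = z r.+2 j / t ^+ r.+1).
by rewrite [t ^+ r.+2]exprS invfM [X in t * X]mulrCA mulVKf.
Qed.

(** Applying L - mu_p to the relation removes v_p and multiplies the other terms by mu_i - mu_p,
    nonzero as the eigenvalues are distinct. *)
Lemma eig_indep p (mu : nat -> R[i]) (v : nat -> nat -> R[i]) :
  (forall i, (i < p)%N -> eigseq (mu i) (v i)) ->
  (forall i j, (i < p)%N -> (j < p)%N -> mu i = mu j -> i = j) ->
  (forall j, \sum_(i < p) v i j = 0) -> forall i j, (i < p)%N -> v i j = 0.
Proof.
elim: p v => [//|p ih] v hv inj h.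
have hv' i : (i < p)%N -> eigseq (mu i) (v i) by move=> ip; apply: hv; exact: ltnW.
have h1 i j : (i < p)%N -> (mu i - mu p) * v i j = 0.
  move=> ip; apply: (ih (fun i j => (mu i - mu p) * v i j)) => // [k kp||j'].
  - split; first by apply: inXZ; exact: (hv' k kp).1.
    by move=> j'; rewrite LseqZ ?(hv' k kp).2 1?mulrCA//; exact: (hv' k kp).1.
  - by move=> k k' kp k'p; apply: inj; exact: ltnW.
  - have X i' : (i' < p.+1)%N -> inX (v i') by move=> /hv[].
    have := Lseq_sum j' X; rewrite (_ : (fun _ => _) = fun=> 0); last exact/funext.
    rewrite Lseq0 => e; have := h j' => /(congr1 ( *%R (mu p))).
    rewrite mulr0 mulr_sumr => e'.
    under eq_bigr do rewrite mulrBl.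
    move: e e'; rewrite !big_ord_recr /= (hv p (ltnSn _)).2 => e e'.
    have e1 : \sum_(i < p) Lseq (v i) j' = \sum_(i < p) mu i * v i j'.
      by apply: eq_bigr => k _; rewrite (hv' _ (ltn_ord k)).2.
    rewrite e1 in e; rewrite sumrB.
    have -> : \sum_(i < p) mu i * v i j' = - (mu p * v p j').
      by apply/eqP; rewrite -addr_eq0 -e.
    have -> : \sum_(i < p) mu p * v i j' = - (mu p * v p j').
      by apply/eqP; rewrite -addr_eq0 e'.
    by rewrite subrr.
have h2 i j : (i < p)%N -> v i j = 0.
  move=> ip; have /eqP := h1 i j ip; rewrite mulf_eq0 subr_eq0 => /orP[/eqP e|/eqP//].
  by have := inj i p (ltnW ip) (ltnSn _) e => ei; move: ip; rewrite ei ltnn.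
move=> i j; rewrite ltnS leq_eqVlt => /predU1P[->|/h2 //].
have := h j; rewrite big_ord_recr /= big1 => [|k _]; [by rewrite add0r|exact: h2].
Qed.

(** More than n eigenvectors have a nontrivial combination vanishing on the first n coordinates.
    There the form is nonnegative, yet on the span it is negative off 0, so the combination is zero,
    against independence. *)
Lemma eig_count p (mu : nat -> R[i]) :
  (forall i, (i < p)%N -> iseig (mu i)) ->
  (forall i, (i < p)%N -> complex.Re (mu i) < c) ->
  (forall i j, (i < p)%N -> (j < p)%N -> mu i = mu j -> i = j) -> (p <= n)%N.
Proof.
move=> he hc inj; rewrite leqNgt; apply/negP => np.
have /choice[v hv] : forall i, exists v, (i < p)%N -> eigseq (mu i) v /\ exists j, v j != 0.
  move=> i; case: (boolP (i < p)%N) => [/he[v hv hn]|_]; last by exists (fun=> 0).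
  by exists v.
pose A : 'M[R[i]]_(p, n) := \matrix_(i, j) v i j.
have : kermx A != 0.
  rewrite kermx_eq0 /row_free neq_ltn.
  by rewrite (leq_ltn_trans (rank_leq_col A))// np.
case/rowV0Pn => r /sub_kermxP rA r0.
have [i0 ri0] : exists i, r 0 i != 0 by exact/rV0Pn.
pose r' (i : nat) := if insub i is Some i' then r 0 i' else 0.
have r'E (i : 'I_p) : r' i = r 0 i by rewrite /r' valK.
pose u i j := r' i * v i j.
have hu i : (i < p)%N -> eigseq (mu i) (u i).
  move=> /hv[[X e] _]; split; first exact: inXZ.
  by move=> j; rewrite LseqZ// e mulrCA.
have Xu : inX (fun j => \sum_(i < p) u i j) by apply: inX_sum => i /hu[].
have u0 : forall j, \sum_(i < p) u i j = 0.
  apply: (krein_neg_inj Xu (eig_sum_neg hu hc)) => j jn.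
  have /matrixP/(_ 0 (Ordinal jn)) := rA; rewrite !mxE => e; rewrite -[RHS]e.
  by apply: eq_bigr => i _; rewrite /u r'E mxE.
have [_ [j /negP[]]] := hv i0 (ltn_ord i0).
have /eqP := eig_indep hu inj u0 j (ltn_ord i0).
by rewrite /u r'E mulf_eq0 (negbTE ri0).
Qed.

End lyapunov.

End diagonal_plus_bounded.

(** Truncation to the first n coordinates is injective on V. A family from W with linearly
    independent truncations has at most n members, and one of maximal length spans W. *)
Lemma finite_span {R : realType} n (W V : set (nat -> R[i])) : W `<=` V ->
  (forall x y z, V x -> V y -> V (fun j => x j - z * y j)) ->
  (forall x, V x -> (forall j, (j < n)%N -> x j = 0) -> forall j, x j = 0) ->
  exists d (e : 'I_d -> nat -> R[i]), (forall i, W (e i)) /\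
    forall x, W x -> exists co : 'I_d -> R[i], forall j, x j = \sum_(i < d) co i * e i j.
Proof.
move=> WV Vlin Vinj.
pose mxof d (e : 'I_d -> nat -> R[i]) : 'M[R[i]]_(d, n) := \matrix_(i, j) e i j.
pose P d := `[< exists e : 'I_d -> nat -> R[i], (forall i, W (e i)) /\ row_free (mxof d e) >].
have P0 : exists d, P d.
  exists 0%N; apply/asboolP; exists (fun=> fun=> 0); split; first by case.
  by rewrite /row_free -leqn0 rank_leq_row.
have Pub d : P d -> (d <= n)%N.
  by move/asboolP => [e [_ /eqP <-]]; exact: rank_leq_col.
case: (ex_maxnP P0 Pub) => d /asboolP[e [We fe]] dmax.
exists d, e; split => // x Wx.
pose rx : 'rV[R[i]]_n := \row_j x j.
have sub : (rx <= mxof d e)%MS.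
  apply: contrapT => /negP nsub.
  pose e' (i : 'I_(d + 1)) := match fintype.split i with inl i => e i | inr _ => x end.
  have : P (d + 1)%N.
    apply/asboolP; exists e'; split.
      by move=> i; rewrite /e'; case: fintype.split.
    have -> : mxof (d + 1)%N e' = col_mx (mxof d e) rx.
      apply/matrixP => i j; rewrite !mxE /e'; case: fintype.split => k; by rewrite !mxE.
    rewrite /row_free -addsmxE.
    have lt : (mxof d e < mxof d e + rx)%MS.
      by rewrite ltmxE addsmxSl addsmx_sub submx_refl.
    rewrite eqn_leq; apply/andP; split.
      by rewrite addsmxE rank_leq_row.
    by rewrite addn1 -{1}(eqP fe); exact: rank_ltmx.
  by move/dmax; rewrite addn1 ltnn.
case/submxP: sub => D eD; exists (fun i => D 0 i) => j.
(* V is only closed under x - z y, so the combination is subtracted one term at a time. *)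
have Vsub k : (k <= d)%N -> V (fun j => x j - \sum_(i < d | (i < k)%N) D 0 i * e i j).
  elim: k => [|k ih] kd.
    rewrite (_ : (fun _ => _) = x); first exact: WV.
    by apply/funext => j'; rewrite big_pred0 ?subr0.
  have := Vlin _ _ (D 0 (Ordinal kd)) (ih (ltnW kd)) (WV _ (We (Ordinal kd))).
  congr V; apply/funext => j'; rewrite [in RHS](bigD1 (Ordinal kd))//= opprD addrA addrAC.
  congr (_ - _ - _); apply: eq_bigl => i; rewrite ltnS -(inj_eq val_inj) /=.
  by rewrite ltn_neqAle andbC.
have := Vinj _ (Vsub d (leqnn _)).
move=> h; apply/eqP; rewrite -subr_eq0; apply/eqP.
rewrite -[RHS](h _ j) => [|j' j'n].
  by congr (_ - _); apply: eq_bigl => i; rewrite ltn_ord.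
have /matrixP/(_ 0 (Ordinal j'n)) := eD; rewrite !mxE /= => ->.
apply/eqP; rewrite subr_eq0; apply/eqP; apply: eq_big => [i|i _]; first by rewrite ltn_ord.
by rewrite mxE.
Qed.

(** * One eigenvalue near each diagonal entry *)

Lemma quarter {R : realType} : 1 / 4 <= 1 / 2 :> R. Proof. lra. Qed.

Section strip.
Context {R : realType}.
Variables (a : nat -> R) (B : nat -> nat -> R[i]) (M Sa : R).
Hypothesis a0 : forall i, 0 < a i.
Hypothesis sa : forall N, \sum_(i < N) (a i)^-1 <= Sa.
Hypothesis hB : forall j i, normc (B j i) <= M.
Hypothesis symB : forall j i, B j i = B i j.
Variables (n : nat) (D : nat -> R) (theta eps : R).
Hypothesis D0 : forall i, 0 < D i.
Hypothesis hD : forall N, \sum_(i < N) (if (i == n :> nat) then 0 else (D i)^-1) <= theta.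
Hypothesis Mt : M * theta <= 1 / 4.
Hypothesis heps : forall j N,
  \sum_(i < N) (if (i == n :> nat) then 0 else normc (B j i) / D i) <= eps.

(** The parameters l for which only the n-th diagonal entry can be close. Both the disc of radius 2
    M around a_n, where an eigenvalue is constructed, and the strip between two midpoints, where
    uniqueness is needed, consist of such l. *)
Definition off_column (l : R[i]) := forall i, i != n -> D i <= normc ((a i)%:C - l).
Hypothesis disc_off : forall l, normc (l - (a n)%:C) <= 2 * M -> off_column l.

Let M0 : 0 <= M := M_ge0 hB.

Definition Kstrip (l : R[i]) j i : R[i] := if i == n then 0 else B j i / ((a i)%:C - l).

Let theta0 : 0 <= theta. Proof. by have := hD 0; rewrite big_ord0. Qed.

Let eps0 : 0 <= eps. Proof. by have := heps 0 0; rewrite big_ord0. Qed.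

Let invD i : i != n -> (D i)^-1 <= theta.
Proof.
move=> /negbTE ni; apply: le_trans (hD i.+1).
rewrite big_ord_recr /= ni lerDr; apply: sumr_ge0 => j _.
by case: ifP => // _; rewrite invr_ge0 ltW.
Qed.

Let off_inv l i : off_column l -> i != n -> normc ((a i)%:C - l)^-1 <= (D i)^-1.
Proof. by move=> h ni; rewrite normcV lef_pV2 ?posrE ?(lt_le_trans _ (h i ni))// h. Qed.

Let off_neq l i : off_column l -> i != n -> (a i)%:C - l != 0.
Proof. by move=> h ni; rewrite -normc_eq0 gt_eqF// (lt_le_trans _ (h i ni)). Qed.

Let Kdom l : off_column l ->
  kdom (Kstrip l) (fun i => if i == n then 0 else M / D i) (1 / 4).
Proof.
move=> h; split=> [j i|N].
  rewrite /Kstrip; case: ifPn => ni; rewrite ?normc0// normcM.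
  by rewrite ler_pM ?normc_ge0// off_inv.
apply: le_trans Mt; apply: le_trans (ler_wpM2l M0 (hD N)); rewrite mulr_sumr.
by apply: ler_sum => i _; case: ifP; rewrite ?mulr0.
Qed.


Lemma strip_solution : exists x : R[i] -> nat -> R[i], forall l, off_column l ->
  bounded (x l) (2 * M) /\ forall j, x l j = B j n + kapp (Kstrip l) (x l) j.
Proof.
suff /choice[x hx] : forall l, exists x : nat -> R[i], off_column l ->
    bounded x (2 * M) /\ forall j, x j = B j n + kapp (Kstrip l) x j by exists x.
move=> l; case: (pselect (off_column l)) => [h|]; last by exists (fun=> 0).
have hb : bounded (B ^~ n) M by move=> j; exact: hB.
by have [x hx e] := neumann (Kdom h) quarter hb; exists x.
Qed.

(** Column n, the only one where a_i - l may vanish, is split off; the other entries are expressed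
    through y_i = (a_i - l) v_i. *)
Lemma row_split l (v y : nat -> R[i]) j c : off_column l -> bounded y c ->
  (forall i, i != n -> ((a i)%:C - l) * v i = y i) ->
  csum (fun i => B j i * v i) = v n * B j n + kapp (Kstrip l) y j.
Proof.
move=> h hy e; pose dl i := if i == n then v n * B j n else 0.
have sd : csummable dl (normc (v n * B j n)).
  move=> N; have [nN|Nn] := ltnP n N.
    rewrite (bigD1 (Ordinal nN))//= /dl eqxx big1 ?addr0// => i.
    by rewrite -(inj_eq val_inj) /= => /negbTE ->; rewrite normc0.
  rewrite big1 ?normc_ge0// => i _; rewrite /dl ifN ?normc0//.
  by rewrite neq_ltn (leq_trans (ltn_ord i)).
have -> : (fun i => B j i * v i) = (fun i => dl i + Kstrip l j i * y i).
  apply/funext => i; rewrite /dl /Kstrip; case: eqVneq => [->|ni].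
    by rewrite mul0r addr0 mulrC.
  by rewrite add0r -(e i ni) -mulrA mulKf// off_neq.
rewrite (csumD sd (kapp_summable (Kdom h) j hy)); congr (_ + _).
by rewrite (@csum_delta _ _ n) /dl ?eqxx// => i /negbTE ->.
Qed.

Variable x : R[i] -> nat -> R[i].
Hypothesis hx : forall l, off_column l ->
  bounded (x l) (2 * M) /\ forall j, x l j = B j n + kapp (Kstrip l) (x l) j.

(** For an eigensequence v, y = B v solves y = v_n B_(.n) + K y, hence y = v_n x by uniqueness; then
    v_n is nonzero and coordinate n reads a_n - l = x_n. Conversely v_n = 1 and v_i = x_i / (a_i -
    l) define an eigensequence. *)
Lemma strip_eigP l : off_column l -> iseig a B l <-> l = (a n)%:C - x l n.
Proof.
move=> h; have [bx ex] := hx h; split=> [[v [Xv ev] nv]|e].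
  have [T hT] := inX_summable a0 sa Xv.
  pose y j := csum (fun i => B j i * v i).
  have hy : bounded y (M * T) by move=> j; apply: csum_le; exact: row_summable.
  have vy i : ((a i)%:C - l) * v i = y i.
    by have := ev i; rewrite /Lseq -/(y i) mulrBl => <-; ring.
  have ey j : y j = v n * B j n + kapp (Kstrip l) y j by exact: (row_split _ h hy).
  have yx j : y j - v n * x l j = 0.
    apply: (kapp_fix0 (Kdom h) quarter (boundedB hy (boundedZ (v n) bx))) => {}j /=.
    rewrite (kappB (Kdom h) _ hy (boundedZ (v n) bx)) (kappZ (Kdom h) _ _ bx).
    by rewrite {1}ey {1}ex; ring.
  have vn0 : v n != 0.
    apply/eqP => vn; case: nv => j /eqP; apply.
    case: (eqVneq j n) => [->//|jn].
    have /eqP := vy j; have /eqP := yx j; rewrite vn mul0r subr0 => /eqP ->.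
    by rewrite mulf_eq0 (negbTE (off_neq h jn)) => /eqP.
  have := vy n; have /eqP := yx n; rewrite subr_eq0 => /eqP ->.
  by rewrite mulrC => /(mulfI vn0) <-; ring.
pose v i := if i == n then 1 else x l i / ((a i)%:C - l).
have vx i : i != n -> ((a i)%:C - l) * v i = x l i.
  by move=> ni; rewrite /v (negbTE ni) mulrC divfK// off_neq.
have vn : v n = 1 by rewrite /v eqxx.
exists v; last by exists n; rewrite vn oner_neq0.
split=> [|j].
  (* From a_i <= |a_i - l| + |l| and 1 / |a_i - l| <= theta one gets a_i / |a_i - l| <= 1 + |l|
     theta. *)
  exists (a n + 2 * M * (1 + normc l * theta)) => i; rewrite /v.
  case: eqVneq => [->|ni].
    rewrite (_ : (1 : R[i]) = 1%:C)// normc_real normr1 mulr1 lerDl.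
    by rewrite !mulr_ge0// addr_ge0// mulr_ge0 ?normc_ge0.
  rewrite normcM mulrCA; apply: (@le_trans _ _ (2 * M * (1 + normc l * theta))); last first.
    by rewrite lerDr ltW.
  rewrite ler_pM ?normc_ge0//; first by rewrite mulr_ge0 ?normc_ge0 ?ltW.
  have ai : a i <= normc ((a i)%:C - l) + normc l.
    by apply: le_trans (normcD _ _); rewrite subrK normc_real ler_norm.
  apply: le_trans (ler_wpM2r (normc_ge0 _) ai) _; rewrite mulrDl lerD//.
    by rewrite normcV divff// gt_eqF// (lt_le_trans _ (h i ni)).
  rewrite ler_wpM2l ?normc_ge0// (le_trans (off_inv h ni))//; exact: invD.
rewrite /Lseq (row_split _ h bx vx) vn mul1r -ex.
case: (eqVneq j n) => [->|jn]; first by rewrite vn !mulr1 [RHS]e.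
by rewrite -(vx j jn); ring.
Qed.

(** The difference of the two solutions solves the equation at l with right-hand side (K_l - K_l')
    x_l'. The resolvent identity and the factor 2 of the Neumann bound give the constant 4 (M
    theta)^2 <= 1 / 4. *)
Lemma strip_lipschitz l l' : off_column l -> off_column l' ->
  normc (x l n - x l' n) <= normc (l - l') / 2.
Proof.
move=> h h'; have [bx ex] := hx h; have [bx' ex'] := hx h'.
pose K' j i := Kstrip l j i - Kstrip l' j i.
have hK' : kdom K' (fun i => if i == n then 0 else M * (normc (l - l') * (theta / D i)))
    (normc (l - l') * theta * (M * theta)).
  split=> [j i|N].
    rewrite /K' /Kstrip; case: ifPn => ni; first by rewrite subrr normc0.
    have -> : B j i / ((a i)%:C - l) - B j i / ((a i)%:C - l') =
        B j i * ((l - l') * (((a i)%:C - l)^-1 * ((a i)%:C - l')^-1)).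
      rewrite -mulrBr; congr (_ * _).
      have := off_neq h ni; have := off_neq h' ni; move: ((a i)%:C) => A hl' hl.
      have e1 : (A - l)^-1 = (A - l') * (A - l')^-1 * (A - l)^-1 by rewrite divff// mul1r.
      have e2 : (A - l')^-1 = (A - l) * (A - l)^-1 * (A - l')^-1 by rewrite divff// mul1r.
      transitivity ((A - l') * (A - l')^-1 * (A - l)^-1 - (A - l) * (A - l)^-1 * (A - l')^-1).
        by rewrite -e1 -e2.
      ring.
    rewrite !normcM ler_pM ?mulr_ge0 ?normc_ge0// ler_wpM2l ?normc_ge0//.
    by rewrite ler_pM ?normc_ge0// ?off_inv// (le_trans (off_inv h ni))// invD.
  rewrite (_ : _ * _ * _ = M * (normc (l - l') * (theta * theta))); last ring.
  apply: (@le_trans _ _ (M * (normc (l - l') * (theta *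
     \sum_(i < N) (if (i == n :> nat) then 0 else (D i)^-1))))).
    rewrite !mulr_sumr; apply: ler_sum => i _.
    by case: ifP; rewrite ?mulr0// mulrA.
  by rewrite !ler_wpM2l ?normc_ge0.
have e j : x l j - x l' j = kapp K' (x l') j + kapp (Kstrip l) (fun i => x l i - x l' i) j.
  rewrite (kappB (Kdom h) _ bx bx').
  have -> : kapp K' (x l') j = kapp (Kstrip l) (x l') j - kapp (Kstrip l') (x l') j.
    rewrite /kapp -(csumB (kapp_summable (Kdom h) j bx') (kapp_summable (Kdom h') j bx')).
    by congr csum; apply/funext => i; rewrite mulrBl.
  by rewrite {1}ex {1}ex'; ring.
have := kapp_inv_bounded (Kdom h) quarter (boundedB bx bx') (kapp_bounded hK' bx') e.
move=> /(_ n)/le_trans; apply.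
have Mt0 : 0 <= M * theta by rewrite mulr_ge0.
have -> : 2 * (normc (l - l') * theta * (M * theta) * (2 * M)) =
  4 * (normc (l - l') * (M * theta) * (M * theta)) by ring.
rewrite -mulrA.
have : (M * theta) * (M * theta) <= 1 / 4 * (1 / 4) by rewrite ler_pM.
by move=> /(ler_wpM2l (normc_ge0 (l - l'))); have := normc_ge0 (l - l'); lra.
Qed.

(** As |x_n(l)| <= 2 M, the contraction l -> a_n - x_n(l) maps the disc of radius 2 M around a_n to
    itself. *)
Lemma strip_exists : exists2 l, normc (l - (a n)%:C) <= 2 * M & iseig a B l.
Proof.
have [|z hz|z z' hz hz'|l hl e] :=
  @complex_contraction R (fun z => (a n)%:C - x z n) (a n)%:C (2 * M).
- by rewrite mulr_ge0.
- rewrite (_ : (a n)%:C - x z n - (a n)%:C = - x z n); last ring.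
  by rewrite normcN (hx (disc_off hz)).1.
- rewrite (_ : (a n)%:C - x z n - ((a n)%:C - x z' n) = x z' n - x z n); last ring.
  by rewrite normcBC strip_lipschitz//; exact: disc_off.
by exists l => //; apply/(strip_eigP (disc_off hl)).
Qed.

Lemma strip_unique l l' : off_column l -> off_column l' ->
  iseig a B l -> iseig a B l' -> l = l'.
Proof.
move=> h h' /(strip_eigP h) e /(strip_eigP h') e'.
apply/eqP; rewrite -subr_eq0 -normc_eq0 eq_le normc_ge0 andbT.
have := strip_lipschitz h h'.
have -> : normc (x l n - x l' n) = normc (l - l').
  by rewrite normcBC; congr normc; rewrite {2}e {2}e'; ring.
by have := normc_ge0 (l - l'); lra.
Qed.

(** Expanding x_n twice leaves the second iterate of K on x, at most 2 M eps^2. Replacing l by a_n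
    in the quadratic term costs |a_n - l| <= 2 M times two sums over denominators, again 2 M
    eps^2. *)
Lemma strip_estimate l : normc (l - (a n)%:C) <= 2 * M -> iseig a B l ->
  normc (l - ((a n)%:C - B n n - csum (fun i => if i == n then 0 else
     B n i * B i n / ((a i)%:C - (a n)%:C)))) <= 4 * M * eps ^+ 2.
Proof.
move=> hl; have h := disc_off hl; have [bx ex] := hx h.
move=> /(strip_eigP h) e.
have hn : off_column (a n)%:C by apply: disc_off; rewrite subrr normc0 mulr_ge0.
have Keps j : csummable (Kstrip l j) eps.
  apply: (@csummable_dom R _ (fun i => if i == n then 0 else normc (B j i) / D i)) (heps j) => i; rewrite /Kstrip; case: ifPn => ni.
    by rewrite normc0.
  by rewrite normcM ler_wpM2l ?normc_ge0// off_inv.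
have bK j : normc (kapp (Kstrip l) (x l) j) <= 2 * M * eps.
  apply: csum_le => N.
  apply: le_trans (ler_wpM2l _ (Keps j N)); last by rewrite mulr_ge0.
  by rewrite mulr_sumr; apply: ler_sum => i _; rewrite normcM mulrC ler_wpM2r ?normc_ge0.
have s1 : csummable (fun i => Kstrip l n i * B i n) (M * eps).
  move=> N; apply: le_trans (ler_wpM2l M0 (Keps n N)); rewrite mulr_sumr.
  by apply: ler_sum => i _; rewrite normcM mulrC ler_wpM2r ?normc_ge0.
have s2 : csummable (fun i => Kstrip l n i * kapp (Kstrip l) (x l) i) (2 * M * eps * eps).
  move=> N; apply: le_trans (ler_wpM2l _ (Keps n N)); last by rewrite !mulr_ge0.
  by rewrite mulr_sumr; apply: ler_sum => i _; rewrite normcM mulrC ler_wpM2r ?normc_ge0.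
have s3 : csummable (fun i => Kstrip (a n)%:C n i * B i n) (M * eps).
  move=> N; apply: le_trans (ler_wpM2l M0 (heps n N)); rewrite mulr_sumr.
  apply: ler_sum => i _; rewrite /Kstrip; case: ifPn => ni.
    by rewrite mul0r mulr0 normc0.
  rewrite !normcM mulrC ler_pM ?mulr_ge0 ?normc_ge0// ler_wpM2l ?normc_ge0//.
  exact: off_inv.
have exn : x l n = B n n + (csum (fun i => Kstrip l n i * B i n) +
    csum (fun i => Kstrip l n i * kapp (Kstrip l) (x l) i)).
  rewrite {1}ex -(csumD s1 s2); congr (_ + csum _); apply/funext => i.
  by rewrite {1}ex mulrDr.
have -> : csum (fun i => if i == n then 0 else B n i * B i n / ((a i)%:C - (a n)%:C)) =
    csum (fun i => Kstrip (a n)%:C n i * B i n).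
  congr csum; apply/funext => i; rewrite /Kstrip; case: ifP => _; first by rewrite mul0r.
  by rewrite mulrAC.
rewrite {1}e exn.
set c1 := csum _; set c2 := csum _; set c3 := csum _.
rewrite (_ : _ - _ = (c3 - c1) - c2); last by ring.
apply: le_trans (normcB _ _) _.
have -> : 4 * M * eps ^+ 2 = 2 * M * eps * eps + 2 * M * eps * eps by ring.
rewrite lerD//; last exact: csum_le.
rewrite /c1 /c3 -(csumB s3 s1); apply: csum_le => N.
apply: (@le_trans _ _ (2 * M * eps *
  \sum_(i < N) (if (i == n :> nat) then 0 else normc (B n i) / D i))); last first.
  by apply: ler_wpM2l (heps n N); rewrite !mulr_ge0.
rewrite mulr_sumr; apply: ler_sum => i _; rewrite /Kstrip; case: ifPn => ni.
  by rewrite !mul0r subrr normc0 mulr0.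
have -> : B n i / ((a i)%:C - (a n)%:C) * B i n - B n i / ((a i)%:C - l) * B i n =
    ((a n)%:C - l) * (B i n / ((a i)%:C - l)) * (B n i / ((a i)%:C - (a n)%:C)).
  have := off_neq h ni; have := off_neq hn ni.
  move: ((a i)%:C) ((a n)%:C) (B n i) (B i n) => A A' b b' hl' hl0.
  have e1 : (A - A')^-1 = (A - l) * (A - l)^-1 * (A - A')^-1 by rewrite divff// mul1r.
  have e2 : (A - l)^-1 = (A - A') * (A - A')^-1 * (A - l)^-1 by rewrite divff// mul1r.
  transitivity (b * ((A - l) * (A - l)^-1 * (A - A')^-1) * b' -
                b * ((A - A') * (A - A')^-1 * (A - l)^-1) * b'); first by rewrite -e1 -e2.
  ring.
rewrite 2!normcM; apply: ler_pM => //; rewrite ?mulr_ge0 ?normc_ge0//.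
  rewrite ler_pM ?mulr_ge0 ?normc_ge0// 1?normcBC//.
  (* Symmetry moves the entry from column n to row n, where it is a single term of a sum bounded by
     eps. *)
  rewrite normcM; apply: (@le_trans _ _ (normc (B n i) / D i)).
    by rewrite symB ler_wpM2l ?normc_ge0// off_inv.
  apply: le_trans (heps n i.+1); rewrite big_ord_recr /= (negbTE ni) lerDr.
  by apply: sumr_ge0 => j _; case: ifP => // _; rewrite divr_ge0 ?normc_ge0// ltW.
by rewrite normcM ler_wpM2l ?normc_ge0// off_inv.
Qed.

End strip.

(** * The spectrum of the sequence operator outside a left half-plane *)

Section structure.
Context {R : realType}.
Variables (a : nat -> R) (B : nat -> nat -> R[i]) (M Sa : R) (theta eps : nat -> R) (m : nat).
Hypothesis a0 : forall i, 0 < a i.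
Hypothesis sa : forall N, \sum_(i < N) (a i)^-1 <= Sa.
Hypothesis hB : forall j i, normc (B j i) <= M.
Hypothesis symB : forall j i, B j i = B i j.
Hypothesis amono : forall i j, (i < j)%N -> a i < a j.
Hypothesis aunb : forall A, exists n, A < a n.
Hypothesis m0 : (0 < m)%N.

(* The value at i = n is a dummy. *)
Definition half_gap (n i : nat) : R := if i == n then 1 else `|a i - a n| / 2.

Hypothesis htheta : forall n N,
  \sum_(i < N) (if (i == n :> nat) then 0 else (half_gap n i)^-1) <= theta n.
Hypothesis heps : forall n j N,
  \sum_(i < N) (if (i == n :> nat) then 0 else normc (B j i) / half_gap n i) <= eps n.
(** Required from n = m - 1 on, since the cut at [midpoint m] involves the gaps at both a_(m-1) and
    a_m. *)
Hypothesis hm : forall n, (m <= n.+1)%N -> M * theta n <= 1 / 4.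

Definition midpoint n : R := (a n.-1 + a n) / 2.

Let amonoW i j : (i <= j)%N -> a i <= a j.
Proof. by rewrite leq_eqVlt => /predU1P[->//|/amono/ltW]. Qed.

Lemma half_gap_gt0 n i : 0 < half_gap n i.
Proof.
rewrite /half_gap; case: eqVneq => // ni; rewrite divr_gt0// normr_gt0 subr_eq0.
by apply/eqP => e; case: (ltngtP i n) ni => // /amono; rewrite e ltxx.
Qed.

Let half_gap_lt n i : (i < n)%N -> half_gap n i = (a n - a i) / 2.
Proof.
by move=> lin; rewrite /half_gap (ltn_eqF lin) distrC gtr0_norm// subr_gt0 amono.
Qed.

Let half_gap_gt n i : (n < i)%N -> half_gap n i = (a i - a n) / 2.
Proof. by move=> lin; rewrite /half_gap (gtn_eqF lin) gtr0_norm// subr_gt0 amono. Qed.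

(** A single summand of theta_n already gives 4 M <= g with g the half gap, so moving from a_n by 2
    M leaves at least 2 g - 2 M >= g. *)
Lemma disc_off_column n l : (m <= n.+1)%N -> normc (l - (a n)%:C) <= 2 * M ->
  off_column a n (half_gap n) l.
Proof.
move=> mn hl i ni; have g0 := half_gap_gt0 n i.
have : (half_gap n i)^-1 <= theta n.
  apply: le_trans (htheta n i.+1); rewrite big_ord_recr /= (negbTE ni) lerDr.
  by apply: sumr_ge0 => j _; case: ifP => // _; rewrite invr_ge0 ltW// half_gap_gt0.
move=> /(ler_wpM2l (M_ge0 hB)) /le_trans /(_ (hm mn)).
rewrite ler_pdivrMr// => h4.
have e : normc ((a i)%:C - (a n)%:C) = 2 * half_gap n i.
  by rewrite -rmorphB normc_real /half_gap (negbTE ni); field.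
have : normc ((a i)%:C - (a n)%:C) <= normc ((a i)%:C - l) + normc (l - (a n)%:C).
  by apply: le_trans (normcD _ _); rewrite addrA subrK.
lra.
Qed.

Lemma strip_off_column n l : (0 < n)%N -> midpoint n <= complex.Re l ->
  complex.Re l <= midpoint n.+1 -> off_column a n (half_gap n) l.
Proof.
move=> n0; rewrite /midpoint /= => h1 h2 i ni; apply: le_trans (ler_Re _).
rewrite cReB cRe_real; case: (ltngtP i n) ni => // [lin|lni] _.
  have : a i <= a n.-1 by apply: amonoW; rewrite -ltnS prednK.
  by rewrite half_gap_lt// ler_normr opprB => ?; apply/orP; right; lra.
have := amonoW lni; rewrite half_gap_gt// ler_normr => ?.
by apply/orP; left; lra.
Qed.

Lemma halfplane_count n p (mu : nat -> R[i]) : (m <= n)%N ->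
  (forall i, (i < p)%N -> iseig a B (mu i)) ->
  (forall i, (i < p)%N -> complex.Re (mu i) < midpoint n) ->
  (forall i j, (i < p)%N -> (j < p)%N -> mu i = mu j -> i = j) -> (p <= n)%N.
Proof.
move=> mn; have n0 : (0 < n)%N by exact: leq_trans mn.
(* An entry is farther from the midpoint of a_(n-1) and a_n than half its distance to whichever of
   the two lies across the cut; hence the two sums theta_n and theta_(n-1), and 1 / 4 + 1 / 4 = 1 /
   2. *)
pose d j := if (j < n)%N then half_gap n j else half_gap n.-1 j.
apply: (@eig_count R a B M Sa a0 sa hB n (midpoint n) (theta n + theta n.-1) d).
- by move=> j; rewrite /d; case: ifP => _; exact: half_gap_gt0.
- move=> j; rewrite /d /midpoint; have [jn|nj] := ltnP j n.
    have : a j <= a n.-1 by apply: amonoW; rewrite -ltnS prednK.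
    by rewrite half_gap_lt//; lra.
  have := amonoW nj; rewrite half_gap_gt ?prednK//; lra.
- move=> N; apply: le_trans (lerD (htheta n N) (htheta n.-1 N)); rewrite -big_split /=.
  apply: ler_sum => i _; rewrite /d; have [lin|lni] := ltnP i n.
    rewrite ltn_eqF// lerDl; case: ifP => // _; rewrite invr_ge0 ltW//.
    exact: half_gap_gt0.
  rewrite (@gtn_eqF n.-1 i) ?prednK// lerDr; case: ifP => // _; rewrite invr_ge0 ltW//.
  exact: half_gap_gt0.
- rewrite mulrDr; have h1 := hm (leq_trans mn (leqnSn n)).
  have h2 : M * theta n.-1 <= 1 / 4 by apply: hm; rewrite prednK.
  lra.
Qed.

Lemma halfplane_chain_inj n l p z : (m <= n)%N -> complex.Re l < midpoint n ->
  chain a B l p z -> (forall j, (j < n)%N -> z 0%N j = 0) -> forall j, z 0%N j = 0.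
Proof.
move=> mn ln hz; have n0 : (0 < n)%N by exact: leq_trans mn.
pose d j := if (j < n)%N then half_gap n j else half_gap n.-1 j.
have X0 : inX a (z 0%N) by case: hz.
apply: (krein_neg_inj a0 sa X0).
apply: (@chain_neg R a B M Sa a0 sa hB n (midpoint n) (theta n + theta n.-1) d _ _ _ _ l p) => //.
- by move=> j; rewrite /d; case: ifP => _; exact: half_gap_gt0.
- move=> j; rewrite /d /midpoint; have [jn|nj] := ltnP j n.
    have : a j <= a n.-1 by apply: amonoW; rewrite -ltnS prednK.
    by rewrite half_gap_lt//; lra.
  have := amonoW nj; rewrite half_gap_gt ?prednK//; lra.
- move=> N; apply: le_trans (lerD (htheta n N) (htheta n.-1 N)); rewrite -big_split /=.
  apply: ler_sum => i _; rewrite /d; have [lin|lni] := ltnP i n.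
    rewrite ltn_eqF// lerDl; case: ifP => // _; rewrite invr_ge0 ltW//.
    exact: half_gap_gt0.
  rewrite (@gtn_eqF n.-1 i) ?prednK// lerDr; case: ifP => // _; rewrite invr_ge0 ltW//.
  exact: half_gap_gt0.
- rewrite mulrDr; have h1 := hm (leq_trans mn (leqnSn n)).
  have h2 : M * theta n.-1 <= 1 / 4 by apply: hm; rewrite prednK.
  lra.
Qed.

Lemma midpoint_unbounded A : exists2 n, (m <= n)%N & A < midpoint n.
Proof.
have [n hn] := aunb A; exists (maxn m n.+1); first exact: leq_maxl.
rewrite /midpoint.
have := amonoW (leq_maxr m n.+1).
have : a n <= a (maxn m n.+1).-1.
  by apply: amonoW; rewrite -ltnS prednK ?leq_maxr// (leq_trans m0) ?leq_maxl.
have := amono (ltnSn n); lra.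
Qed.

(** An eigenvalue right of [midpoint m] lies in a strip between consecutive midpoints. Uniqueness
    among the l satisfying [off_column] identifies it with lam n, although the latter was found in a
    disc. *)
Lemma seq_spectrum : exists lam : nat -> R[i],
  (forall n, (m <= n)%N -> iseig a B (lam n) /\
     normc (lam n - ((a n)%:C - B n n - csum (fun i => if i == n then 0 else
       B n i * B i n / ((a i)%:C - (a n)%:C)))) <= 4 * M * eps n ^+ 2) /\
  forall l, iseig a B l -> complex.Re l < midpoint m \/ exists2 n, (m <= n)%N & l = lam n.
Proof.
have hS n (mn : (m <= n)%N) : exists2 x, normc (x - (a n)%:C) <= 2 * M & iseig a B x.
  have mn1 := leq_trans mn (leqnSn n).
  have [x hx] := strip_solution a hB (half_gap_gt0 n) (htheta n) (hm mn1).
  exact: (strip_exists a0 sa hB (half_gap_gt0 n) (htheta n) (hm mn1)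
    (fun l => @disc_off_column n l mn1) hx).
have /choice[lam hlam] n : exists x, (m <= n)%N ->
    normc (x - (a n)%:C) <= 2 * M /\ iseig a B x.
  case: (boolP (m <= n)%N) => [/hS[x h1 h2]|_]; [by exists x|by exists 0].
exists lam; split=> [n mn|l el].
  have [h1 h2] := hlam n mn; split => //.
  have mn1 := leq_trans mn (leqnSn n).
  have [x hx] := strip_solution a hB (half_gap_gt0 n) (htheta n) (hm mn1).
  exact: (strip_estimate a0 sa hB symB (half_gap_gt0 n) (htheta n) (hm mn1) (heps n)
    (fun l => @disc_off_column n l mn1) hx).
have [lt|ge] := ltP (complex.Re l) (midpoint m); [by left|right].
have ex : exists n, (m < n)%N && (complex.Re l < midpoint n).
  have [n mn hn] := midpoint_unbounded (complex.Re l); exists n; rewrite hn andbT.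
  by rewrite ltn_neqAle mn andbT; apply/eqP => e; move: hn; rewrite -e ltNge ge.
case: (ex_minnP ex) => -[//|n] /andP[mn ln] nmin; rewrite ltnS in mn.
have gn : midpoint n <= complex.Re l.
  move: mn; rewrite leq_eqVlt => /predU1P[<-//|mn].
  rewrite leNgt; apply/negP => ln'; have := nmin n; rewrite mn ln' => /(_ isT).
  by rewrite ltnn.
exists n => //; have n0 : (0 < n)%N by exact: leq_trans mn.
have mn1 := leq_trans mn (leqnSn n).
have [x hx] := strip_solution a hB (half_gap_gt0 n) (htheta n) (hm mn1).
have [h1 h2] := hlam n mn.
apply: (strip_unique a0 sa hB (half_gap_gt0 n) (htheta n) (hm mn1) hx) => //.
  by apply: strip_off_column => //; exact: ltW.
exact: disc_off_column.
Qed.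

End structure.

(** * Absolutely continuous functions and their densities *)

Section real_abs_continuity.
Context {R : realType}.
Implicit Types (w e d : R) (f : R -> R).
Notation leb := (@lebesgue_measure R).
Notation TV := total_variation.

Definition disjoint_family w (T : finType) (a b : T -> R) :=
  (forall i, [/\ 0 <= a i, a i <= b i & b i <= w]) /\
  trivIset setT (fun i => [set` `]a i, b i[]).

(** Families are indexed by arbitrary finite types so that a refinement, indexed by pairs of an
    interval and a subinterval, needs no renumbering. *)
Definition abs_cont w f := forall e, 0 < e -> exists2 d, 0 < d &
  forall (T : finType) (a b : T -> R), disjoint_family w a b ->
    \sum_i (b i - a i) < d -> \sum_i `|f (b i) - f (a i)| < e.

Lemma disjoint_familyS w (T T' : finType) (h : T' -> T) (a b : T -> R) : injective h ->
  disjoint_family w a b -> disjoint_family w (a \o h) (b \o h).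
Proof.
move=> hi [hab tr]; split=> [i|i j _ _ hij]; first exact: hab.
by apply: hi; exact: (tr (h i) (h j)).
Qed.

Lemma reindex_enum_ord (T : finType) (F : T -> R) :
  \sum_i F i = \sum_(k < #|T|) F (enum_val k).
Proof. by rewrite (reindex _ (onW_bij _ (@enum_val_bij T))). Qed.

Lemma abs_contP w f :
  (forall e, 0 < e -> exists2 d, 0 < d & forall (n : nat) (a b : 'I_n -> R),
    disjoint_family w a b -> \sum_i (b i - a i) < d ->
    \sum_i `|f (b i) - f (a i)| < e) -> abs_cont w f.
Proof.
move=> h e /h[d d0 hd]; exists d => // T a b fab.
rewrite (reindex_enum_ord (fun i => b i - a i)) => lt.
rewrite (reindex_enum_ord (fun i => `|f (b i) - f (a i)|)).
exact: (hd _ _ _ (disjoint_familyS (@enum_val_inj _ _) fab)).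
Qed.

Lemma abs_cont_pair w f e : abs_cont w f -> 0 < e -> exists2 d, 0 < d &
  forall x y, 0 <= x -> x <= y -> y <= w -> y - x < d -> `|f y - f x| < e.
Proof.
move=> h /h[d d0 hd]; exists d => // x y x0 xy yw yx.
have := hd [the finType of 'I_1] (fun=> x) (fun=> y).
rewrite !big_ord1; apply => //; split => // i j _ _ _.
by rewrite (ord1 i) (ord1 j).
Qed.

Lemma abs_contB w f g : abs_cont w f -> abs_cont w g -> abs_cont w (fun x => f x - g x).
Proof.
move=> hf hg e e0; have e2 : 0 < e / 2 by rewrite divr_gt0.
have [d d0 hd] := hf _ e2; have [d' d'0 hd'] := hg _ e2.
exists (Num.min d d') => [|T a b fab]; first by rewrite lt_min d0.
rewrite lt_min => /andP[/(hd _ _ _ fab) h1 /(hd' _ _ _ fab) h2].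
rewrite (splitr e) (le_lt_trans _ (ltrD h1 h2))// -big_split; apply: ler_sum => i _ /=.
by rewrite (_ : _ - _ = (f (b i) - f (a i)) - (g (b i) - g (a i))) ?ler_normB//; ring.
Qed.

Definition part_pt (a b : R) (s : seq R) k := nth b (a :: s) k.

Lemma part_mono a b s : itv_partition a b s ->
  forall i j, (i <= j <= size s)%N -> part_pt a b s i <= part_pt a b s j.
Proof.
move=> [pas _] i j /andP[ij js]; rewrite /part_pt.
have srt : sorted <=%R (a :: s) by apply: sub_path pas => x y; exact: ltW.
by apply: (sorted_leq_nth le_trans lexx b srt) => //; rewrite inE /= ltnS// (leq_trans ij).
Qed.

Lemma part_last a b s : itv_partition a b s -> part_pt a b s (size s) = b.
Proof. by move=> [_ /eqP <-]; rewrite /part_pt nth_last. Qed.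

Lemma part_in a b s k : itv_partition a b s -> (k <= size s)%N ->
  a <= part_pt a b s k <= b.
Proof.
move=> abs ks; apply/andP; split.
  exact: (part_mono abs (i := 0) (j := k)).
by rewrite -[leRHS](part_last abs); apply: (part_mono abs); rewrite ks leqnn.
Qed.

Lemma variation_ord a b f s : variation a b f s =
  \sum_(k < size s) `|f (part_pt a b s k.+1) - f (part_pt a b s k)|.
Proof. by rewrite /variation big_mkord. Qed.

Lemma part_sum a b s : itv_partition a b s ->
  \sum_(k < size s) (part_pt a b s k.+1 - part_pt a b s k) = b - a.
Proof.
move=> abs; rewrite -(big_mkord xpredT (fun k => part_pt a b s k.+1 - part_pt a b s k)).
by rewrite telescope_sumr// part_last.
Qed.

Lemma in_oo (a b x : R) : [set` `]a, b[] x <-> a < x < b.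
Proof. by rewrite /= in_itv. Qed.

Lemma part_disjoint a b s (i j : nat) x : itv_partition a b s ->
  (i < size s)%N -> (j < size s)%N ->
  part_pt a b s i < x < part_pt a b s i.+1 ->
  part_pt a b s j < x < part_pt a b s j.+1 -> i = j.
Proof.
move=> abs ik jk /andP[h1 h2] /andP[h3 h4].
case: (ltngtP i j) => // [ij|ji].
  have := part_mono abs (i := i.+1) (j := j); rewrite ij ltnW// => /(_ isT).
  by move=> /(lt_le_trans h2)/lt_trans/(_ h3); rewrite ltxx.
have := part_mono abs (i := j.+1) (j := i); rewrite ji ltnW// => /(_ isT).
by move=> /(lt_le_trans h4)/lt_trans/(_ h1); rewrite ltxx.
Qed.

(* Refining each interval of a disjoint family by a partition gives again a
   disjoint family, of the same total length. *)
Lemma family_variation w f e : abs_cont w f -> 0 < e -> exists2 d, 0 < d &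
  forall (T : finType) (a b : T -> R) (s : T -> seq R), disjoint_family w a b ->
    (forall i, itv_partition (a i) (b i) (s i)) ->
    \sum_i (b i - a i) < d -> \sum_i variation (a i) (b i) f (s i) < e.
Proof.
move=> h /h[d d0 hd]; exists d => // T a b s [hab tr] hs lt.
pose T' := {i : T & 'I_(size (s i))}.
pose a' (p : T') := part_pt (a (tag p)) (b (tag p)) (s (tag p)) (tagged p).
pose b' (p : T') := part_pt (a (tag p)) (b (tag p)) (s (tag p)) (tagged p).+1.
have hd' := hd _ a' b'.
under eq_bigr do rewrite variation_ord.
rewrite (sig_big_dep xpredT (fun=> xpredT) (fun i (k : 'I_(size (s i))) =>
  `|f (part_pt (a i) (b i) (s i) k.+1) - f (part_pt (a i) (b i) (s i) k)|)) /=.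
apply: hd'; last first.
  suff -> : \sum_i (b' i - a' i) = \sum_i (b i - a i) by [].
  under [RHS]eq_bigr do rewrite -(part_sum (hs _)).
  by rewrite (sig_big_dep xpredT (fun=> xpredT) (fun i (k : 'I_(size (s i))) =>
    part_pt (a i) (b i) (s i) k.+1 - part_pt (a i) (b i) (s i) k)).
split=> [[i k]|[i k] [j l] _ _ [x [/in_oo h1 /in_oo h2]]].
  rewrite /a' /b' /=; have [a0 ab bw] := hab i; split.
  - by have /andP[h1 _] := part_in (hs i) (ltnW (ltn_ord k)); exact: le_trans h1.
  - by apply: part_mono => //; rewrite leqnSn ltn_ord.
  - by have /andP[_ h1] := part_in (hs i) (ltn_ord k); exact: le_trans bw.
rewrite /a' /b' /= in h1 h2.
have ij : i = j.
  apply: tr => //; exists x; split; apply/in_oo.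
    have /andP[h3 _] := part_in (hs i) (ltnW (ltn_ord k)).
    have /andP[_ h4] := part_in (hs i) (ltn_ord k).
    by move/andP: h1 => [/(le_lt_trans h3) -> /lt_le_trans/(_ h4) ->].
  have /andP[h3 _] := part_in (hs j) (ltnW (ltn_ord l)).
  have /andP[_ h4] := part_in (hs j) (ltn_ord l).
  by move/andP: h2 => [/(le_lt_trans h3) -> /lt_le_trans/(_ h4) ->].
subst j; congr existT; apply: val_inj.
exact: (part_disjoint (hs i) (ltn_ord k) (ltn_ord l) h1 h2).
Qed.

(** On a subinterval shorter than the d belonging to e = 1 every partition sum is below 1; K such
    subintervals cover [0, w]. *)
Lemma abs_cont_bv w f : 0 <= w -> abs_cont w f -> bounded_variation 0 w f.
Proof.
move=> w0 h; have [d d0 hd] := family_variation h ltr01.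
have small x y : 0 <= x -> x <= y -> y <= w -> y - x < d -> TV x y f \is a fin_num.
  move=> x0 xy yw lt; apply/bounded_variationP => //; exists 1 => _ [s hs <-].
  have := hd [the finType of 'I_1] (fun=> x) (fun=> y) (fun=> s).
  rewrite !big_ord1 => h1; apply/ltW/h1 => //; split => // i j _ _ _.
  by rewrite (ord1 i) (ord1 j).
have [K hK] : exists K : nat, w < d * K%:R.
  exists (Num.bound (w / d)); rewrite -ltr_pdivrMl// mulrC.
  by have := archi_boundP (divr_ge0 w0 (ltW d0)).
have K0 : (0 < K)%N by case: K hK => // ; rewrite mulr0 ltNge w0.
pose x j : R := w * j%:R / K%:R.
have KR : (0 : R) < K%:R by rewrite ltr0n.
have x0 j : 0 <= x j by rewrite !mulr_ge0// invr_ge0.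
have xS j : x j.+1 - x j = w / K%:R.
  by rewrite /x -natr1 mulrDr mulr1; field; rewrite gt_eqF.
have xle j : x j <= x j.+1 by rewrite -subr_ge0 xS divr_ge0.
have xw j : (j <= K)%N -> x j <= w.
  by move=> jK; rewrite /x -mulrA ler_piMr// ler_pdivrMr// mul1r ler_nat.
have fin j : (j <= K)%N -> TV 0 (x j) f \is a fin_num.
  elim: j => [|j ih] jK; first by rewrite /x mulr0 mul0r total_variationxx.
  rewrite (total_variationD f (x0 j) (xle j)) fin_numD ih ?(ltnW jK)//=.
  apply: small => //; first exact: xw.
  by rewrite xS ltr_pdivrMr.
apply/bounded_variationP => //; have := fin K (leqnn _).
by rewrite /x mulfK// gt_eqF.
Qed.

Definition tvf f x : R := fine (TV 0 x f).

Section tv.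
Variables (w : R) (f : R -> R).
Hypotheses (w0 : 0 <= w) (hf : abs_cont w f).
Let bv := abs_cont_bv w0 hf.

Lemma tv_fin x y : 0 <= x -> x <= y -> y <= w -> TV x y f \is a fin_num.
Proof.
move=> x0 xy yw; apply/(bounded_variationP _ xy).
apply: (bounded_variationl xy yw); apply: (bounded_variationr x0 (le_trans xy yw)).
exact: bv.
Qed.

Lemma tvfB x y : 0 <= x -> x <= y -> y <= w -> tvf f y - tvf f x = fine (TV x y f).
Proof.
move=> x0 xy yw; rewrite /tvf (total_variationD f x0 xy) fineD ?tv_fin//.
  by rewrite addrAC subrr add0r.
exact: le_trans yw.
Qed.

Lemma tvf_ge x y : 0 <= x -> x <= y -> y <= w -> `|f y - f x| <= tvf f y - tvf f x.
Proof.
move=> x0 xy yw; rewrite tvfB// -lee_fin fineK ?tv_fin//.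
exact: total_variation_ge.
Qed.

Lemma tvf_abs_cont : abs_cont w (tvf f).
Proof.
move=> e e0; have e2 : 0 < e / 2 by rewrite divr_gt0.
have [d d0 hd] := family_variation hf e2.
(* Each variation is approximated by a partition sum up to eta, so the errors add up to at most e /
   2; the successor keeps the denominator nonzero for an empty family. *)
exists d => // T a b fab lt; pose eta := e / 2 / (#|T|.+1)%:R.
have eta0 : 0 < eta by rewrite divr_gt0.
have /choice[s hs] i : exists s, itv_partition (a i) (b i) s /\
    `|tvf f (b i) - tvf f (a i)| <= variation (a i) (b i) f s + eta.
  have [ai ab bi] := fab.1 i.
  rewrite tvfB// ger0_norm ?fine_ge0 ?total_variation_ge0//.
  have [_ [_ [s hs <-] <-] hlt] := ub_ereal_sup_adherent eta0 (tv_fin ai ab bi).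
  exists s; split => //; rewrite -lerBlDr ltW// -lte_fin EFinB fineK//.
  exact: tv_fin.
have hsum := hd _ a b s fab (fun i => (hs i).1) lt.
rewrite (splitr e) (@le_lt_trans _ _ (\sum_i (variation (a i) (b i) f (s i) + eta)))//.
  by apply: ler_sum => i _; exact: (hs i).2.
have hE : eta *+ #|T| <= e / 2.
  rewrite -mulr_natr /eta mulrAC ler_pdivrMr ?ltr0n// ler_wpM2l ?ler_nat//.
  exact: ltW.
by rewrite big_split /= ltr_leD// sumr_const.
Qed.

End tv.

End real_abs_continuity.

(** * Densities of absolutely continuous functions by Radon-Nikodym *)

Section density.
Context {R : realType}.
Implicit Types (w e d x y : R) (f g : R -> R).
Notation leb := (@lebesgue_measure R).

(** The nearest point of [0, w]. Composition with it extends a function from [0, w] to the line by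
    constants; being nondecreasing and 1-Lipschitz, it preserves monotonicity and continuity. *)
Definition clamp w x : R := if x < 0 then 0 else if w < x then w else x.

Lemma clamp_itv w x : 0 <= w -> 0 <= clamp w x <= w.
Proof.
by move=> w0; rewrite /clamp; case: (ltP x 0) => ?; case: (ltP w x) => ?; apply/andP; split; lra.
Qed.

Lemma clamp_id w x : 0 <= x <= w -> clamp w x = x.
Proof.
by move=> /andP[x0 xw]; rewrite /clamp; case: (ltP x 0) => ?; case: (ltP w x) => ?; lra.
Qed.

Lemma clamp_le w x y : 0 <= w -> x <= y -> clamp w x <= clamp w y.
Proof.
by move=> w0 xy; rewrite /clamp; case: (ltP x 0) => ?; case: (ltP w x) => ?;
  case: (ltP y 0) => ?; case: (ltP w y) => ?; lra.
Qed.

Lemma clamp_lip w x y : 0 <= w -> x <= y -> clamp w y - clamp w x <= y - x.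
Proof.
by move=> w0 xy; rewrite /clamp; case: (ltP x 0) => ?; case: (ltP w x) => ?;
  case: (ltP y 0) => ?; case: (ltP w y) => ?; lra.
Qed.

Lemma open_interval_itv (I : set R) : open I -> is_interval I ->
  has_lbound I -> has_ubound I ->
  exists ab : R * R, ab.1 <= ab.2 /\ I = [set` `]ab.1, ab.2[].
Proof.
move=> oI iI lI uI; have [->|I0] := eqVneq I set0.
  by exists (0, 0); split => //=; rewrite set_itv_ge ?bnd_simp ?ltxx.
have E : I = [set` `]inf I, sup I[].
  rewrite {1}(_ : I = I°); last by apply/esym/interior_id.
  rewrite interval_bounded_interior//; apply/seteqP; split => r /=; by rewrite in_itv.
exists (inf I, sup I); split => //=.
move/set0P: I0 => [r]; rewrite {1}E /= in_itv /= => /andP[h1 h2].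
exact: ltW (lt_trans h1 h2).
Qed.

Lemma measure_bigcupT (dT : measure_display) (T : measurableType dT) (m : {measure set T -> \bar R})
    (I : nat -> set T) : (forall q, measurable (I q)) -> trivIset setT I ->
  m (\bigcup_q I q) = (\sum_(0 <= q <oo) m (I q))%E.
Proof.
move=> mI tI; rewrite measure_bigcup//; apply: eq_eseriesl => q.
by rewrite in_setT.
Qed.

Lemma lebesgue_stieltjes_measure_oc (C : cumulative R R) x y : x <= y ->
  lebesgue_stieltjes_measure C `]x, y]%classic = (C y - C x)%:E.
Proof.
move=> xy; rewrite /lebesgue_stieltjes_measure /measure_extension/=.
by rewrite measurable_mu_extE/= ?wlength_itv_bnd//; exact: is_ocitv.
Qed.

Section monotone.
Variables (w : R) (f : R -> R).
Hypothesis w0 : 0 <= w.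
Hypothesis fmono : forall x y, 0 <= x -> x <= y -> y <= w -> f x <= f y.
Hypothesis fac : abs_cont w f.

Let F x := f (clamp w x).

Let Fmono : nondecreasing F.
Proof.
move=> x y xy; have /andP[h1 _] := clamp_itv x w0; have /andP[_ h2] := clamp_itv y w0.
by apply: fmono => //; exact: clamp_le.
Qed.

Let Frc : forall x, F @ at_right x --> F x.
Proof.
move=> x; apply/cvgrPdist_lt => e e0; have [d d0 hd] := abs_cont_pair fac e0.
near=> y; rewrite distrC.
have /andP[h1 _] := clamp_itv x w0; have /andP[_ h2] := clamp_itv y w0.
have xy : x <= y by near: y; exact: nbhs_right_ge.
apply: hd => //; first exact: clamp_le.
apply: le_lt_trans (clamp_lip w0 xy) _; rewrite ltrBlDr addrC.
by near: y; apply: nbhs_right_lt; rewrite ltrDl.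
Unshelve. all: by end_near. Qed.

Let C : cumulative R R := HB.pack F (isCumulative.Build R _ R F Fmono Frc).

Let mu := lebesgue_stieltjes_measure C.

Let mu_oc x y : x <= y -> mu `]x, y]%classic = (F y - F x)%:E.
Proof. exact: lebesgue_stieltjes_measure_oc. Qed.

(** A null set is covered by an open set of small length, a disjoint union of open intervals.
    Clamped to [0, w], finitely many of them form a family of total length below d, on which
    absolute continuity bounds the increments of f. *)
Let mu_dom (E : set R) : measurable E -> leb E = 0%E -> mu (E `&` `]0, w]%classic) = 0%E.
Proof.
move=> mE E0; apply/eqP; rewrite eq_le measure_ge0 andbT.
apply/lee_addgt0Pr => e e0; rewrite add0e.
have [d d0 hd] := fac e0.
have Efin : (leb E < +oo)%E by rewrite E0.
have [U [oU EU Ud]] := lebesgue_regularity_outer mE Efin d0.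
have mU := open_measurable oU.
have Ult : (leb U < d%:E)%E.
  apply: le_lt_trans Ud; have := measureU2 leb mE (measurableD mU mE).
  by rewrite /= setDUK// E0 add0e.
(* Cutting to a bounded set gives every component interval finite end points. *)
pose V := U `&` `]-1, w + 1[%classic.
have oV : open V by apply: openI => //; exact: interval_open.
have mV := open_measurable oV.
pose I := open_disjoint_itv oV.
have /choice[ab hab] q : exists ab : R * R, ab.1 <= ab.2 /\ I q = [set` `]ab.1, ab.2[].
  have IV : I q `<=` V by rewrite (open_disjoint_itv_bigcup oV) => x Ix; exists q.
  apply: open_interval_itv.
  - exact: open_disjoint_itv_open.
  - exact: open_disjoint_itv_is_interval.
  - by exists (-1) => x /IV[_]; rewrite /= in_itv /= => /andP[/ltW].
  - by exists (w + 1) => x /IV[_]; rewrite /= in_itv /= => /andP[_ /ltW].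
have mI q : measurable (I q) by rewrite (hab q).2; exact: measurable_itv.
have tI : trivIset setT I by exact: open_disjoint_itv_trivIset.
have VI : V = \bigcup_q I q by exact: open_disjoint_itv_bigcup.
apply: (@le_trans _ _ (mu V)).
  apply: le_measure; rewrite ?inE//; first by apply: measurableI => //; exact: measurable_itv.
  move=> x [/EU Ux]; rewrite /= in_itv /= => /andP[x0 xw]; split => //.
  by rewrite /= in_itv /=; apply/andP; split; lra.
rewrite VI /mu (measure_bigcupT (lebesgue_stieltjes_measure C) mI tI).
apply: lime_le; first by apply: is_cvg_nneseries => q _ _; exact: measure_ge0.
apply: nearW => N.
have len : \sum_(q < N) ((ab q).2 - (ab q).1) < d.
  rewrite -lte_fin; apply: le_lt_trans Ult; apply: (@le_trans _ _ (leb V)); last first.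
    by apply: le_measure; rewrite ?inE// => x [].
  rewrite VI (measure_bigcupT leb mI tI).
  apply: (@le_trans _ _ (\sum_(0 <= q < N) leb (I q))%E).
    rewrite big_mkord -sumEFin; apply: lee_sum => q _.
    rewrite (hab q).2 lebesgue_measure_itv /= lte_fin; case: ltP => // h.
    by rewrite lee_fin subr_le0.
  by apply: nneseries_lim_ge => *; exact: measure_ge0.
have hF := hd [the finType of 'I_N] (fun q => clamp w (ab q).1) (fun q => clamp w (ab q).2).
rewrite big_mkord; apply: (@le_trans _ _ (\sum_(q < N) (F (ab q).2 - F (ab q).1)%:E)%E).
  apply: lee_sum => q _; rewrite -mu_oc; last exact: (hab q).1.
  rewrite /mu; apply: (le_measure (lebesgue_stieltjes_measure C)); rewrite ?inE.
  - exact: mI.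
  - exact: measurable_itv.
  by rewrite (hab q).2 => x; rewrite /= !in_itv /= => /andP[-> /ltW].
rewrite sumEFin lee_fin.
apply: (@le_trans _ _ (\sum_(q < N) `|F (ab q).2 - F (ab q).1|)).
  by apply: ler_sum => q _; exact: ler_norm.
apply/ltW/hF.
  split=> [q|p q _ _ [x []]].
    have /andP[h1 _] := clamp_itv (ab q).1 w0; have /andP[_ h2] := clamp_itv (ab q).2 w0.
    by split => //; apply: clamp_le => //; exact: (hab q).1.
  have aux (r : 'I_N) : `]clamp w (ab r).1, clamp w (ab r).2[%classic x -> I r x.
    rewrite (hab r).2 /= !in_itv /= => /andP[h1 h2].
    have /andP[h3 _] := clamp_itv (ab r).1 w0; have /andP[_ h4] := clamp_itv (ab r).2 w0.
    have xw : 0 <= x <= w by apply/andP; split; lra.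
    apply/andP; split; rewrite ltNge; apply/negP => /(clamp_le w0).
      by rewrite (clamp_id xw) leNgt h1.
    by rewrite (clamp_id xw) leNgt h2.
  by move=> /aux h1 /aux h2; apply: val_inj; apply: tI => //; exists x.
apply: le_lt_trans len; apply: ler_sum => q _; apply: clamp_lip => //; exact: (hab q).1.
Qed.

(** The increment f x - f 0 is the Stieltjes measure of ]0, x]; restricted to ]0, w] this measure is
    finite and dominated by Lebesgue measure, so it has an integrable density. *)
Lemma mono_density : exists g, leb.-integrable setT (EFin \o g) /\
  forall x, 0 <= x <= w -> f x = f 0 + \int[leb]_(t in `[0, x]) g t.
Proof.
have mD : measurable (`]0, w]%classic : set (measurableTypeR R)) by exact: measurable_itv.
have fD : (mu `]0%R, w]%classic < +oo)%E by rewrite mu_oc// ltry.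
pose nu := mfrestr mD fD.
have dom : nu `<< leb.
  by apply/null_content_dominatesP => E mE E0; exact: mu_dom.
have [h [h0 hfin hint hE]] := radon_nikodym_sigma_finite dom.
have hg : h = EFin \o (fun x => fine (h x)) by apply/funext => x /=; rewrite fineK.
have ig : leb.-integrable setT (EFin \o (fun x => fine (h x))) by rewrite -hg.
exists (fun x => fine (h x)); split => // x /andP[x0 xw].
rewrite -Rintegral_itv_obnd_cbnd; last exact: integrableS ig.
have mx : measurable (`]0, x]%classic : set (measurableTypeR R)) by exact: measurable_itv.
have := hE _ mx; rewrite /nu /= /mfrestr /= /mrestr setIidl; last first.
  by move=> t; rewrite /= !in_itv /= => /andP[-> /le_trans]; exact.
rewrite (lebesgue_stieltjes_measure_oc C x0) /= /F clamp_id ?x0// clamp_id ?lexx//.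
rewrite /Rintegral; under [X in _ -> _ = _ + fine X]eq_integral do rewrite fineK//.
by move=> <- /=; rewrite addrC subrK.
Qed.

End monotone.

(** Jordan decomposition: f is the difference of its variation function V and V - f, both
    nondecreasing and absolutely continuous. *)
Lemma abs_cont_density w f : 0 <= w -> abs_cont w f ->
  exists g, leb.-integrable setT (EFin \o g) /\
  forall x, 0 <= x <= w -> f x = f 0 + \int[leb]_(t in `[0, x]) g t.
Proof.
move=> w0 fac; have tac := tvf_abs_cont w0 fac.
have [|g [ig eg]] := @mono_density w (tvf f) w0 _ tac.
  move=> x y x0 xy yw; rewrite -subr_ge0; apply: le_trans (tvf_ge w0 fac x0 xy yw).
  exact: normr_ge0.
have [|h [ih eh]] := @mono_density w (fun x => tvf f x - f x) w0 _ (abs_contB tac fac).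
  move=> x y x0 xy yw; have := tvf_ge w0 fac x0 xy yw.
  by move=> /(le_trans (ler_norm _)); lra.
exists (fun x => g x - h x); split.
  by rewrite (_ : EFin \o _ = (EFin \o g) \- (EFin \o h))%E//; exact: integrableB.
move=> x hx; rewrite RintegralB//; [|exact: integrableS ig|exact: integrableS ih].
by have := eg x hx; have := eh x hx; lra.
Qed.

End density.

(** * Integrals of complex functions on [0, w] *)

Section almost_everywhere.
Context {R : realType}.
Notation leb := (@lebesgue_measure R).
Implicit Types P Q : R -> Prop.

Lemma aeS P Q : {ae leb, forall t, P t} -> (forall t, P t -> Q t) ->
  {ae leb, forall t, Q t}.
Proof. by move=> hP PQ; apply: filterS hP; first exact: (ae_filter_ringOfSetsType leb). Qed.

Lemma aeI P Q : {ae leb, forall t, P t} -> {ae leb, forall t, Q t} ->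
  {ae leb, forall t, P t /\ Q t}.
Proof. by move=> hP hQ; apply: filterI => //; exact: (ae_filter_ringOfSetsType leb). Qed.

Lemma aeE P : (forall t, P t) -> {ae leb, forall t, P t}.
Proof. by move=> h; apply: filterE => //; exact: (ae_filter_ringOfSetsType leb). Qed.

End almost_everywhere.

Section real_integrals.
Context {R : realType}.
Notation leb := (@lebesgue_measure R).
Implicit Types (w x : R) (f g : R -> R).

Definition rintegrable w f := leb.-integrable `[0, w] (EFin \o f).

Lemma in_cc x y t : [set` `[x, y]] t <-> x <= t <= y.
Proof. by rewrite /= in_itv. Qed.

Lemma rint_meas w f : rintegrable w f -> measurable_fun `[0, w] f.
Proof. by move=> /integrableP[/measurable_EFinP]. Qed.

Lemma rint_dom w f g : measurable_fun `[0, w] f -> rintegrable w g ->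
  (forall t, 0 <= t <= w -> `|f t| <= g t) -> rintegrable w f.
Proof.
move=> mf ig h; apply: (le_integrable _ _ _ ig).
- exact: measurable_itv.
- exact/measurable_EFinP.
- by move=> t /in_cc /h h'; rewrite lee_fin (le_trans h')// ler_norm.
Qed.

Lemma rint_cst w c : rintegrable w (fun=> c).
Proof.
apply: continuous_compact_integrable; first exact: segment_compact.
by apply: continuous_subspaceT => x; exact: cvg_cst.
Qed.

Lemma rintZ w c f : rintegrable w f -> rintegrable w (fun t => c * f t).
Proof. by move=> h; apply: integrableZl h; exact: measurable_itv. Qed.

Lemma rintD w f g : rintegrable w f -> rintegrable w g -> rintegrable w (fun t => f t + g t).
Proof. by move=> h h'; apply: integrableD h h'; exact: measurable_itv. Qed.

Lemma rintN w f : rintegrable w f -> rintegrable w (fun t => - f t).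
Proof. by move=> /(rintZ (-1)); congr rintegrable; apply/funext => t; rewrite mulN1r. Qed.

Lemma rintB w f g : rintegrable w f -> rintegrable w g -> rintegrable w (fun t => f t - g t).
Proof. by move=> h /rintN h'; exact: rintD. Qed.

Lemma rint_norm w f : rintegrable w f -> rintegrable w (fun t => `|f t|).
Proof.
move=> h; apply: (le_integrable _ _ _ h) => [||t _]; last by rewrite /= normr_id.
  exact: measurable_itv.
by apply/measurable_EFinP; apply: measurableT_comp => //; exact: rint_meas.
Qed.

Lemma rintS w x f : x <= w -> rintegrable w f -> rintegrable x f.
Proof.
move=> xw; apply: integrableS => //; try exact: measurable_itv.
by move=> t /in_cc /andP[t0 tx]; apply/in_cc; rewrite t0 (le_trans tx).
Qed.

End real_integrals.

Section complex_integrals.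
Context {R : realType}.
Notation leb := (@lebesgue_measure R).
Implicit Types (w x : R) (f g : R -> R[i]).

Definition cmeas w f := measurable_fun `[0, w] (fun t => complex.Re (f t)) /\
  measurable_fun `[0, w] (fun t => complex.Im (f t)).
Definition cintegrable w f := rintegrable w (fun t => complex.Re (f t)) /\
  rintegrable w (fun t => complex.Im (f t)).

Lemma cint_meas w f : cintegrable w f -> cmeas w f.
Proof. by case=> /rint_meas h /rint_meas h'. Qed.

Lemma cmeasM w f g : cmeas w f -> cmeas w g -> cmeas w (fun t => f t * g t).
Proof.
move=> [fr fi] [gr gi]; split.
  rewrite (_ : (fun _ => _) = fun t => complex.Re (f t) * complex.Re (g t) -
      complex.Im (f t) * complex.Im (g t)); last by apply/funext => t; rewrite cReM.
  by apply: measurable_funB; exact: measurable_funM.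
rewrite (_ : (fun _ => _) = fun t => complex.Re (f t) * complex.Im (g t) +
    complex.Im (f t) * complex.Re (g t)); last by apply/funext => t; rewrite cImM.
by apply: measurable_funD; exact: measurable_funM.
Qed.

Lemma cmeasD w f g : cmeas w f -> cmeas w g -> cmeas w (fun t => f t + g t).
Proof.
move=> [fr fi] [gr gi]; split.
  rewrite (_ : (fun _ => _) = fun t => complex.Re (f t) + complex.Re (g t)).
    exact: measurable_funD.
  by apply/funext => t; rewrite cReD.
rewrite (_ : (fun _ => _) = fun t => complex.Im (f t) + complex.Im (g t)).
  exact: measurable_funD.
by apply/funext => t; rewrite cImD.
Qed.

Lemma cmeas_cst w (z : R[i]) : cmeas w (fun=> z).
Proof. by split; exact: measurable_cst. Qed.

Lemma cmeasZ w z f : cmeas w f -> cmeas w (fun t => z * f t).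
Proof. by move=> h; apply: cmeasM => //; exact: cmeas_cst. Qed.

Lemma cmeasB w f g : cmeas w f -> cmeas w g -> cmeas w (fun t => f t - g t).
Proof.
move=> h /(cmeasZ (-1)) h'; have := cmeasD h h'.
by congr cmeas; apply/funext => t; rewrite mulN1r.
Qed.

Lemma cmeas_real w (f : R -> R) : measurable_fun `[0, w] f -> cmeas w (fun t => (f t)%:C).
Proof. by move=> h; split => //; exact: measurable_cst. Qed.

Lemma cmeas_normc2 w f : cmeas w f -> measurable_fun `[0, w] (fun t => normc (f t) ^+ 2).
Proof.
move=> [fr fi]; rewrite (_ : (fun _ => _) =
   fun t => complex.Re (f t) ^+ 2 + complex.Im (f t) ^+ 2); last first.
  by apply/funext => t; rewrite normc_sqr.
by apply: measurable_funD; exact: measurable_funX.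
Qed.

Lemma cmeas_normc w f : cmeas w f -> measurable_fun `[0, w] (fun t => normc (f t)).
Proof.
move=> /cmeas_normc2 h; rewrite (_ : (fun _ => _) = Num.sqrt \o (fun t => normc (f t) ^+ 2)).
  by apply: measurableT_comp => //; apply: continuous_measurable_fun; exact: sqrt_continuous.
by apply/funext => t /=; rewrite sqrtr_sqr ger0_norm// normc_ge0.
Qed.

Lemma cint_dom w f (g : R -> R) : cmeas w f -> rintegrable w g ->
  (forall t, 0 <= t <= w -> normc (f t) <= g t) -> cintegrable w f.
Proof.
move=> [fr fi] ig h; split; apply: (rint_dom _ ig) => // t /h; apply: le_trans.
  exact: ler_Re.
exact: ler_Im.
Qed.

Lemma cint_normc w f : cintegrable w f -> rintegrable w (fun t => normc (f t)).
Proof.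
move=> h; have [hr hi] := h.
apply: (rint_dom _ (rintD (rint_norm hr) (rint_norm hi))).
  by apply: cmeas_normc; exact: cint_meas.
by move=> t _; rewrite ger0_norm ?normc_ge0//; exact: normc_le_ReIm.
Qed.

Lemma cintD w f g : cintegrable w f -> cintegrable w g -> cintegrable w (fun t => f t + g t).
Proof.
move=> h h'; apply: (cint_dom _ (rintD (cint_normc h) (cint_normc h'))).
  by apply: cmeasD; exact: cint_meas.
by move=> t _; exact: normcD.
Qed.

Lemma cintM w f g c : cintegrable w f -> cmeas w g ->
  (forall t, 0 <= t <= w -> normc (g t) <= c) -> cintegrable w (fun t => f t * g t).
Proof.
move=> h h' hc; apply: (cint_dom _ (rintZ c (cint_normc h))).
  by apply: cmeasM => //; exact: cint_meas.
by move=> t /hc ht; rewrite normcM mulrC ler_wpM2r// normc_ge0.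
Qed.

Lemma cintZ w z f : cintegrable w f -> cintegrable w (fun t => z * f t).
Proof.
move=> h; rewrite (_ : (fun _ => _) = fun t => f t * z); last first.
  by apply/funext => t; rewrite mulrC.
by apply: (@cintM _ _ _ (normc z)) => //; exact: cmeas_cst.
Qed.

Lemma cintB w f g : cintegrable w f -> cintegrable w g -> cintegrable w (fun t => f t - g t).
Proof.
move=> h /(cintZ (-1)) h'; have := cintD h h'.
by congr cintegrable; apply/funext => t; rewrite mulN1r.
Qed.

Lemma cint_cst w (z : R[i]) : cintegrable w (fun=> z).
Proof. by split; exact: rint_cst. Qed.

Lemma cint_bounded w f c : cmeas w f -> (forall t, 0 <= t <= w -> normc (f t) <= c) ->
  cintegrable w f.
Proof. by move=> h hc; apply: (cint_dom h (rint_cst w c)). Qed.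

Lemma cintS w x f : x <= w -> cintegrable w f -> cintegrable x f.
Proof. by move=> xw [h h']; split; [exact: rintS h|exact: rintS h']. Qed.

Lemma cintegralD w f g : cintegrable w f -> cintegrable w g ->
  cintegral w (fun t => f t + g t) = cintegral w f + cintegral w g.
Proof.
move=> [fr fi] [gr gi]; apply: complex_ext; rewrite /= ?cReD ?cImD /=.
  by rewrite -RintegralD//; apply: eq_Rintegral => t _; rewrite cReD.
by rewrite -RintegralD//; apply: eq_Rintegral => t _; rewrite cImD.
Qed.

Lemma cintegralZ w z f : cintegrable w f ->
  cintegral w (fun t => z * f t) = z * cintegral w f.
Proof.
move=> [fr fi]; apply: complex_ext; rewrite /= ?cReM ?cImM /=.
  rewrite -!RintegralZl// -RintegralB//; try exact: rintZ.
  by apply: eq_Rintegral => t _; rewrite cReM.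
rewrite -!RintegralZl// -RintegralD//; try exact: rintZ.
by apply: eq_Rintegral => t _; rewrite cImM.
Qed.

Lemma cintegralB w f g : cintegrable w f -> cintegrable w g ->
  cintegral w (fun t => f t - g t) = cintegral w f - cintegral w g.
Proof.
move=> h h'; rewrite -mulN1r -(cintegralZ _ h') -(cintegralD h (cintZ (-1) h')).
by congr cintegral; apply/funext => t; rewrite mulN1r.
Qed.

Lemma eq_cintegral w f g : (forall t, 0 <= t <= w -> f t = g t) ->
  cintegral w f = cintegral w g.
Proof.
move=> h; apply: complex_ext => /=; apply: eq_Rintegral => t; rewrite inE => /in_cc ht.
  by rewrite h.
by rewrite h.
Qed.

Lemma cintegral_sum w n (f : nat -> R -> R[i]) : (forall i, cintegrable w (f i)) ->
  cintegrable w (fun t => \sum_(i < n) f i t) /\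
  cintegral w (fun t => \sum_(i < n) f i t) = \sum_(i < n) cintegral w (f i).
Proof.
move=> h; elim: n => [|n [ih1 ih2]].
  rewrite big_ord0 (_ : (fun _ => _) = fun=> 0); last by apply/funext => t; rewrite big_ord0.
  split; first exact: cint_cst.
  rewrite -[fun=> 0](_ : (fun t => 0 * (0 : R[i])) = _); last by apply/funext => t; rewrite mulr0.
  by rewrite (cintegralZ 0 (cint_cst w 0)) mul0r.
rewrite (_ : (fun _ => _) = fun t => \sum_(i < n) f i t + f n t); last first.
  by apply/funext => t; rewrite big_ord_recr.
by split; [exact: cintD|rewrite big_ord_recr /= -ih2 cintegralD].
Qed.

(** Real and imaginary parts are bounded separately, whence the factor 2, which reappears in
    [coef_bound] and [potential_bound]. *)
Lemma cintegral_le w f (g : R -> R) : cintegrable w f -> rintegrable w g ->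
  (forall t, 0 <= t <= w -> normc (f t) <= g t) ->
  normc (cintegral w f) <= 2 * \int[leb]_(t in `[0, w]) g t.
Proof.
move=> [fr fi] ig h; apply: le_trans (normc_le_ReIm _) _.
rewrite mulr_natl mulr2n lerD//=.
  apply: le_trans (le_normr_Rintegral _ fr) _; first exact: measurable_itv.
  apply: le_Rintegral; [exact: measurable_itv|exact: rint_norm|exact: ig|].
  by move=> t /in_cc /h; apply: le_trans; exact: ler_Re.
apply: le_trans (le_normr_Rintegral _ fi) _; first exact: measurable_itv.
apply: le_Rintegral; [exact: measurable_itv|exact: rint_norm|exact: ig|].
by move=> t /in_cc /h; apply: le_trans; exact: ler_Im.
Qed.

Lemma Rintegral_cc_cst w (c : R) : 0 <= w -> \int[leb]_(t in `[0, w]) c = c * w.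
Proof.
move=> w0; rewrite Rintegral_cst; last exact: measurable_itv.
have := @lebesgue_measure_itv R `[0, w]; rewrite /= => ->; rewrite lte_fin; case: ltP => [_|h]; first by rewrite /= oppr0 addr0.
by have -> : w = 0 by apply/eqP; rewrite eq_le h.
Qed.

Lemma ae_eq_cintegral w f g : cmeas w f -> cmeas w g -> ae_eq_on w f g ->
  cintegral w f = cintegral w g.
Proof.
move=> [fr fi] [gr gi] fg; apply: complex_ext => /=; congr fine; apply: ae_eq_integral;
  try exact: measurable_itv; try exact/measurable_EFinP.
- by rewrite /ae_eq; apply: (aeS fg) => t h /in_cc ht; rewrite h// in_itv.
- by rewrite /ae_eq; apply: (aeS fg) => t h /in_cc ht; rewrite h// in_itv.
Qed.

Lemma in_L2P w f : in_L2 w f <-> cmeas w f /\ rintegrable w (fun t => normc (f t) ^+ 2).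
Proof.
split=> [[fr fi foo]|[[fr fi] h]]; last first.
  split => //; move/integrableP : h => [_]; apply: le_lt_trans.
  rewrite le_eqVlt; apply/orP; left; apply/eqP; apply: eq_integral => t _ /=.
  by rewrite ger0_norm// sqr_ge0.
have mf : cmeas w f by [].
split => //; apply/integrableP; split.
  by apply/measurable_EFinP; exact: cmeas_normc2.
apply: le_lt_trans foo.
rewrite le_eqVlt; apply/orP; left; apply/eqP; apply: eq_integral => t _ /=.
by rewrite ger0_norm// sqr_ge0.
Qed.

Lemma L2_meas w f : in_L2 w f -> cmeas w f.
Proof. by move/in_L2P => []. Qed.

Lemma L2_dom w f (g : R -> R) : cmeas w f -> rintegrable w g ->
  (forall t, 0 <= t <= w -> normc (f t) ^+ 2 <= g t) -> in_L2 w f.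
Proof.
move=> mf ig h; apply/in_L2P; split => //; apply: (rint_dom _ ig).
  exact: cmeas_normc2.
by move=> t /h; rewrite ger0_norm ?sqr_ge0.
Qed.

Lemma L2_cint w f : in_L2 w f -> cintegrable w f.
Proof.
move=> /in_L2P[mf i2]; apply: (cint_dom mf (rintD (rint_cst w 1) i2)) => t _.
by have := sqr_ge0 (normc (f t) - 1); have := normc_ge0 (f t); rewrite sqrrB expr1n; lra.
Qed.

Lemma L2_bounded w f c : cmeas w f -> (forall t, 0 <= t <= w -> normc (f t) <= c) -> in_L2 w f.
Proof.
move=> mf hc; apply: (L2_dom mf (rint_cst w (c ^+ 2))) => t ht.
by rewrite ler_pXn2r ?nnegrE ?normc_ge0 ?hc// (le_trans (normc_ge0 _) (hc t ht)).
Qed.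

Lemma L2D w f g : in_L2 w f -> in_L2 w g -> in_L2 w (fun t => f t + g t).
Proof.
move=> /in_L2P[mf fi] /in_L2P[mg gi].
apply: (L2_dom (cmeasD mf mg) (rintZ 2 (rintD fi gi))) => t _.
have h := normcD (f t) (g t); have h0 := normc_ge0 (f t + g t).
apply: (@le_trans _ _ ((normc (f t) + normc (g t)) ^+ 2)).
  by rewrite ler_pXn2r ?nnegrE ?addr_ge0 ?normc_ge0.
by have := sqr_ge0 (normc (f t) - normc (g t)); rewrite sqrrB sqrrD; lra.
Qed.

Lemma L2M w f g c : in_L2 w f -> cmeas w g ->
  (forall t, 0 <= t <= w -> normc (g t) <= c) -> in_L2 w (fun t => f t * g t).
Proof.
move=> /in_L2P[mf fi] mg hc.
apply: (L2_dom (cmeasM mf mg) (rintZ (c ^+ 2) fi)) => t ht.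
rewrite normcM exprMn mulrC ler_wpM2r ?sqr_ge0//.
by rewrite ler_pXn2r ?nnegrE ?normc_ge0 ?hc// (le_trans (normc_ge0 _) (hc t ht)).
Qed.

Lemma L2Z w z f : in_L2 w f -> in_L2 w (fun t => z * f t).
Proof.
move=> h; rewrite (_ : (fun _ => _) = fun t => f t * z); last first.
  by apply/funext => t; rewrite mulrC.
by apply: (@L2M _ _ _ (normc z)) => //; exact: cmeas_cst.
Qed.

Lemma L2B w f g : in_L2 w f -> in_L2 w g -> in_L2 w (fun t => f t - g t).
Proof.
move=> h /(L2Z (-1)) h'; have := L2D h h'.
by congr in_L2; apply/funext => t; rewrite mulN1r.
Qed.

Lemma ae_eq_on_sym w f g : ae_eq_on w f g -> ae_eq_on w g f.
Proof. by rewrite /ae_eq_on => h; apply: (aeS h) => t {}h /h. Qed.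

Lemma ae_eq_on_trans w f g h : ae_eq_on w f g -> ae_eq_on w g h -> ae_eq_on w f h.
Proof. by rewrite /ae_eq_on => h1 h2; apply: (aeS (aeI h1 h2)) => t [e1 e2] ht; rewrite e1// e2. Qed.

Lemma eq_on_ae w f g : (forall t, 0 <= t <= w -> f t = g t) -> ae_eq_on w f g.
Proof. by rewrite /ae_eq_on => h; apply: aeE => t; rewrite in_itv /= => /h. Qed.

Lemma ae_eq_onS w (P : R -> Prop) f g : {ae leb, forall t, P t} ->
  (forall t, 0 <= t <= w -> P t -> f t = g t) -> ae_eq_on w f g.
Proof. by rewrite /ae_eq_on => hP h; apply: (aeS hP) => t Pt; rewrite in_itv /= => /h; exact. Qed.

(* Cauchy-Schwarz against 1, by AM-GM with an arbitrary parameter. *)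
Lemma L1_le_L2 w f : 0 < w -> in_L2 w f ->
  \int[leb]_(t in `[0, w]) normc (f t) <= w * norm_L2 w f.
Proof.
move=> w0 /[dup] fL2 /in_L2P[mf i2].
pose S := \int[leb]_(t in `[0, w]) normc (f t) ^+ 2.
have S0 : 0 <= S by apply: Rintegral_ge0 => t _; rewrite sqr_ge0.
have nE : norm_L2 w f = Num.sqrt (S / w).
  rewrite /norm_L2 /inner_L2; congr Num.sqrt; rewrite cReM /= mul0r subr0 mulrC.
  congr (_ * _); apply: eq_Rintegral => t _; rewrite normc_sqr cReM cReJ cImJ.
  by rewrite mulrN opprK !expr2.
have key tau : 0 < tau ->
    \int[leb]_(t in `[0, w]) normc (f t) <= (tau * w + S / tau) / 2.
  move=> t0; have i2' := rintZ tau^-1 i2; have it := rintD (rint_cst w tau) i2'.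
  have -> : (tau * w + S / tau) / 2 =
      \int[leb]_(t in `[0, w]) (2^-1 * (tau + tau^-1 * normc (f t) ^+ 2)).
    rewrite RintegralZl; [|exact: measurable_itv|exact: it].
    rewrite RintegralD; [|exact: measurable_itv|exact: rint_cst|exact: i2'].
    rewrite RintegralZl; [|exact: measurable_itv|exact: i2].
    by rewrite (Rintegral_cc_cst tau (ltW w0)) -/S; ring.
  apply: le_Rintegral; [exact: measurable_itv|exact/cint_normc/L2_cint|exact: rintZ|].
  move=> t _; set a := normc (f t).
  have : 0 <= (a - tau) ^+ 2 / tau by rewrite divr_ge0 ?sqr_ge0// ltW.
  have -> : (a - tau) ^+ 2 / tau = tau^-1 * a ^+ 2 - 2 * a + tau by field; rewrite gt_eqF.
  lra.
(* The optimal parameter is sqrt (S / w); for S = 0 it is not positive, and tau has to tend to 0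
   instead. *)
rewrite nE; have [SE|Sn] := eqVneq S 0.
  rewrite SE mul0r sqrtr0 mulr0; apply/ler_addgt0Pl => e e0; rewrite addr0.
  have t0 : 0 < 2 * e / w by rewrite divr_gt0// mulr_gt0.
  have := key _ t0; rewrite SE mul0r addr0 divfK ?gt_eqF//; lra.
have Sp : 0 < S by rewrite lt_neqAle eq_sym Sn.
have t0 : 0 < Num.sqrt (S / w) by rewrite sqrtr_gt0 divr_gt0.
have := key _ t0; set tau := Num.sqrt _ in t0 *.
have e2 : tau ^+ 2 = S / w by rewrite sqr_sqrtr// divr_ge0// ltW.
have -> : S = tau ^+ 2 * w by rewrite e2 divfK// gt_eqF.
have -> : tau ^+ 2 * w / tau = tau * w by field; rewrite gt_eqF.
by rewrite mulrC; lra.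
Qed.

End complex_integrals.

(** * Derivatives relative to [0, w] *)

Section relative_derivative.
Context {R : realType}.
Variable w : R.
Hypothesis w0 : 0 < w.
Implicit Types (x t e d : R) (f g : R -> R[i]) (l m : R[i]).

(** Differentiability in increment form: without a quotient the point t = x needs no exclusion, and
    the product rule reduces to an algebraic identity. *)
Definition hasd f x l := forall e, 0 < e -> exists2 d, 0 < d &
  forall t, 0 <= t <= w -> `|t - x| < d ->
    normc (f t - f x - l * (t - x)%:C) <= e * `|t - x|.

Definition ccont f x := forall e, 0 < e -> exists2 d, 0 < d &
  forall t, 0 <= t <= w -> `|t - x| < d -> normc (f t - f x) <= e.

Lemma near_at_in x (P : R -> Prop) : (\forall t \near at_in w x, P t) <->
  exists2 d, 0 < d & forall t, 0 <= t <= w -> t != x -> `|t - x| < d -> P t.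
Proof.
split=> [/nbhs_ballP[d d0 h]|[d d0 h]].
  exists d => // t tw tx td; apply: (h t); [|exact: tx|exact/in_cc].
  by rewrite -ball_normE /= distrC.
apply/nbhs_ballP; exists d => // t; rewrite -ball_normE /= distrC => td tx.
by move=> /in_cc tw; exact: h.
Qed.

Lemma at_in_proper x : 0 <= x <= w -> ProperFilter (at_in w x).
Proof.
move=> /andP[x0 xw]; apply: Build_ProperFilter_ex => P /near_at_in[d d0 h].
have [xlt|xge] := ltP x w.
  pose s := Num.min d (w - x) / 2.
  have m0 : 0 < Num.min d (w - x) by rewrite lt_min d0 subr_gt0.
  have s0 : 0 < s by rewrite divr_gt0.
  have sd : s < d.
    have : Num.min d (w - x) <= d by rewrite ge_min lexx.
    by rewrite /s; lra.
  have sw : s <= w - x.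
    have : Num.min d (w - x) <= w - x by rewrite ge_min lexx orbT.
    by rewrite /s; lra.
  exists (x + s); apply: h; first by apply/andP; split; lra.
    by rewrite -subr_eq0 addrAC subrr add0r gt_eqF.
  by rewrite addrAC subrr add0r gtr0_norm.
have ex : x = w by apply/eqP; rewrite eq_le xw.
pose s := Num.min d w / 2.
have m0 : 0 < Num.min d w by rewrite lt_min d0.
have s0 : 0 < s by rewrite divr_gt0.
have sd : s < d.
  have : Num.min d w <= d by rewrite ge_min lexx.
  by rewrite /s; lra.
have sw : s <= w.
  have : Num.min d w <= w by rewrite ge_min lexx orbT.
  by rewrite /s; lra.
exists (x - s); apply: h; first by apply/andP; split; lra.
  by rewrite -subr_eq0 addrAC subrr add0r oppr_eq0 gt_eqF.
by rewrite addrAC subrr add0r normrN gtr0_norm.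
Qed.

Lemma hasdP f x l : 0 <= x <= w ->
  hasd f x l <-> (diff_quot f x t @[t --> at_in w x] --> (l : R[i]^o)).
Proof.
move=> xw; have FF := at_in_proper xw.
have E t : t != x -> normc (f t - f x - l * (t - x)%:C) =
    normc (diff_quot f x t - l) * `|t - x|.
  move=> tx; have nz : (t - x)%:C != 0 :> R[i].
    by rewrite -normc_eq0 normc_real normr_eq0 subr_eq0.
  by rewrite -normc_real -normcM mulrBl /diff_quot divfK.
split=> [h|/cvg_normcP h].
  apply/cvg_normcP => e e0; have e2 : 0 < e / 2 by rewrite divr_gt0.
  have [d d0 hd] := h _ e2; apply/near_at_in; exists d => // t tw tx td.
  have := hd t tw td; rewrite E// ler_pM2r ?normr_gt0 ?subr_eq0//.
  by move=> /le_lt_trans; apply; lra.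
move=> e /h /near_at_in[d d0 hd]; exists d => // t tw td.
have [->|tx] := eqVneq t x.
  by rewrite !subrr mulr0 subr0 normc0 normr0 mulr0.
by rewrite E// ler_wpM2r// ltW// hd.
Qed.

Lemma hasd_derive f x l : 0 <= x <= w -> hasd f x l -> derive_on w f x = l.
Proof.
move=> xw /(hasdP _ _ xw) h; have FF := at_in_proper xw.
exact: (cvg_lim (@norm_hausdorff _ R[i]^o) h).
Qed.

Lemma derivable_hasd f : derivable_on w f <->
  forall x, 0 <= x <= w -> hasd f x (derive_on w f x).
Proof.
split=> [h x xw|h x].
  by apply/(hasdP _ _ xw); apply: h; rewrite in_itv.
by rewrite in_itv /= => xw; apply: cvgP; apply/(hasdP _ _ xw); exact: h.
Qed.

Lemma hasd_ext f g x l : 0 <= x <= w -> (forall t, 0 <= t <= w -> f t = g t) ->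
  hasd f x l -> hasd g x l.
Proof.
move=> xw fg h e /h[d d0 hd]; exists d => // t tw td.
by rewrite -!fg//; exact: hd.
Qed.

Lemma hasd_ccont f x l : hasd f x l -> ccont f x.
Proof.
move=> h e e0; have [d d0 hd] := h _ ltr01.
exists (Num.min d (e / (1 + normc l))).
  by rewrite lt_min d0 divr_gt0// ltr_pwDl ?normc_ge0.
move=> t tw; rewrite lt_min => /andP[td te].
rewrite -(subrK (l * (t - x)%:C) (f t - f x)) (le_trans (normcD _ _))//.
rewrite (le_trans (lerD (hd t tw td) (lexx _)))// normcM normc_real -mulrDl.
by rewrite mulrC -ler_pdivlMr ?ltr_pwDl ?normc_ge0// ltW.
Qed.

Lemma hasd_unique f x l m : 0 <= x <= w -> hasd f x l -> hasd f x m -> l = m.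
Proof. by move=> xw /(hasd_derive xw) <- /(hasd_derive xw). Qed.

Lemma hasd_cst x (z : R[i]) : hasd (fun=> z) x 0.
Proof.
move=> e e0; exists 1 => // t _ _.
by rewrite subrr mul0r subr0 normc0 mulr_ge0// ltW.
Qed.

Lemma hasdD f g x l m : hasd f x l -> hasd g x m -> hasd (fun t => f t + g t) x (l + m).
Proof.
move=> hf hg e e0; have e2 : 0 < e / 2 by rewrite divr_gt0.
have [d d0 hd] := hf _ e2; have [d' d'0 hd'] := hg _ e2.
exists (Num.min d d') => [|t tw]; first by rewrite lt_min d0.
rewrite lt_min => /andP[/(hd t tw) h1 /(hd' t tw) h2].
rewrite (_ : _ - _ - _ = (f t - f x - l * (t - x)%:C) + (g t - g x - m * (t - x)%:C)); last by ring.
by rewrite (le_trans (normcD _ _))// (splitr e) mulrDl lerD.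
Qed.

Lemma hasdM f g x l m : hasd f x l -> hasd g x m ->
  hasd (fun t => f t * g t) x (l * g x + f x * m).
Proof.
move=> hf hg e e0; have cg := hasd_ccont hg.
have e3 : 0 < e / 3 by rewrite divr_gt0.
have p1 y : 0 < normc y + 1 :> R by rewrite ltr_wpDl ?normc_ge0.
have [d1 d10 h1] := hf _ (divr_gt0 e3 (p1 (g x))).
have [d2 d20 h2] := cg _ (divr_gt0 e3 (p1 l)).
have [d3 d30 h3] := hg _ (divr_gt0 e3 (p1 (f x))).
have [d4 d40 h4] := cg _ ltr01.
exists (Num.min (Num.min d1 d2) (Num.min d3 d4)).
  by rewrite !lt_min d10 d20 d30 d40.
move=> t tw; rewrite !lt_min => /andP[/andP[/(h1 t tw) b1 /(h2 t tw) b2]].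
move=> /andP[/(h3 t tw) b3 /(h4 t tw) b4].
rewrite (_ : _ - _ - _ = (f t - f x - l * (t - x)%:C) * g t +
  (l * (t - x)%:C) * (g t - g x) + f x * (g t - g x - m * (t - x)%:C)); last by ring.
apply: le_trans (normcD _ _) _; apply: le_trans (lerD (normcD _ _) (lexx _)) _.
rewrite !normcM normc_real.
have gt1 : normc (g t) <= normc (g x) + 1.
  by rewrite -(subrK (g x) (g t)) addrC (le_trans (normcD _ _))// lerD2l.
have H0 := normr_ge0 (t - x).
have c1 : normc (f t - f x - l * (t - x)%:C) * normc (g t) <= e / 3 * `|t - x|.
  apply: le_trans (ler_pM (normc_ge0 _) (normc_ge0 _) b1 gt1) _.
  by rewrite mulrAC divfK// gt_eqF.
have c2 : normc l * `|t - x| * normc (g t - g x) <= e / 3 * `|t - x|.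
  rewrite mulrAC ler_wpM2r//.
  apply: (@le_trans _ _ ((normc l + 1) * (e / 3 / (normc l + 1)))).
    by rewrite ler_pM ?normc_ge0// lerDl.
  by rewrite mulrC divfK// gt_eqF.
have c3 : normc (f x) * normc (g t - g x - m * (t - x)%:C) <= e / 3 * `|t - x|.
  apply: (@le_trans _ _ ((normc (f x) + 1) * (e / 3 / (normc (f x) + 1) * `|t - x|))).
    by rewrite ler_pM ?normc_ge0// lerDl.
  by rewrite mulrA mulrCA mulrA [X in X * _](_ : _ = e / 3)//; field; rewrite gt_eqF.
have -> : e * `|t - x| = e / 3 * `|t - x| + e / 3 * `|t - x| + e / 3 * `|t - x| by field.
by rewrite !lerD.
Qed.

Lemma hasdZ f x l z : hasd f x l -> hasd (fun t => z * f t) x (z * l).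
Proof.
move=> h; have := hasdM (hasd_cst x z) h.
by rewrite mul0r add0r.
Qed.

Lemma hasdB f g x l m : hasd f x l -> hasd g x m -> hasd (fun t => f t - g t) x (l - m).
Proof.
move=> hf /(hasdZ (-1)) hg; have := hasdD hf hg; rewrite mulN1r.
by congr hasd; apply/funext => t; rewrite mulN1r.
Qed.

Lemma hasd_real (phi : R -> R) x (dphi : R) : is_derive x 1 phi dphi ->
  hasd (fun t => (phi t)%:C) x dphi%:C.
Proof.
move=> [dr E] e e0; move: dr; rewrite /derivable => dr.
have : (fun h => h^-1 *: ((phi \o shift x) (h *: 1) - phi x)) @ 0^' --> dphi.
  by rewrite -E; exact: dr.
move=> /cvgrPdist_le/(_ e e0)/nbhs_ballP[d d0 hd].
exists d => // t tw td; have [->|tx] := eqVneq t x.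
  by rewrite !subrr mulr0 subr0 normc0 normr0 mulr0.
have tx0 : t - x != 0 by rewrite subr_eq0.
have h : `|dphi - (t - x)^-1 * (phi t - phi x)| <= e.
  have := hd (t - x); rewrite -ball_normE /= sub0r normrN => /(_ td tx0).
  by rewrite /shift /= [_ *: 1]mulr1 subrK.
rewrite -!rmorphB -rmorphM -rmorphB normc_real.
have -> : phi t - phi x - dphi * (t - x) = - (dphi - (t - x)^-1 * (phi t - phi x)) * (t - x).
  by field.
by rewrite normrM normrN ler_wpM2r.
Qed.

Lemma ccont_AC f : (forall x, 0 <= x <= w -> ccont f x) ->
  continuous (fun t => complex.Re (f (clamp w t))) /\
  continuous (fun t => complex.Im (f (clamp w t))).
Proof.
move=> h; have key x (e : R) : 0 < e ->
    \forall t \near x, normc (f (clamp w t) - f (clamp w x)) <= e.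
  move=> e0; have [d d0 hd] := h _ (clamp_itv x (ltW w0)) _ e0.
  apply/nbhs_ballP; exists d => // t; rewrite -ball_normE /= => xt.
  apply: hd; first exact: clamp_itv (ltW w0).
  apply: le_lt_trans xt; have [tx|xt] := leP t x.
    rewrite distrC [leRHS]ger0_norm ?subr_ge0// ger0_norm; last by rewrite subr_ge0 clamp_le// ltW.
    exact: clamp_lip (ltW w0) tx.
  rewrite [leRHS]distrC [leRHS]ger0_norm ?subr_ge0 ?(ltW xt)// ger0_norm; last first.
    by rewrite subr_ge0 clamp_le// ltW.
  exact: clamp_lip (ltW w0) (ltW xt).
split=> x; apply/cvgrPdist_le => e /(key x); apply: filterS => t; apply: le_trans.
  by rewrite distrC -cReB ler_Re.
by rewrite distrC -cImB ler_Im.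
Qed.

Lemma ccont_meas f : (forall x, 0 <= x <= w -> ccont f x) -> cmeas w f.
Proof.
move=> /ccont_AC[hr hi]; split.
  apply: (eq_measurable_fun (fun t => complex.Re (f (clamp w t)))).
    by move=> t; rewrite inE => /in_cc tw; rewrite clamp_id.
  by apply: measurable_funTS; exact: continuous_measurable_fun.
apply: (eq_measurable_fun (fun t => complex.Im (f (clamp w t)))).
  by move=> t; rewrite inE => /in_cc tw; rewrite clamp_id.
by apply: measurable_funTS; exact: continuous_measurable_fun.
Qed.

Lemma real_hasd_is_derive (F : R -> R) x (l : R) : 0 < x < w ->
  (forall e, 0 < e -> exists2 d, 0 < d & forall t, 0 <= t <= w -> `|t - x| < d ->
    `|F t - F x - l * (t - x)| <= e * `|t - x|) -> is_derive x 1 F l.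
Proof.
move=> /andP[x0 xw] h.
have H : (fun h => h^-1 *: ((F \o shift x) (h *: 1) - F x)) @ 0^' --> l.
  apply/cvgrPdist_le => e /h[d d0 hd].
  apply/nbhs_ballP; exists (Num.min d (Num.min x (w - x))).
    by rewrite /= !lt_min d0 x0 subr_gt0.
  move=> s; rewrite -ball_normE /= sub0r normrN !lt_min => /andP[sd /andP[sx sw]] s0.
  rewrite /shift /= [s *: 1]mulr1.
  have tw : 0 <= s + x <= w by apply/andP; split; move: sx sw; rewrite !ltr_norml; lra.
  have := hd (s + x) tw; rewrite addrK => /(_ sd) hs.
  have -> : l - s^-1 *: (F (s + x) - F x) = - (F (s + x) - F x - l * s) / s.
    by rewrite [_ *: _]mulrC; field.
  by rewrite normrM normrN normfV ler_pdivrMr ?normr_gt0.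
apply: DeriveDef; first exact: cvgP H.
exact: (cvg_lim _ H).
Qed.

(** The mean value theorem holds only for real functions, so it is applied to the real and imaginary
    parts, at possibly different points; hence the factor 2. *)
Lemma hasd_lip f g c : (forall x, 0 <= x <= w -> hasd f x (g x)) ->
  (forall x, 0 <= x <= w -> normc (g x) <= c) ->
  forall x y, 0 <= x -> x <= y -> y <= w -> normc (f y - f x) <= 2 * c * (y - x).
Proof.
move=> hf gc x y x0 xy yw.
have [cr ci] := ccont_AC (fun x xw => hasd_ccont (hf x xw)).
have xw : 0 <= x <= w by rewrite x0 (le_trans xy).
have yw' : 0 <= y <= w by rewrite yw (le_trans x0).
have der z : z \in `]x, y[ ->
    is_derive z 1 (fun t => complex.Re (f (clamp w t))) (complex.Re (g z)) /\
    is_derive z 1 (fun t => complex.Im (f (clamp w t))) (complex.Im (g z)).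
  rewrite in_itv /= => /andP[xz zy].
  have zw : 0 < z < w by apply/andP; split; lra.
  have zw' : 0 <= z <= w by apply/andP; split; lra.
  have H e : 0 < e -> exists2 d, 0 < d & forall t, 0 <= t <= w -> `|t - z| < d ->
      `|complex.Re (f (clamp w t)) - complex.Re (f (clamp w z)) -
        complex.Re (g z) * (t - z)| <= e * `|t - z| /\
      `|complex.Im (f (clamp w t)) - complex.Im (f (clamp w z)) -
        complex.Im (g z) * (t - z)| <= e * `|t - z|.
    move=> /(hf z zw')[d d0 hd]; exists d => // t tw /(hd t tw) h.
    rewrite !clamp_id//; split; apply: le_trans h.
      by apply: le_trans (ler_Re _); rewrite !cReB cReM /= mulr0 subr0.
    by apply: le_trans (ler_Im _); rewrite !cImB cImM /= mulr0 add0r.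
  by split; apply: real_hasd_is_derive => // e /H[d d0 hd]; exists d => // t tw /(hd t tw)[].
have [z zxy er] := MVT_segment xy (fun z hz => (der z hz).1) (continuous_subspaceT cr).
have [z' z'xy ei] := MVT_segment xy (fun z hz => (der z hz).2) (continuous_subspaceT ci).
rewrite /= !clamp_id// in er ei.
have inw u : u \in `[x, y] -> 0 <= u <= w.
  by rewrite in_itv /= => /andP[? ?]; apply/andP; split; lra.
apply: le_trans (normc_le_ReIm _) _; rewrite cReB cImB er ei !normrM.
rewrite [`|y - x|]ger0_norm ?subr_ge0// -mulrDl ler_wpM2r ?subr_ge0//.
rewrite mulr_natl mulr2n lerD//.
  exact: le_trans (ler_Re _) (gc _ (inw _ zxy)).
exact: le_trans (ler_Im _) (gc _ (inw _ z'xy)).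
Qed.

End relative_derivative.

(** * Primitives of integrable functions and integration by parts *)

Section real_primitive.
Context {R : realType}.
Notation leb := (@lebesgue_measure R).
Implicit Types (w x y c e : R) (g : R -> R).

Definition prim g x := \int[leb]_(t in `[0, x]) g t.

Lemma oc_sub w x y : 0 <= x -> y <= w -> `]x, y] `<=` `[0, w].
Proof.
move=> x0 yw t; rewrite /= !in_itv /= => /andP[xt ty].
by rewrite (le_trans x0 (ltW xt)) (le_trans ty yw).
Qed.

Lemma primB w g x y : rintegrable w g -> 0 <= x -> x <= y -> y <= w ->
  prim g y - prim g x = \int[leb]_(t in `]x, y]) g t.
Proof.
move=> ig x0 xy yw; rewrite /prim (@Rintegral_itvB _ _ (BLeft 0) (BRight y))//.
exact: rintS ig.
Qed.

Lemma rint_oc w g x y : rintegrable w g -> 0 <= x -> y <= w ->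
  leb.-integrable `]x, y] (EFin \o g).
Proof.
move=> ig x0 yw; apply: integrableS ig; [exact: measurable_itv..|].
exact: oc_sub.
Qed.

Lemma Rintegral_oc_cst c x y : x <= y -> \int[leb]_(t in `]x, y]) c = c * (y - x).
Proof.
move=> xy; rewrite Rintegral_cst; last exact: measurable_itv.
have := @lebesgue_measure_itv R `]x, y]; rewrite /= => ->; rewrite lte_fin; case: ltP => // h.
rewrite (_ : y = x) ?subrr//.
by apply/eqP; rewrite eq_le xy h.
Qed.

Lemma prim_bound w g x y c e : rintegrable w g -> 0 <= x -> x <= y -> y <= w ->
  (forall s, x <= s <= y -> `|g s - c| <= e) ->
  `|prim g y - prim g x - c * (y - x)| <= e * (y - x).
Proof.
move=> ig x0 xy yw h; rewrite (primB ig)// -(Rintegral_oc_cst c xy).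
have ic k : leb.-integrable `]x, y] (EFin \o (fun=> k : R)).
  exact: (rint_oc (rint_cst w k)).
have ioc := rint_oc ig x0 yw.
have md : measurable (`]x, y]%classic : set (measurableTypeR R)) by exact: measurable_itv.
rewrite -(RintegralB md ioc (ic c)) -(Rintegral_oc_cst e xy).
have id : leb.-integrable `]x, y] (EFin \o (fun t => g t - c)).
  exact: (rint_oc (rintB ig (rint_cst w c))).
apply: le_trans (le_normr_Rintegral md id) _.
apply: (le_Rintegral md _ (ic e)).
  exact: (rint_oc (rint_norm (rintB ig (rint_cst w c)))).
by move=> t; rewrite /= in_itv /= => /andP[xt ty]; apply: h; rewrite (ltW xt) ty.
Qed.

Lemma rint_restrict w g : rintegrable w g ->
  leb.-integrable setT (EFin \o (g \_ `[0, w])).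
Proof.
by move=> ig; rewrite -restrict_EFin; apply/(integrable_mkcond _ _).1 => //; exact: measurable_itv.
Qed.

Lemma restrict_in w g t : 0 <= t <= w -> (g \_ `[0, w]) t = g t.
Proof. by move=> tw; rewrite patchE mem_set//; exact/in_cc. Qed.

(** Absolute continuity of the integral as a set function, applied to the union of the intervals,
    whose measure is their total length. *)
Lemma prim_abs_cont w g : rintegrable w g -> abs_cont w (prim g).
Proof.
move=> ig e e0; pose g' := g \_ `[0, w].
have [d [d0 hd]] := integral_normr_continuous (rint_restrict ig) e0.
exists d => // T a b [hab tr] lt.
pose F i := [set` `]a i, b i[] : set (measurableTypeR R).
pose A := \big[setU/set0]_(i <- index_enum T) F i.
have mF i : measurable (F i) by exact: measurable_itv.
have mA : measurable A by apply: bigsetU_measurable => i _; exact: mF.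
have tF : trivIset [set` index_enum T] F by apply: sub_trivIset tr.
have lF i : leb (F i) = (b i - a i)%:E.
  have := @lebesgue_measure_itv R `]a i, b i[; rewrite /= => ->; rewrite lte_fin.
  have [_ ab _] := hab i; case: ltP => // h.
  rewrite (_ : b i = a i) ?subrr//.
  by apply/eqP; rewrite eq_le ab h.
have lA : leb A = (\sum_i (b i - a i))%:E.
  have := @ge0_integral_bigsetU _ _ R leb T F (cst 1%E) (index_enum T) mF
    (index_enum_uniq T) tF _ _.
  rewrite integral_cst// mul1e => -> //.
  by rewrite -sumEFin; apply: eq_bigr => i _; rewrite -lF integral_cst// mul1e.
have iT := rint_restrict ig.
have inorm (D : set (measurableTypeR R)) : measurable D ->
    leb.-integrable D (EFin \o (fun t => `|g' t|)).
  move=> mD; have := integrable_abse iT; apply: integrableS => //.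
have ltA : (leb A < d%:E)%E by rewrite lA lte_fin.
have := hd A mA ltA.
have -> : \int[leb]_(x in A) `|g' x| = \sum_i \int[leb]_(x in F i) `|g' x|.
  rewrite /Rintegral (ge0_integral_bigsetU leb mF (index_enum_uniq T) tF)//; last first.
    by have /integrableP[] := inorm _ mA.
  rewrite -[RHS]/(fine (\sum_i \int[leb]_(x in F i) `|g' x|)%:E) -sumEFin.
  congr fine; apply: eq_bigr => i _; rewrite fineK//.
  by apply: integrable_fin_num => //; exact: inorm.
apply: le_lt_trans; apply: ler_sum => i _; have [a0 ab bw] := hab i.
rewrite (primB ig)//.
have -> : \int[leb]_(t in `]a i, b i]) g t = \int[leb]_(t in F i) g' t.
  rewrite -Rintegral_itv_bndo_bndc; last first.
    apply: integrableS (rint_oc ig a0 bw) => //; [exact: measurable_itv..|].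
    by move=> t; rewrite /= !in_itv /= => /andP[-> /ltW].
  apply: eq_Rintegral => t; rewrite inE /= in_itv /= => /andP[at_ tb].
  by rewrite /g' restrict_in//; apply/andP; split; lra.
apply: le_normr_Rintegral => //.
by apply: integrableS iT.
Qed.

Lemma prim_is_derive_ae w g : 0 < w -> rintegrable w g ->
  {ae leb, forall x, 0 < x <= w -> is_derive x 1 (prim (g \_ `[0, w])) (g x)}.
Proof.
move=> w0 ig; have iT := rint_restrict ig.
have iy y : leb.-integrable `[0, y] (EFin \o (g \_ `[0, w])).
  by apply: integrableS iT => //; exact: measurable_itv.
have il : locally_integrable setT (g \_ `[0, w]).
  by apply: open_integrable_locally => //; exact: openT.
have := FTC1 (a := BLeft 0) iy il.
move=> h; apply: (aeS h) => x hx /andP[x0 xw].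
have [dr E] := hx x0.
apply: DeriveDef; first exact: dr.
by rewrite -derive1E E restrict_in// (ltW x0).
Qed.

End real_primitive.

Section complex_primitive.
Context {R : realType}.
Variable w : R.
Hypothesis w0 : 0 < w.
Notation leb := (@lebesgue_measure R).
Implicit Types (x y e c : R) (f g : R -> R[i]).

Lemma cintegralE x g : cintegral x g =
  prim (fun t => complex.Re (g t)) x +i* prim (fun t => complex.Im (g t)) x.
Proof. by []. Qed.

Lemma cintegral_hasd g x : 0 <= x <= w -> cintegrable w g -> ccont w g x ->
  hasd w (fun t => cintegral t g) x (g x).
Proof.
move=> /andP[x0 xw] [ir ii] cg e e0; have e2 : 0 < e / 2 by rewrite divr_gt0.
have [d d0 hd] := cg _ e2; exists d => // t /andP[t0 tw] td.
rewrite (le_trans (normc_le_ReIm _))// !cReB !cImB cReM cImM /= mulr0 subr0 mulr0 add0r.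
rewrite (splitr e) mulrDl.
have [xt|/ltW tx] := leP x t.
  rewrite [X in _ * X + _ * X]ger0_norm ?subr_ge0//.
  have hs s : x <= s <= t -> normc (g s - g x) <= e / 2.
    move=> /andP[xs st]; apply: hd; first by rewrite (le_trans x0) ?(le_trans st).
    rewrite ger0_norm ?subr_ge0//; apply: le_lt_trans td; rewrite ger0_norm ?subr_ge0//.
    by rewrite lerD2r.
  apply: lerD; [apply: (prim_bound ir)|apply: (prim_bound ii)] => // s /hs.
    by apply: le_trans; rewrite -cReB ler_Re.
  by apply: le_trans; rewrite -cImB ler_Im.
rewrite [X in _ * X + _ * X]ler0_norm ?subr_le0// opprB.
have hs s : t <= s <= x -> normc (g s - g x) <= e / 2.
  move=> /andP[ts sx]; apply: hd; first by rewrite (le_trans t0) ?(le_trans sx).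
  rewrite ler0_norm ?subr_le0//; apply: le_lt_trans td; rewrite ler0_norm ?subr_le0//.
  by rewrite lerN2 lerD2r.
have flip (u v k : R) : u - v - k * (t - x) = - (v - u - k * (x - t)) by ring.
rewrite !flip !normrN.
apply: lerD; [apply: (prim_bound ir)|apply: (prim_bound ii)] => // s /hs.
  by apply: le_trans; rewrite -cReB ler_Re.
by apply: le_trans; rewrite -cImB ler_Im.
Qed.

Lemma hasd_ReIm (f g : R -> R) x (l m : R) : hasd w (fun t => (f t)%:C) x l%:C ->
  hasd w (fun t => (g t)%:C) x m%:C -> hasd w (fun t => f t +i* g t) x (l +i* m).
Proof.
move=> hf /(hasdZ 'i%C) hg; have := hasdD hf hg.
have E (a b : R) : a%:C + 'i%C * b%:C = a +i* b.
  by apply: complex_ext; rewrite /= ?mul0r ?mul1r ?subr0 ?addr0 ?add0r.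
by rewrite E; congr hasd; apply/funext => t; rewrite E.
Qed.

Lemma cintegral_hasd_ae g : cintegrable w g ->
  {ae leb, forall x, 0 <= x <= w -> hasd w (fun t => cintegral t g) x (g x)}.
Proof.
move=> [ir ii].
(* The differentiation theorem is available for x > 0; the end point 0 is discarded as a null
   set. *)
have n0 : {ae leb, forall x, x != 0}.
  exists [set 0]; split; [exact: measurable_set1|exact: lebesgue_measure_set1|].
  by move=> x /= /negP; rewrite negbK => /eqP.
have := aeI n0 (aeI (prim_is_derive_ae w0 ir) (prim_is_derive_ae w0 ii)).
move=> h; apply: (aeS h) => x [x0 [hr hi]] xw; have /andP[x0' xw'] := xw.
have xp : 0 < x <= w by rewrite lt_neqAle eq_sym x0 x0'.
have := hasd_ReIm (hasd_real w (hr xp)) (hasd_real w (hi xp)).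
have -> : complex.Re (g x) +i* complex.Im (g x) = g x by case: (g x).
apply: (hasd_ext xw) => t /andP[t0 tw]; rewrite cintegralE.
congr (_ +i* _); apply: eq_Rintegral => s; rewrite inE => /in_cc /andP[s0 st].
  by rewrite restrict_in// s0 (le_trans st).
by rewrite restrict_in// s0 (le_trans st).
Qed.

Lemma abs_continuousP f : abs_continuous w f <->
  abs_cont w (fun t => complex.Re (f t)) /\ abs_cont w (fun t => complex.Im (f t)).
Proof.
split=> [h|[hr hi] e e0].
  split; apply: abs_contP => e /h[d d0 hd]; exists d => // n a b [hab tr] lt.
    apply: le_lt_trans (hd n a b hab tr lt); apply: ler_sum => i _.
    by rewrite -cReB ler_Re.
  apply: le_lt_trans (hd n a b hab tr lt); apply: ler_sum => i _.
  by rewrite -cImB ler_Im.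
have e2 : 0 < e / 2 by rewrite divr_gt0.
have [d d0 hd] := hr _ e2; have [d' d'0 hd'] := hi _ e2.
exists (Num.min d d') => [|n a b hab tr]; first by rewrite lt_min d0.
rewrite lt_min => /andP[/(hd _ a b (conj hab tr)) h1 /(hd' _ a b (conj hab tr)) h2].
rewrite (splitr e) (le_lt_trans _ (ltrD h1 h2))// -big_split; apply: ler_sum => i _ /=.
by rewrite (le_trans (normc_le_ReIm _))// cReB cImB.
Qed.

Lemma cintegral_AC g (z : R[i]) : cintegrable w g ->
  abs_continuous w (fun x => cintegral x g - z).
Proof.
move=> [ir ii]; have [hr hi] := (prim_abs_cont ir, prim_abs_cont ii).
have cst (c : R) : abs_cont w (fun=> c).
  move=> e e0; exists 1 => // T a b _ _; rewrite big1// => i _.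
  by rewrite subrr normr0.
apply/abs_continuousP; split.
  have := abs_contB hr (cst (complex.Re z)); congr abs_cont.
  by apply/funext => t; rewrite cReB.
have := abs_contB hi (cst (complex.Im z)); congr abs_cont.
by apply/funext => t; rewrite cImB.
Qed.

Lemma AC_density f : abs_continuous w f -> exists g, [/\ cintegrable w g,
  forall x, 0 <= x <= w -> f x = f 0 + cintegral x g &
  {ae leb, forall x, 0 <= x <= w -> hasd w f x (g x)}].
Proof.
move=> /abs_continuousP[/(abs_cont_density (ltW w0))[gr [ir er]]].
move=> /(abs_cont_density (ltW w0))[gi [ii ei]].
pose g x := gr x +i* gi x.
have ig : cintegrable w g.
  by split; [apply: integrableS ir|apply: integrableS ii] => //; exact: measurable_itv.
have E x : 0 <= x <= w -> f x = f 0 + cintegral x g.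
  by move=> xw; apply: complex_ext; [rewrite cReD er|rewrite cImD ei].
exists g; split => //; apply: (aeS (cintegral_hasd_ae ig)) => x h xw.
have := hasdD (hasd_cst w x (f 0)) (h xw); rewrite add0r.
by apply: (hasd_ext xw) => t /E ->.
Qed.

Lemma AC_ccont f : abs_continuous w f -> forall x, 0 <= x <= w -> ccont w f x.
Proof.
move=> /abs_continuousP[hr hi] x /andP[x0 xw] e e0.
have e2 : 0 < e / 2 by rewrite divr_gt0.
have [d d0 hd] := abs_cont_pair hr e2; have [d' d'0 hd'] := abs_cont_pair hi e2.
exists (Num.min d d') => [|t /andP[t0 tw]]; first by rewrite lt_min d0.
rewrite lt_min => /andP[td td']; rewrite (le_trans (normc_le_ReIm _))// (splitr e).
rewrite cReB cImB; have [xt|/ltW tx] := leP x t.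
  rewrite ger0_norm ?subr_ge0// in td; rewrite ger0_norm ?subr_ge0// in td'.
  by rewrite lerD// ltW// ?hd// ?hd'.
rewrite distrC ger0_norm ?subr_ge0// in td; rewrite distrC ger0_norm ?subr_ge0// in td'.
by rewrite lerD// distrC ltW// ?hd// ?hd'.
Qed.

Lemma cintegral_bounded g : cintegrable w g -> exists c, forall x, 0 <= x <= w ->
  normc (cintegral x g) <= c.
Proof.
move=> ig; have ing := cint_normc ig; exists (2 * prim (fun t => normc (g t)) w).
move=> x /andP[x0 xw].
apply: le_trans (cintegral_le (cintS xw ig) (rintS xw ing) (fun t _ => lexx _)) _.
rewrite ler_pM2l// -subr_ge0 -/(prim _ x) (primB ing)//.
by apply: Rintegral_ge0 => t _; exact: normc_ge0.
Qed.

Lemma AC_bounded f : abs_continuous w f -> exists c, forall x, 0 <= x <= w ->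
  normc (f x) <= c.
Proof.
move=> /AC_density[g [ig e _]]; have [c hc] := cintegral_bounded ig.
exists (normc (f 0) + c) => x xw; rewrite e// (le_trans (normcD _ _))// lerD2l.
exact: hc.
Qed.

Lemma lip_AC f c : (forall x y, 0 <= x -> x <= y -> y <= w ->
  normc (f y - f x) <= c * (y - x)) -> abs_continuous w f.
Proof.
move=> h e e0; have c0 : 0 <= c.
  have := le_trans (normc_ge0 _) (h 0 w (lexx _) (ltW w0) (lexx _)).
  by rewrite subr0 pmulr_lge0.
exists (e / (c + 1)); first by rewrite divr_gt0// ltr_wpDl.
move=> n a b hab _ lt.
apply: (@le_lt_trans _ _ ((c + 1) * \sum_(i < n) (b i - a i))).
  rewrite mulr_sumr; apply: ler_sum => i _; have [a0 ab bw] := hab i.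
  by apply: le_trans (h _ _ a0 ab bw) _; rewrite ler_wpM2r ?subr_ge0// lerDl.
by rewrite mulrC -ltr_pdivlMr// ltr_wpDl.
Qed.

Lemma hasd_AC f g : (forall x, 0 <= x <= w -> hasd w f x (g x)) ->
  (exists c, forall x, 0 <= x <= w -> normc (g x) <= c) -> abs_continuous w f.
Proof. by move=> hf [c hc]; apply: lip_AC; exact: (hasd_lip w0 hf hc). Qed.

Lemma AC_mul f g : abs_continuous w f -> abs_continuous w g ->
  abs_continuous w (fun t => f t * g t).
Proof.
move=> hf hg e e0; have [c hc] := AC_bounded hf; have [c' hc'] := AC_bounded hg.
have z0 : (0 : R) <= (0 : R) <= w by rewrite lexx ltW.
have c0 : 0 <= c by exact: le_trans (normc_ge0 _) (hc 0 z0).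
have c'0 : 0 <= c' by exact: le_trans (normc_ge0 _) (hc' 0 z0).
have e2 : 0 < e / 2 by rewrite divr_gt0.
have p : 0 < c + 1 by rewrite ltr_wpDl.
have p' : 0 < c' + 1 by rewrite ltr_wpDl.
have [d d0 hd] := hf _ (divr_gt0 e2 p').
have [d' d'0 hd'] := hg _ (divr_gt0 e2 p).
exists (Num.min d d') => [|n a b hab tr]; first by rewrite lt_min d0.
rewrite lt_min => /andP[/(hd _ a b hab tr) h1 /(hd' _ a b hab tr) h2].
rewrite ltr_pdivlMr// in h1; rewrite ltr_pdivlMr// in h2.
rewrite (splitr e) (le_lt_trans _ (ltrD h1 h2))// !mulr_suml -big_split.
apply: ler_sum => i _ /=; have [a0 ab bw] := hab i.
have aw : 0 <= a i <= w by rewrite a0 (le_trans ab).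
have bw' : 0 <= b i <= w by rewrite bw (le_trans a0).
rewrite (_ : _ - _ = (f (b i) - f (a i)) * g (b i) + (g (b i) - g (a i)) * f (a i)); last by ring.
rewrite (le_trans (normcD _ _))// !normcM lerD// ler_wpM2l ?normc_ge0//.
  by rewrite (le_trans (hc' _ bw'))// lerDl.
by rewrite (le_trans (hc _ aw))// lerDl.
Qed.

(** The product F phi is absolutely continuous, so it is the primitive of some density k; almost
    everywhere k is the derivative of the product, and derivatives are unique. *)
Lemma integration_by_parts_AC F f phi dphi c : abs_continuous w F -> cintegrable w f ->
  {ae leb, forall x, 0 <= x <= w -> hasd w F x (f x)} ->
  (forall x, 0 <= x <= w -> hasd w phi x (dphi x)) ->
  cmeas w dphi -> (forall x, 0 <= x <= w -> normc (dphi x) <= c) ->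
  cintegral w (fun t => f t * phi t) =
  F w * phi w - F 0 * phi 0 - cintegral w (fun t => F t * dphi t).
Proof.
move=> acF if_ dF dphiE mdphi cdphi.
have acphi : abs_continuous w phi by apply: hasd_AC dphiE _; exists c.
have [c1 hc1] := AC_bounded acF; have [c2 hc2] := AC_bounded acphi.
have mF := ccont_meas w0 (AC_ccont acF); have mphi := ccont_meas w0 (AC_ccont acphi).
have i1 : cintegrable w (fun t => f t * phi t) by exact: (cintM if_ mphi hc2).
have i2 : cintegrable w (fun t => F t * dphi t).
  exact: (cintM (cint_bounded mF hc1) mdphi cdphi).
have [k [ik ek dk]] := AC_density (AC_mul acF acphi).
have E : ae_eq_on w k (fun t => f t * phi t + F t * dphi t).
  apply: (ae_eq_onS (aeI dk dF)) => t tw [h1 h2].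
  exact: (hasd_unique w0 tw (h1 tw) (hasdM (h2 tw) (dphiE t tw))).
have ww : 0 <= w <= w by rewrite lexx ltW.
have := ek w ww; rewrite (ae_eq_cintegral _ _ E).
- by rewrite cintegralD// => ->; ring.
- exact: cint_meas.
- by apply: cint_meas; exact: cintD.
Qed.

End complex_primitive.

(** * Measurability of the derivative *)

Section derivative_measurable.
Context {R : realType}.
Variable w : R.
Hypothesis w0 : 0 < w.
Notation leb := (@lebesgue_measure R).
Implicit Types (u : R -> R) (x t e d : R).

(* The step points into [0, w]. *)
Definition one_sided_quot (u : R -> R) n x :=
  let d := w / 2 / n.+1%:R in
  if x <= w / 2 then (u (x + d) - u x) / d else (u (x - d) - u x) / (- d).

(* A measurable function equal to the derivative wherever the latter exists. *)
Definition limit_quot u x := fine (limn_esup (fun n => (one_sided_quot u n x)%:E)).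

Lemma limit_quot_meas u : continuous u -> measurable_fun setT (limit_quot u).
Proof.
move=> cu; have mu : measurable_fun setT u by exact: continuous_measurable_fun.
have shift d : measurable_fun setT (fun x => u (x + d)).
  apply: measurableT_comp => //; apply: continuous_measurable_fun => x.
  by apply: continuousD; [exact: cvg_id|exact: cvg_cst].
have mq n : measurable_fun setT (one_sided_quot u n).
  apply: measurable_fun_ifT; first exact: measurable_fun_ler.
    by apply: measurable_funM => //; exact: measurable_funB.
  by apply: measurable_funM => //; exact: measurable_funB.
apply: (@measurableT_comp _ _ _ _ _ _ fine); first exact: fine_measurable.
by apply: measurable_fun_limn_esup => n; exact/measurable_EFinP.
Qed.

Lemma limit_quotE u x l : 0 <= x <= w ->
  (forall e, 0 < e -> exists2 d, 0 < d & forall t, 0 <= t <= w -> `|t - x| < d ->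
    `|u t - u x - l * (t - x)| <= e * `|t - x|) -> limit_quot u x = l.
Proof.
move=> /andP[x0 xw] h.
have H : (fun n => one_sided_quot u n x) @ \oo --> l.
  apply/cvgrPdist_le => e /h[d d0 hd].
  have [N hN] : exists N, forall n, (N <= n)%N -> w / 2 / n.+1%:R < d.
    exists (Num.bound (w / 2 / d)) => n hn.
    rewrite ltr_pdivrMr ?ltr0n// -ltr_pdivrMl// [ltLHS]mulrC.
    apply: (@lt_le_trans _ _ (Num.bound (w / 2 / d))%:R); last by rewrite ler_nat leqW.
    by apply: archi_boundP; rewrite !divr_ge0 ?(ltW w0) ?(ltW d0).
  exists N => // n /= /hN; rewrite /one_sided_quot; set s := w / 2 / _ => sd.
  have s0 : 0 < s by rewrite !divr_gt0.
  have sw : s <= w / 2 by rewrite ler_pdivrMr ?ltr0n// ler_peMr ?divr_ge0 ?(ltW w0)// ler1n.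
  have [xh|xh] := leP x (w / 2).
    have t : 0 <= x + s <= w by apply/andP; split; lra.
    have := hd _ t; rewrite addrAC subrr add0r gtr0_norm// => /(_ sd).
    have -> : l - (u (x + s) - u x) / s = - (u (x + s) - u x - l * s) / s.
      by field; rewrite gt_eqF.
    by rewrite normrM normrN normfV (gtr0_norm s0) ler_pdivrMr.
  have t : 0 <= x - s <= w by apply/andP; split; lra.
  have := hd _ t; rewrite addrAC subrr add0r normrN gtr0_norm// => /(_ sd).
  have -> : l - (u (x - s) - u x) / - s = (u (x - s) - u x - l * - s) / s.
    by field; rewrite gt_eqF.
  by rewrite normrM normfV (gtr0_norm s0) ler_pdivrMr.
have HE : (fun n => (one_sided_quot u n x)%:E) @ \oo --> l%:E.
  by apply: cvg_EFin; [exact: nearW|exact: H].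
rewrite /limit_quot is_cvg_limn_esupE; last exact: cvgP HE.
by rewrite (cvg_lim _ HE).
Qed.

Definition rational_point (j : nat) : R :=
  clamp w (ratr (odflt 0 (unpickle j : option rat))).

Lemma rational_point_dense t e : 0 <= t <= w -> 0 < e ->
  exists j, `|rational_point j - t| < e.
Proof.
move=> tw e0; have [r] := rat_in_itvoo (ltr_pwDr e0 (lexx t)).
rewrite in_itv /= => /andP[tr re]; exists (pickle r).
rewrite /rational_point pickleK /= -{1}(clamp_id tw).
rewrite ger0_norm ?subr_ge0 ?clamp_le ?(ltW w0) ?(ltW tr)//.
by apply: le_lt_trans (clamp_lip (ltW w0) (ltW tr)) _; lra.
Qed.

Variable f : R -> R[i].
Hypothesis cf : forall x, 0 <= x <= w -> ccont w f x.

Let l x : R[i] := limit_quot (fun t => complex.Re (f (clamp w t))) x +i*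
                  limit_quot (fun t => complex.Im (f (clamp w t))) x.

Let err x t := normc (f t - f x - l x * (t - x)%:C).

(* By density and continuity, testing on countably many points is enough. *)
Definition differentiable_at x := forall k, exists n, forall j,
  `|rational_point j - x| < n.+1%:R^-1 ->
  err x (rational_point j) <= k.+1%:R^-1 * `|rational_point j - x|.

Lemma clamp_in t : 0 <= clamp w t <= w.
Proof. exact: clamp_itv (ltW w0). Qed.

Lemma l_meas : cmeas w l.
Proof.
have [cr ci] := ccont_AC w0 cf.
by split; apply: measurable_funTS; exact: limit_quot_meas.
Qed.

Lemma differentiable_meas : measurable (`[0, w] `&` [set x | differentiable_at x]).
Proof.
have mi : measurable (`[0, w]%classic : set (measurableTypeR R)) by exact: measurable_itv.
pose A k n j := [set x | n.+1%:R^-1 <= `|rational_point j - x|] `|`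
  [set x | err x (rational_point j) <= k.+1%:R^-1 * `|rational_point j - x|].
rewrite (_ : _ `&` _ = \bigcap_k \bigcup_n \bigcap_j (`[0, w] `&` A k n j)); last first.
  apply/seteqP; split=> [x [xw h] k _|x h].
    have [n hn] := h k; exists n => // j _; split => //.
    by have [?|/hn ?] := leP n.+1%:R^-1 `|rational_point j - x|; [left|right].
  split; first by have [n _ /(_ 0%N I)[]] := h 0%N I.
  move=> k; have [n _ hn] := h k I; exists n => j lt.
  by have [_ []//=] := hn j I; rewrite leNgt lt.
apply: bigcapT_measurable => k; apply: bigcupT_measurable => n.
apply: bigcapT_measurable => j; rewrite setIUr.
have md : measurable_fun `[0, w] (fun x => `|rational_point j - x|).
  by apply: measurableT_comp => //; exact: measurable_funB.
apply: measurableU.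
  rewrite (_ : [set x | n.+1%:R^-1 <= `|rational_point j - x|] = (fun x => n.+1%:R^-1 <= `|rational_point j - x|) @^-1` [set true]).
    by apply: measurable_fun_ler.
  by apply/seteqP; split.
rewrite (_ : [set x | err x (rational_point j) <= k.+1%:R^-1 * `|rational_point j - x|] =
    (fun x => err x (rational_point j) <= k.+1%:R^-1 * `|rational_point j - x|) @^-1` [set true]).
  apply: measurable_fun_ler => //; last exact: measurable_funM.
  apply: cmeas_normc; apply: cmeasB; first by apply: cmeasB; [exact: cmeas_cst|exact: ccont_meas].
  by apply: cmeasM; [exact: l_meas|apply: cmeas_real; exact: measurable_funB].
by apply/seteqP; split.
Qed.

Lemma hasd_limit_quot x m : 0 <= x <= w -> hasd w f x m -> l x = m.
Proof.
move=> xw h; rewrite /l; case: m h => a b h.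
congr (_ +i* _); apply: limit_quotE => // e /h[d d0 hd]; exists d => // t tw /(hd t tw);
  apply: le_trans; rewrite !clamp_id//.
  by apply: le_trans (ler_Re _); rewrite !cReB cReM /= mulr0 subr0.
by apply: le_trans (ler_Im _); rewrite !cImB cImM /= mulr0 add0r.
Qed.

Lemma inv_nat_small (e : R) : 0 < e -> exists n, n.+1%:R^-1 < e.
Proof.
move=> e0; exists (Num.bound e^-1); rewrite -[ltRHS]invrK ltf_pV2 ?posrE ?invr_gt0 ?ltr0n//.
apply: (@lt_trans _ _ (Num.bound e^-1)%:R); last by rewrite ltr_nat.
by apply: archi_boundP; rewrite invr_ge0 ltW.
Qed.

Lemma differentiableP x : 0 <= x <= w -> differentiable_at x <-> hasd w f x (l x).
Proof.
move=> xw; split=> [h e e0|h k]; last first.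
  have [d d0 hd] := h k.+1%:R^-1 (ltac:(by rewrite invr_gt0 ltr0n)).
  have [n hn] := inv_nat_small d0; exists n => j lt.
  by apply: hd; [exact: clamp_in|exact: lt_trans hn].
have [k hk] := inv_nat_small e0; have [n hn] := h k.
exists n.+1%:R^-1 => [|t tw lt]; first by rewrite invr_gt0 ltr0n.
apply/ler_addgt0Pl => a a0.
(* Moving t to a rational point p within a / c changes the estimate by a / c through f, by |l| a / c
   through the linear term and by e a / c through |p - x|: together a. *)
pose c := 1 + normc (l x) + e.
have c0 : 0 < c by rewrite /c; have := normc_ge0 (l x); lra.
have a3 : 0 < a / c by rewrite divr_gt0.
have a2 : 0 < a / 2 by rewrite divr_gt0.
have [d d0 hd] := cf tw (divr_gt0 a0 c0).
pose d' := Num.min d (Num.min (a / c) (n.+1%:R^-1 - `|t - x|)).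
have d'0 : 0 < d' by rewrite !lt_min d0 a3 subr_gt0.
have [j] := rational_point_dense tw d'0; set p := rational_point j.
rewrite !lt_min => /andP[pd /andP[pa pn]].
have pw : 0 <= p <= w by exact: clamp_in.
have px : `|p - x| <= `|p - t| + `|t - x|.
  by rewrite (_ : p - x = (p - t) + (t - x)) ?ler_normD//; ring.
have pxn : `|p - x| < n.+1%:R^-1 by apply: le_lt_trans px _; rewrite -ltrBrDr.
have hj := hn j pxn; have {}hj : err x p <= e * `|p - x|.
  by apply: le_trans hj _; rewrite ler_wpM2r// ltW.
have hf := hd p pw pd.
rewrite (_ : _ - _ - _ = (f p - f x - l x * (p - x)%:C) + (f t - f p) + l x * (p - t)%:C); last first.
  by rewrite !rmorphB /=; ring.
apply: le_trans (normcD _ _) _; apply: le_trans (lerD (normcD _ _) (lexx _)) _.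
rewrite normcM normc_real (normcBC (f t)) -/(err x p).
have h1 : normc (l x) * `|p - t| <= normc (l x) * (a / c) by rewrite ler_wpM2l ?normc_ge0// ltW.
have h2 : e * `|p - x| <= e * (a / c) + e * `|t - x|.
  by rewrite -mulrDr ler_wpM2l ?(ltW e0)//; lra.
have : a = a / c * c by rewrite divfK// gt_eqF.
rewrite {2}/c; nra.
Qed.

(** As a bare [lim], [derive_on] equals [l] on the measurable set of differentiability and the
    default [point] elsewhere. Measurability is needed for [derive_on] itself: [in_Sobolev] asks the
    top derivative, known only almost everywhere, to be in L_2. *)
Lemma derive_on_meas : cmeas w (derive_on w f).
Proof.
have mi : measurable (`[0, w]%classic : set (measurableTypeR R)) by exact: measurable_itv.
have [mr mim] := l_meas.
have E x : 0 <= x <= w -> derive_on w f x = if `[< differentiable_at x >] then l x else (point : R[i]^o).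
  move=> xw; case: asboolP => [/(differentiableP xw)|h]; first exact: hasd_derive.
  apply: xgetPN => m; move/(hasdP w0 _ _ xw) => hm; apply: h.
  by apply/(differentiableP xw); rewrite (hasd_limit_quot xw hm).
have mE : measurable_fun `[0, w] (fun x => `[< differentiable_at x >]).
  apply: (measurable_fun_bool true).
  rewrite (_ : _ @^-1` _ = [set x | differentiable_at x]); first exact: differentiable_meas.
  by apply/seteqP; split=> x /asboolP.
have sub b : measurable (`[0, w] `&` (fun x => `[< differentiable_at x >]) @^-1` [set b]).
  exact: mE.
split.
  apply: (eq_measurable_fun (fun x => if `[< differentiable_at x >] then complex.Re (l x)
      else complex.Re (point : R[i]^o))).
    by move=> x; rewrite inE => /in_cc /E ->; case: ifP.
  apply: measurable_fun_if => //; first exact: measurable_funS mr.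
apply: (eq_measurable_fun (fun x => if `[< differentiable_at x >] then complex.Im (l x)
    else complex.Im (point : R[i]^o))).
  by move=> x; rewrite inE => /in_cc /E ->; case: ifP.
by apply: measurable_fun_if => //; exact: measurable_funS mim.
Qed.

End derivative_measurable.

(** * Sine coefficients *)

Section sine_system.
Context {R : realType}.
Variable w : R.
Hypothesis w0 : 0 < w.
Notation leb := (@lebesgue_measure R).
Implicit Types (x t c : R) (f g y : R -> R[i]) (i j n : nat).

Definition freq j : R := pi * j.+1%:R / w.
Definition sn j t : R := sin (freq j * t).
Definition coef y j : R[i] := (2 / w)%:C * cintegral w (fun t => y t * (sn j t)%:C).

Lemma is_derive_sin_scale c x : is_derive x 1 (fun t => sin (c * t)) (c * cos (c * x)).
Proof.
have h : is_derive x 1 (fun t : R => c * t) c.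
  have := is_deriveZ c (is_derive_id x 1); rewrite [_ *: 1]mulr1.
  by [].
have := @is_derive1_comp _ sin (fun t => c * t) x _ _ (is_derive_sin _) h.
by rewrite mulrC.
Qed.

Lemma is_derive_cos_scale c x : is_derive x 1 (fun t => cos (c * t)) (- (c * sin (c * x))).
Proof.
have h : is_derive x 1 (fun t : R => c * t) c.
  have := is_deriveZ c (is_derive_id x 1); rewrite [_ *: 1]mulr1.
  by [].
have := @is_derive1_comp _ cos (fun t => c * t) x _ _ (is_derive_cos _) h.
by rewrite mulNr mulrC.
Qed.

Lemma hasd_sin c x : hasd w (fun t => (sin (c * t))%:C) x (c * cos (c * x))%:C.
Proof. exact: hasd_real (is_derive_sin_scale c x). Qed.

Lemma hasd_cos c x : hasd w (fun t => (cos (c * t))%:C) x (- (c * sin (c * x)))%:C.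
Proof. exact: hasd_real (is_derive_cos_scale c x). Qed.

Lemma sin_meas c : cmeas w (fun t => (sin (c * t))%:C).
Proof. by apply: (ccont_meas w0) => x _; exact: hasd_ccont (hasd_sin c x). Qed.

Lemma cos_meas c : cmeas w (fun t => (cos (c * t))%:C).
Proof. by apply: (ccont_meas w0) => x _; exact: hasd_ccont (hasd_cos c x). Qed.

Lemma sn_meas j : cmeas w (fun t => (sn j t)%:C).
Proof. exact: sin_meas. Qed.

Lemma normc_sin c t : normc (sin (c * t))%:C <= 1.
Proof. by rewrite normc_real sin_max. Qed.

Lemma normc_cos c t : normc (cos (c * t))%:C <= 1.
Proof. by rewrite normc_real cos_max. Qed.

Lemma cint_sn f j : cintegrable w f -> cintegrable w (fun t => f t * (sn j t)%:C).
Proof. by move=> h; apply: (cintM h (sn_meas j)) => t _; exact: normc_sin. Qed.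

Lemma cint_cos f c : cintegrable w f -> cintegrable w (fun t => f t * (cos (c * t))%:C).
Proof. by move=> h; apply: (cintM h (cos_meas c)) => t _; exact: normc_cos. Qed.

Lemma FTC_hasd F g c : (forall x, 0 <= x <= w -> hasd w F x (g x)) -> cmeas w g ->
  (forall x, 0 <= x <= w -> normc (g x) <= c) -> cintegral w g = F w - F 0.
Proof.
move=> hF mg cg; have acF : abs_continuous w F by apply: (hasd_AC w0 hF); exists c.
have [k [ik ek dk]] := AC_density w0 acF.
have ww : 0 <= w <= w by rewrite lexx ltW.
rewrite (ek w ww) addrAC subrr add0r; apply: ae_eq_cintegral => //.
  exact: cint_meas.
apply: (ae_eq_onS dk) => t tw h; exact: (hasd_unique w0 tw (hF t tw) (h tw)).
Qed.

Lemma coefD f g j : cintegrable w f -> cintegrable w g ->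
  coef (fun t => f t + g t) j = coef f j + coef g j.
Proof.
move=> hf hg; rewrite /coef -mulrDr -cintegralD; [|exact: cint_sn..].
by congr (_ * cintegral _ _); apply/funext => t; rewrite mulrDl.
Qed.

Lemma coefZ f z j : cintegrable w f -> coef (fun t => z * f t) j = z * coef f j.
Proof.
move=> hf; rewrite /coef mulrCA -(cintegralZ z (cint_sn j hf)).
by congr (_ * cintegral _ _); apply/funext => t; rewrite mulrA.
Qed.

Lemma coefB f g j : cintegrable w f -> cintegrable w g ->
  coef (fun t => f t - g t) j = coef f j - coef g j.
Proof.
move=> hf hg; rewrite /coef -mulrBr -cintegralB; [|exact: cint_sn..].
by congr (_ * cintegral _ _); apply/funext => t; rewrite mulrBl.
Qed.

Lemma coef_ae f g j : cmeas w f -> cmeas w g -> ae_eq_on w f g -> coef f j = coef g j.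
Proof.
move=> mf mg fg; congr (_ * _); apply: ae_eq_cintegral.
- exact: cmeasM (sn_meas j).
- exact: cmeasM (sn_meas j).
- by apply: (ae_eq_onS fg) => t tw h; rewrite h// in_itv.
Qed.

Lemma coef_eq f g j : (forall t, 0 <= t <= w -> f t = g t) -> coef f j = coef g j.
Proof. by move=> h; congr (_ * _); apply: eq_cintegral => t /h ->. Qed.

Lemma coef_bound f j : in_L2 w f -> normc (coef f j) <= 4 * norm_L2 w f.
Proof.
move=> fL2; have fi := L2_cint fL2; have h1 := L1_le_L2 w0 fL2.
have := cintegral_le (cint_sn j fi) (cint_normc fi) _.
move=> /(_ _)/wrap[t _|h2].
  by rewrite normcM ler_piMr ?normc_ge0// normc_sin.
rewrite normcM normc_real ger0_norm ?divr_ge0 ?(ltW w0)//.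
rewrite mulrAC ler_pdivrMr//; apply: (@le_trans _ _ (2 * (2 * (w * norm_L2 w f)))).
  by rewrite ler_pM2l// (le_trans h2)// ler_pM2l.
by rewrite le_eqVlt; apply/orP; left; apply/eqP; ring.
Qed.

Lemma sin_pi_nat n : sin (pi * n%:R) = 0 :> R.
Proof.
by elim: n => [|n ih]; rewrite ?mulr0 ?sin0// -natr1 mulrDr mulr1 sinDpi ih oppr0.
Qed.

Lemma sn_0 j : sn j 0 = 0. Proof. by rewrite /sn mulr0 sin0. Qed.

Lemma sn_w j : sn j w = 0.
Proof. by rewrite /sn /freq divfK ?gt_eqF// sin_pi_nat. Qed.

Lemma cintegral_cos_nat n : (0 < n)%N ->
  cintegral w (fun t => (cos (pi * n%:R / w * t))%:C) = 0.
Proof.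
move=> n0; set c := pi * n%:R / w.
have c0 : c != 0 by rewrite /c !mulf_neq0 ?invr_eq0 ?gt_eqF ?pi_gt0 ?ltr0n.
rewrite (@FTC_hasd (fun t => c%:C^-1 * (sin (c * t))%:C) _ 1); first last.
- by move=> x _; exact: normc_cos.
- exact: cos_meas.
- move=> x _; have := hasdZ c%:C^-1 (hasd_sin c x).
  suff -> : c%:C^-1 * (c * cos (c * x))%:C = (cos (c * x))%:C :> R[i] by [].
  by rewrite -fmorphV -rmorphM /= mulKf.
by rewrite mulr0 sin0 /c divfK ?gt_eqF// sin_pi_nat subrr.
Qed.

Lemma sn_mul i j t : (i <= j)%N -> sn i t * sn j t =
  (cos (pi * (j - i)%:R / w * t) - cos (pi * (i + j).+2%:R / w * t)) / 2.
Proof.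
move=> ij; have -> : pi * (j - i)%:R / w * t = freq j * t - freq i * t.
  by rewrite /freq natrB// -!natr1; field; rewrite gt_eqF.
have -> : pi * (i + j).+2%:R / w * t = freq j * t + freq i * t.
  by rewrite /freq -!natr1 natrD; field; rewrite gt_eqF.
by rewrite cosB cosD /sn; field.
Qed.

Lemma cint_one : cintegrable w (fun=> 1). Proof. exact: cint_cst. Qed.

Lemma cintegral_sn2 i j :
  cintegral w (fun t => (sn i t)%:C * (sn j t)%:C) = if i == j then (w / 2)%:C else 0.
Proof.
wlog ij : i j / (i <= j)%N => [h|].
  have [/h//|/ltnW/h] := leqP i j; rewrite eq_sym => <-.
  by congr cintegral; apply/funext => t; rewrite mulrC.
pose e n : R -> R[i] := fun t => (cos (pi * n%:R / w * t))%:C.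
have ie n : cintegrable w (e n).
  have := cint_cos (pi * n%:R / w) cint_one; congr cintegrable.
  by apply/funext => t; rewrite mul1r.
rewrite (_ : (fun t => _) = fun t => (2^-1)%:C * (e (j - i)%N t - e (i + j).+2 t)); last first.
  by apply/funext => t; rewrite -rmorphM sn_mul// mulrC rmorphM rmorphB.
rewrite cintegralZ ?cintegralB//; last exact: cintB.
rewrite (cintegral_cos_nat (ltn0Sn _)) subr0.
case: eqVneq => [->|nij]; last by rewrite cintegral_cos_nat ?mulr0// subn_gt0 ltn_neqAle nij.
rewrite subnn /e; under eq_fun do rewrite mulr0 mul0r mul0r cos0.
apply: complex_ext; rewrite ?cReM ?cImM /= Rintegral_cc_cst ?(ltW w0)// Rintegral_cc_cst ?(ltW w0)//.
  by ring.
by ring.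
Qed.

Lemma normc2B_real (a c : R[i]) (s : R) : normc (a - c * s%:C) ^+ 2 =
  normc a ^+ 2 - 2 * complex.Re (c^* * (a * s%:C)) + normc c ^+ 2 * s ^+ 2.
Proof.
rewrite !normc_sqr !cReM !cImM cReB cImB cReM cImM cReJ cImJ /=.
ring.
Qed.

Lemma bessel_step f j z : in_L2 w f -> coef f j = z ->
  \int[leb]_(t in `[0, w]) normc (f t - z * (sn j t)%:C) ^+ 2 =
  \int[leb]_(t in `[0, w]) normc (f t) ^+ 2 - w / 2 * normc z ^+ 2.
Proof.
move=> /[dup] fL2 /in_L2P[mf f2] fz; have fi := L2_cint fL2.
under eq_Rintegral => t _ do rewrite normc2B_real.
have i1 := cint_sn j fi; have i2 := cintZ z^* i1.
have i3 := cint_sn j (cint_sn j cint_one).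
have r3 : rintegrable w (fun t => sn j t ^+ 2).
  move: i3.1; congr rintegrable; apply/funext => t.
  by rewrite mul1r -rmorphM /= expr2.
have e3 : \int[leb]_(t in `[0, w]) sn j t ^+ 2 = w / 2.
  have := congr1 (@complex.Re R) (cintegral_sn2 j j); rewrite eqxx /= => <-.
  by apply: eq_Rintegral => t _; rewrite mul0r subr0 expr2.
have e2 : \int[leb]_(t in `[0, w]) complex.Re (z^* * (f t * (sn j t)%:C)) =
    w / 2 * normc z ^+ 2.
  rewrite -[LHS]/(complex.Re (cintegral w (fun t => z^* * (f t * (sn j t)%:C)))).
  rewrite cintegralZ//.
  have -> : cintegral w (fun t => f t * (sn j t)%:C) = (w / 2)%:C * z.
    rewrite -fz /coef mulrA -rmorphM /= (_ : w / 2 * (2 / w) = 1) ?mul1r//.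
    by field; rewrite gt_eqF.
  by rewrite normc_sqr !cReM !cImM cReJ cImJ /=; ring.
have r2 := i2.1.
rewrite RintegralD; [|exact: measurable_itv|by apply: rintB => //; exact: rintZ|exact: rintZ].
rewrite RintegralB; [|exact: measurable_itv|exact: f2|exact: rintZ].
rewrite RintegralZl; [|exact: measurable_itv|exact: r2].
rewrite RintegralZl; [|exact: measurable_itv|exact: r3].
by rewrite e2 e3; ring.
Qed.

(** The terms are subtracted one at a time; later coefficients are unaffected, so each step lowers
    the squared norm of the remainder by w / 2 |coef f n|^2. *)
Lemma bessel f N : in_L2 w f ->
  \sum_(j < N) normc (coef f j) ^+ 2 <= 2 / w * \int[leb]_(t in `[0, w]) normc (f t) ^+ 2.
Proof.
move=> fL2.
pose r n t := f t - \sum_(j < n) coef f j * (sn j t)%:C.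
have isn j (z : R[i]) : cintegrable w (fun t => z * (sn j t)%:C).
  exact: cint_sn (cint_cst w z).
have L2sn j (z : R[i]) : in_L2 w (fun t => z * (sn j t)%:C).
  apply: (@L2_bounded _ _ _ (normc z)) => [|t _]; first exact: cint_meas.
  by rewrite normcM ler_piMr ?normc_ge0 ?normc_sin.
have rS n : r n.+1 = fun t => r n t - coef f n * (sn n t)%:C.
  by apply/funext => t; rewrite /r big_ord_recr /= opprD addrA.
have rL2 n : in_L2 w (r n).
  elim: n => [|n ih]; last by rewrite rS; exact: L2B.
  by rewrite (_ : r 0%N = f)//; apply/funext => t; rewrite /r big_ord0 subr0.
have rc n m : (n <= m)%N -> coef (r n) m = coef f m.
  elim: n => [|n ih] nm.
    by rewrite (_ : r 0%N = f)//; apply/funext => t; rewrite /r big_ord0 subr0.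
  rewrite rS coefB; [|exact/L2_cint/rL2|exact: isn].
  rewrite ih ?(ltnW nm)// coefZ; last first.
    by have := isn n 1; congr cintegrable; apply/funext => t; rewrite mul1r.
  by rewrite /coef cintegral_sn2 ltn_eqF// !mulr0 subr0.
have key n : \int[leb]_(t in `[0, w]) normc (r n t) ^+ 2 =
    \int[leb]_(t in `[0, w]) normc (f t) ^+ 2 - w / 2 * \sum_(j < n) normc (coef f j) ^+ 2.
  elim: n => [|n ih].
    rewrite big_ord0 mulr0 subr0; apply: eq_Rintegral => t _.
    by rewrite /r big_ord0 subr0.
  by rewrite rS (bessel_step (rL2 n) (rc n n (leqnn n))) ih big_ord_recr /=; ring.
have : 0 <= \int[leb]_(t in `[0, w]) normc (r N t) ^+ 2.
  by apply: Rintegral_ge0 => t _; exact: sqr_ge0.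
rewrite key subr_ge0 -ler_pdivlMl ?divr_gt0// => /le_trans; apply.
by rewrite invf_div.
Qed.

End sine_system.

(** * Sine series with absolutely summable coefficients *)

Section sine_series.
Context {R : realType}.
Variable w : R.
Hypothesis w0 : 0 < w.
Notation leb := (@lebesgue_measure R).
Implicit Types (x t c : R) (f g y : R -> R[i]) (i j n : nat) (v : nat -> R[i]).

Definition sine_series v t : R[i] := csum (fun j => v j * (sn w j t)%:C).

Lemma sine_term_le v t j : normc (v j * (sn w j t)%:C) <= normc (v j).
Proof. by rewrite normcM ler_piMr ?normc_ge0 ?normc_sin. Qed.

Lemma sine_summable v c t : csummable v c -> csummable (fun j => v j * (sn w j t)%:C) c.
Proof. by move=> h; apply: csummable_dom h => j; exact: sine_term_le. Qed.

Lemma sine_series_near v c e : csummable v c -> 0 < e -> exists N0, forall N, (N0 <= N)%N ->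
  forall t, normc (sine_series v t - \sum_(j < N) v j * (sn w j t)%:C) <= e.
Proof.
move=> h e0; have [n hn] := small_tail e0 (fun i => normc_ge0 (v i)) h.
exists n => N nN t; rewrite /sine_series (csum_split N (sine_summable t h)).
rewrite addrAC subrr add0r; apply: csum_le => M; apply: le_trans (hn M).
apply: ler_sum => i _; case: ltnP => iN; first by rewrite normc0; case: ifP => // _; exact: normc_ge0.
by rewrite ltnNge (leq_trans nN iN) sine_term_le.
Qed.

Lemma sine_series_ccont v c x : csummable v c -> ccont w (sine_series v) x.
Proof.
move=> h e e0; have e3 : 0 < e / 3 by rewrite divr_gt0.
have [N /(_ N (leqnn N)) hN] := sine_series_near h e3.
have : ccont w (fun t => \sum_(j < N) v j * (sn w j t)%:C) x.
  elim: N {hN} => [|N ih].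
    rewrite (_ : (fun _ => _) = fun=> 0); last by apply/funext => t; rewrite big_ord0.
    exact: hasd_ccont (hasd_cst w x 0).
  move=> a a0; have a2 : 0 < a / 2 by rewrite divr_gt0.
  have [d d0 hd] := ih _ a2.
  have [d' d'0 hd'] := hasd_ccont (hasdZ (v N) (hasd_sin w (freq w N) x)) a2.
  exists (Num.min d d') => [|t tw]; first by rewrite lt_min d0.
  rewrite lt_min => /andP[/(hd t tw) h1 /(hd' t tw) h2].
  rewrite !big_ord_recr /= opprD addrACA (splitr a) (le_trans (normcD _ _))//.
  exact: lerD.
move=> /(_ _ e3)[d d0 hd]; exists d => // t tw /(hd t tw) h3.
pose S t : R[i] := \sum_(j < N) v j * (sn w j t)%:C.
have {}h3 : normc (S t - S x) <= e / 3 := h3.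
have ht : normc (sine_series v t - S t) <= e / 3 := hN t.
have hx : normc (sine_series v x - S x) <= e / 3 := hN x.
rewrite (_ : _ - _ = (sine_series v t - S t) - (sine_series v x - S x) + (S t - S x)); last by ring.
apply: le_trans (normcD _ _) _; apply: le_trans (lerD (normcB _ _) (lexx _)) _.
by lra.
Qed.

Lemma sine_series_bound v c t : csummable v c -> normc (sine_series v t) <= c.
Proof. by move=> h; exact: csum_le (sine_summable t h). Qed.

Lemma sine_series_meas v c : csummable v c -> cmeas w (sine_series v).
Proof. by move=> h; apply: (ccont_meas w0) => x _; exact: sine_series_ccont h. Qed.

Lemma cintegral_sine_series f v c : cintegrable w f -> csummable v c ->
  cintegral w (fun t => f t * sine_series v t) =
  csum (fun j => v j * cintegral w (fun t => f t * (sn w j t)%:C)).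
Proof.
move=> hf h; pose K := 2 * \int[leb]_(t in `[0, w]) normc (f t).
have nf := cint_normc hf.
have K0 : 0 <= K by rewrite mulr_ge0// Rintegral_ge0// => t _; exact: normc_ge0.
have fj j : cintegrable w (fun t => f t * (sn w j t)%:C) by exact: cint_sn.
have bj j : normc (cintegral w (fun t => f t * (sn w j t)%:C)) <= K.
  apply: cintegral_le => // t _.
  by rewrite normcM ler_piMr ?normc_ge0 ?normc_sin.
apply/esym; apply: (@csum_unique _ _ (c * K)).
  move=> N; apply: le_trans (_ : \sum_(i < N) normc (v i) * K <= _).
    by apply: ler_sum => i _; rewrite normcM ler_wpM2l ?normc_ge0.
  by rewrite -mulr_suml ler_wpM2r.
move=> e e0; have e1 : 0 < e / (K + 1) / 2 by rewrite !divr_gt0// ltr_wpDl.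
have [N0 hN] := sine_series_near h e1; exists N0 => N /hN {}hN.
pose S t := \sum_(j < N) v j * (sn w j t)%:C.
have fvj j : cintegrable w (fun t => v j * (f t * (sn w j t)%:C)) by exact: cintZ.
have [iS eS] := cintegral_sum N fvj.
have isf : cintegrable w (fun t => f t * sine_series v t).
  by apply: (cintM hf (sine_series_meas h)) => t _; exact: sine_series_bound h.
have <- : cintegral w (fun t => \sum_(i < N) v i * (f t * (sn w i t)%:C)) =
    \sum_(i < N) v i * cintegral w (fun t => f t * (sn w i t)%:C).
  by rewrite eS; apply: eq_bigr => i _; rewrite cintegralZ.
rewrite -cintegralB//.
apply: (@le_lt_trans _ _ (2 * \int[leb]_(t in `[0, w]) (e / (K + 1) / 2 * normc (f t)))).
  apply: cintegral_le; [exact: cintB|exact: rintZ|] => t _.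
  have -> : \sum_(i < N) v i * (f t * (sn w i t)%:C) = f t * S t.
    by rewrite mulr_sumr; apply: eq_bigr => i _; rewrite mulrCA.
  by rewrite -mulrBr normcM mulrC ler_wpM2r ?normc_ge0// normcBC.
rewrite RintegralZl; [|exact: measurable_itv|exact: nf].
rewrite mulrCA -/K; have KK : 0 < K + 1 by rewrite ltr_wpDl.
apply: (@le_lt_trans _ _ (e / 2)); last by lra.
by rewrite mulrAC ler_pM2r ?invr_gt0// mulrAC ler_pdivrMr// ler_pM2l// lerDl.
Qed.

Lemma coef_sine_series v c i : csummable v c -> coef w (sine_series v) i = v i.
Proof.
move=> h; rewrite /coef.
have isn := cint_sn w0 i (cint_one w).
have -> : cintegral w (fun t => sine_series v t * (sn w i t)%:C) =
    cintegral w (fun t => 1 * (sn w i t)%:C * sine_series v t).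
  by congr cintegral; apply/funext => t; rewrite mul1r mulrC.
rewrite (cintegral_sine_series isn h).
have E j : cintegral w (fun t => 1 * (sn w i t)%:C * (sn w j t)%:C) =
    if i == j then (w / 2)%:C else 0.
  by rewrite -cintegral_sn2//; congr cintegral; apply/funext => t; rewrite mul1r.
rewrite (@csum_delta _ _ i) => [|j ij]; last by rewrite E eq_sym (negbTE ij) mulr0.
by rewrite E eqxx mulrCA -rmorphM /= (_ : 2 / w * (w / 2) = 1) ?mulr1//; field; rewrite gt_eqF.
Qed.

Lemma coef_mul_sine_series q v c j : cintegrable w q -> csummable v c ->
  coef w (fun t => q t * sine_series v t) j =
  csum (fun i => coef w (fun t => q t * (sn w i t)%:C) j * v i).
Proof.
move=> hq h; rewrite /coef.
have qj := cint_sn w0 j hq.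
have -> : cintegral w (fun t => q t * sine_series v t * (sn w j t)%:C) =
    cintegral w (fun t => q t * (sn w j t)%:C * sine_series v t).
  by congr cintegral; apply/funext => t; rewrite mulrAC.
rewrite (cintegral_sine_series qj h).
have b i : normc (cintegral w (fun t => q t * (sn w j t)%:C * (sn w i t)%:C)) <=
   2 * \int[leb]_(t in `[0, w]) normc (q t).
  apply: cintegral_le; [exact: cint_sn|exact: cint_normc|] => t _.
  rewrite !normcM -mulrA ler_piMr ?normc_ge0// mulr_ile1 ?normc_ge0 ?normc_sin//.
rewrite -(@csumZ _ _ (c * (2 * \int[leb]_(t in `[0, w]) normc (q t)))); last first.
  move=> N; apply: le_trans (_ : \sum_(i < N) normc (v i) * (2 * \int[leb]_(t in `[0, w]) normc (q t)) <= _).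
    by apply: ler_sum => i _; rewrite normcM ler_wpM2l ?normc_ge0.
  rewrite -mulr_suml ler_wpM2r//; apply: le_trans (b 0%N); exact: normc_ge0.
congr csum; apply/funext => i; rewrite mulrCA mulrC; congr (_ * cintegral _ _ * _).
by apply/funext => t; rewrite mulrAC.
Qed.

End sine_series.

(** * Completeness of the sine system *)

Section completeness.
Context {R : realType}.
Variable w : R.
Hypothesis w0 : 0 < w.
Notation leb := (@lebesgue_measure R).
Implicit Types (x t c : R) (u : R -> R[i]) (i j n m : nat).

Lemma Rintegral_indic_itv (a b : R) : 0 <= a -> a <= b -> b <= w ->
  rintegrable w (\1_(`[a, b]%classic : set R)) /\
  \int[leb]_(t in `[0, w]) (\1_(`[a, b]%classic : set R)) t = b - a.
Proof.
move=> a0 ab bw.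
have mJ : measurable (`[a, b]%classic : set (measurableTypeR R)) by exact: measurable_itv.
have mI : measurable (`[0, w]%classic : set (measurableTypeR R)) by exact: measurable_itv.
split.
  apply: (rint_dom _ (rint_cst w 1)) => [|t _].
    by apply: measurable_funTS; exact: measurable_indic.
  by rewrite ger0_norm // indicE lern1 leq_b1.
rewrite /Rintegral integral_indic//.
have -> : `[a, b]%classic `&` `[0, w]%classic = `[a, b]%classic :> set R.
  apply/setIidPl => t; rewrite /= !in_itv /= => /andP[? ?]; apply/andP; split; lra.
have := @lebesgue_measure_itv R `[a, b]; rewrite /= => ->; rewrite lte_fin; case: ltP => // h.
rewrite (_ : b = a) ?subrr//.
by apply/eqP; rewrite eq_le ab h.
Qed.

Lemma le_rint (f g : R -> R) : rintegrable w f -> rintegrable w g ->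
  (forall t, 0 <= t <= w -> f t <= g t) ->
  \int[leb]_(t in `[0, w]) f t <= \int[leb]_(t in `[0, w]) g t.
Proof.
move=> hf hg h; apply: le_Rintegral; [exact: measurable_itv|exact: hf|exact: hg|].
by move=> t /in_cc /h.
Qed.

Lemma below_three (a b c : R) : 0 < a -> 0 < b -> 0 < c ->
  exists d, [/\ 0 < d, d < a, d < b & d < c].
Proof.
move=> a0 b0 c0; pose m := Num.min a (Num.min b c).
have m0 : 0 < m by rewrite !lt_min a0 b0.
have [ma mb mc] : [/\ m <= a, m <= b & m <= c] by rewrite /m !ge_min !lexx !orbT.
by exists (m / 2); split; lra.
Qed.

Lemma parabola_far (x c e : R) : 0 <= e -> x <= c - e \/ c + e <= x ->
  1 - (x - c) ^+ 2 / 4 <= 1 - e ^+ 2 / 4.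
Proof.
move=> e0 h; have : e ^+ 2 <= (x - c) ^+ 2 by case: h => h; nra.
lra.
Qed.

Lemma parabola_near (x c e : R) : `|x - c| <= e / 2 -> 1 - e ^+ 2 / 16 <= 1 - (x - c) ^+ 2 / 4.
Proof. by rewrite ler_norml => /andP[h1 h2]; nra. Qed.

Lemma expr_small (r e : R) : 0 <= r -> r < 1 -> 0 < e -> exists n, r ^+ n < e.
Proof.
move=> r0 r1 e0; have : (fun n => r ^+ n) @ \oo --> 0.
  by apply: cvg_expr; rewrite ger0_norm.
move=> /cvgrPdist_lt/(_ e e0)[N _ /(_ N (leqnn N))] /=.
by rewrite sub0r normrN ger0_norm ?exprn_ge0// => h; exists N.
Qed.

Let th : R := pi / w.
Let C t : R := cos (th * t).

Lemma th0 : 0 < th. Proof. by rewrite divr_gt0 ?pi_gt0. Qed.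

Lemma sn_cos j t : sn w j.+1 t * C t = (sn w j.+2 t + sn w j t) / 2.
Proof.
rewrite /sn /C /th.
have -> : freq w j.+2 * t = freq w j.+1 * t + pi / w * t.
  by rewrite /freq -!natr1; field; rewrite gt_eqF.
have -> : freq w j * t = freq w j.+1 * t - pi / w * t.
  by rewrite /freq -!natr1; field; rewrite gt_eqF.
by rewrite sinD sinB; field.
Qed.

Lemma sn0_cos t : sn w 0 t * C t = sn w 1 t / 2.
Proof.
rewrite /sn /C /th; have -> : freq w 1 * t = freq w 0 * t + pi / w * t.
  by rewrite /freq -!natr1; field; rewrite gt_eqF.
have -> : freq w 0 * t = pi / w * t by rewrite /freq mulr1.
by rewrite sinD; field.
Qed.

Section peak.
Variables (u : R -> R[i]) (x0 : R).
Hypothesis cu : forall x, 0 <= x <= w -> ccont w u x.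
Variable M : R.
Hypothesis hM : forall x, 0 <= x <= w -> normc (u x) <= M.
Hypothesis hu : forall j, cintegral w (fun t => u t * (sn w j t)%:C) = 0.
Hypothesis hx0 : 0 < x0 < w.

Let c0 := C x0.
(** A polynomial in cos (pi t / w) with values in [0, 1]. On [0, w] it takes the value 1 only at x0,
    because this cosine is injective there. *)
Let P t : R := 1 - (C t - c0) ^+ 2 / 4.

Let iu : cintegrable w u.
Proof. exact: (cint_bounded (ccont_meas w0 cu) hM). Qed.

Lemma C_le1 t : `|C t| <= 1. Proof. exact: cos_max. Qed.

Lemma P_itv t : 0 <= P t <= 1.
Proof.
have := C_le1 t; have := C_le1 x0; rewrite -/c0 !ler_norml => /andP[a b] /andP[c d].
have h1 : 0 <= (C t - c0) ^+ 2 by exact: sqr_ge0.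
have h2 : (C t - c0) ^+ 2 <= 4 by nra.
by rewrite /P; apply/andP; split; lra.
Qed.

Lemma integrable_moment j m n :
  cintegrable w (fun t => u t * (sn w j t * C t ^+ m * P t ^+ n)%:C).
Proof.
have mC : cmeas w (fun t => (C t)%:C) by exact: cos_meas.
have mP : cmeas w (fun t => (P t)%:C).
  rewrite (_ : (fun _ => _) = fun t => 1 - (4^-1)%:C * (((C t)%:C - c0%:C) * ((C t)%:C - c0%:C))).
    have mB : cmeas w (fun t => (C t)%:C - c0%:C) by apply: cmeasB => //; exact: cmeas_cst.
    by apply: cmeasB; [exact: cmeas_cst|apply: cmeasZ; exact: cmeasM].
  by apply/funext => t; rewrite /P rmorphB rmorphM rmorphXn rmorphB /= expr2 mulrC.
have mX (f : R -> R) k : cmeas w (fun t => (f t)%:C) -> cmeas w (fun t => (f t ^+ k)%:C).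
  move=> mf; elim: k => [|k ih].
    by rewrite (_ : (fun _ => _) = fun=> 1); [exact: cmeas_cst|apply/funext => t; rewrite expr0].
  rewrite (_ : (fun _ => _) = fun t => (f t)%:C * (f t ^+ k)%:C); first exact: cmeasM.
  by apply/funext => t; rewrite exprS rmorphM.
have mm : cmeas w (fun t => (sn w j t * C t ^+ m * P t ^+ n)%:C).
  rewrite (_ : (fun _ => _) = fun t => (sn w j t)%:C * (C t ^+ m)%:C * (P t ^+ n)%:C).
    by apply: cmeasM; [apply: cmeasM; [exact: sn_meas|exact: mX]|exact: mX].
  by apply/funext => t; rewrite !rmorphM.
apply: (@cintM _ _ _ _ 1) => // t _; rewrite normc_real !normrM !normrX.
have /andP[p0 p1] := P_itv t.
rewrite !mulr_ile1 ?mulr_ge0 ?exprn_ge0 ?exprn_ile1 ?normr_ge0//.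
- exact: sin_max.
- exact: C_le1.
- by rewrite ger0_norm.
Qed.

(** Multiplication by [C] preserves the span of the sines ([sn_cos], and [sn0_cos] at the lowest
    index), so powers of [C] reduce to [hu]; [P] is quadratic in [C], so each factor [P] reduces to
    powers of [C]. *)
Lemma moment_zero j m n :
  cintegral w (fun t => u t * (sn w j t * C t ^+ m * P t ^+ n)%:C) = 0.
Proof.
elim: n j m => [|n ihn] j m.
  elim: m j => [|m ihm] j.
    by rewrite -[RHS](hu j); congr cintegral; apply/funext => t; rewrite !expr0 !mulr1.
  case: j => [|j].
    rewrite -[RHS](mulr0 (2^-1)%:C) -[in RHS](ihm 1%N) -cintegralZ; last exact: integrable_moment.
    congr cintegral; apply/funext => t.
    by rewrite mulrCA -rmorphM exprS (mulrA (sn w 0 t)) sn0_cos; congr (_ * _%:C); ring.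
  rewrite -[RHS](mulr0 (2^-1)%:C) -[in RHS](addr0 0) -{1}(ihm j.+2) -(ihm j).
  rewrite -cintegralD -?cintegralZ; [|by apply: cintD; exact: integrable_moment|exact: integrable_moment..].
  congr cintegral; apply/funext => t.
  rewrite -mulrDr mulrCA -rmorphD -rmorphM exprS (mulrA (sn w j.+1 t)) sn_cos.
  by congr (_ * _%:C); ring.
pose I k := fun t => u t * (sn w j t * C t ^+ k * P t ^+ n)%:C.
have iI k : cintegrable w (I k) by exact: integrable_moment.
have E : (fun t => u t * (sn w j t * C t ^+ m * P t ^+ n.+1)%:C) =
  fun t => (1 - c0 ^+ 2 / 4)%:C * I m t + (c0 / 2)%:C * I m.+1 t - (4^-1)%:C * I m.+2 t.
  apply/funext => t; rewrite /I !(mulrCA _ (u t)) -!rmorphM -mulrDr -rmorphD -mulrBr -rmorphB /=.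
  congr (_ * _%:C); rewrite !exprS; rewrite /P.
  move: (C t ^+ m) ((1 - (C t - c0) ^+ 2 / 4) ^+ n) (C t) (sn w j t) c0 => X Y a b c.
  by field.
rewrite E cintegralB; [|by apply: cintD; exact: cintZ|exact: cintZ].
rewrite cintegralD; [|exact: cintZ|exact: cintZ].
by rewrite !cintegralZ// /I !ihn !mulr0 addr0 subr0.
Qed.

(* Otherwise sin (th t) P(t)^n, a combination of sines concentrating at x0, would
   have a positive integral against u for large n. *)
Lemma peak : complex.Re (u x0) <= 0.
Proof.
have /andP[x00 x0w] := hx0; have xw : 0 <= x0 <= w by rewrite !ltW.
rewrite leNgt; apply/negP => up.
pose U t := complex.Re (u t).
have UM t : 0 <= t <= w -> `|U t| <= M by move=> /hM; apply: le_trans; exact: ler_Re.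
pose mm := U x0 / 2; have m0 : 0 < mm by rewrite divr_gt0.
have thx t : 0 < t < w -> 0 < th * t < pi.
  move=> /andP[t0 tw]; rewrite mulr_gt0 ?th0//=.
  by rewrite /th mulrAC ltr_pdivrMr// ltr_pM2l ?pi_gt0.
have thi t : 0 <= t <= w -> th * t \in `[0, pi].
  move=> /andP[t0 tw]; rewrite in_itv /= mulr_ge0 ?(ltW th0)//=.
  by rewrite /th mulrAC ler_pdivrMr// ler_pM2l ?pi_gt0.
have S0 : 0 < sin (th * x0) by apply: sin_gt0_pi; exact: thx.
have sE t : sn w 0 t = sin (th * t) by rewrite /sn /freq mulr1.
pose sg := sin (th * x0) / 2; have sg0 : 0 < sg by rewrite divr_gt0.
have [d1 d10 h1] := cu xw m0.
have wx0 : 0 < w - x0 by rewrite subr_gt0.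
have [d [d0 dd1 dx dw]] := below_three d10 x00 wx0.
have xd1 : 0 <= x0 - d by rewrite subr_ge0 ltW.
have xd2 : x0 + d <= w by rewrite -lerBrDl ltW.
have xd3 : x0 - d < x0 by rewrite ltrBlDr ltrDl.
have xd4 : x0 < x0 + d by rewrite ltrDl.
have Ud t : 0 <= t <= w -> `|t - x0| < d -> mm <= U t.
  move=> tw td; have := h1 t tw (lt_trans td dd1).
  move=> /(le_trans (ler_Re _)); rewrite cReB ler_norml /mm /U => /andP[? _]; lra.
have Clt s t : 0 <= s -> s < t -> t <= w -> C t < C s.
  move=> s0 st tw; rewrite /C ltr_cos ?thi ?s0 ?tw ?(le_trans (ltW st))//.
    by rewrite ltr_pM2l ?th0.
  by rewrite (le_trans s0 (ltW st)).
pose ka := Num.min (C (x0 - d) - c0) (c0 - C (x0 + d)).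
have ka0 : 0 < ka by rewrite lt_min !subr_gt0 !Clt// ltW.
have [kl kr] : ka <= C (x0 - d) - c0 /\ ka <= c0 - C (x0 + d) by rewrite !ge_min !lexx orbT.
have ka2 : ka <= 2.
  have := C_le1 (x0 - d); have := C_le1 x0; rewrite -/c0 !ler_norml; lra.
(* P <= r at distance at least d from x0, where |C t - c0| >= ka, and P >= r' close to x0, where |C
   t - c0| <= ka / 2. The strict gap r < r' is the concentration. *)
pose r := 1 - ka ^+ 2 / 4; pose r' := 1 - ka ^+ 2 / 16.
have r0 : 0 <= r by rewrite /r; nra.
have rr' : r < r' by rewrite /r /r'; nra.
have r'0 : 0 < r' by exact: le_lt_trans rr'.
have far t : 0 <= t <= w -> d <= `|t - x0| -> P t <= r.
  move=> /andP[t0 tw]; rewrite ler_normr => h.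
  apply: parabola_far; [exact: ltW|case/orP: h => h; [left|right]].
    apply: (@le_trans _ _ (C (x0 + d))); last by rewrite lerBrDr -lerBrDl.
    have [->//|ne] := eqVneq t (x0 + d).
    apply/ltW/Clt => //; first by rewrite (le_trans _ (ltW xd4))// ltW.
    by rewrite lt_neqAle eq_sym ne -lerBrDl.
  apply: (@le_trans _ _ (C (x0 - d))); first by rewrite addrC -lerBrDr.
  have [->//|ne] := eqVneq t (x0 - d).
  apply/ltW/Clt => //; last by rewrite (le_trans (ltW xd3))// ltW.
  by rewrite lt_neqAle ne lerBrDr -lerBrDl -opprB.
have ka2' : 0 < ka / 2 by rewrite divr_gt0.
have [d2 d20 h2] := hasd_ccont (hasd_cos w th x0) ka2'.
have [d3 d30 h3] := hasd_ccont (hasd_sin w th x0) sg0.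
have [z [z0 zd zd2 zd3]] := below_three d0 d20 d30.
have near t : 0 <= t <= w -> `|t - x0| <= z -> r' <= P t /\ sg <= sn w 0 t.
  move=> tw tz; have := h2 t tw (le_lt_trans tz zd2); have := h3 t tw (le_lt_trans tz zd3).
  rewrite -!rmorphB !normc_real sE -/(C t) -/(C x0) -/c0 => h hC.
  split; first exact: parabola_near.
  move: h; rewrite ler_norml lerBrDr => /andP[+ _]; apply: le_trans.
  by rewrite addrC lerBrDr /sg -splitr.
have xz1 : 0 <= x0 - z by rewrite subr_ge0 ltW// (lt_trans zd).
have xz3 : x0 + z <= w by rewrite -lerBrDl ltW// (lt_trans zd).
have xz2 : x0 - z <= x0 + z by rewrite lerD2l (le_trans _ (ltW z0))// oppr_le0 ltW.
have [iJ eJ] := @Rintegral_indic_itv (x0 - z) (x0 + z) xz1 xz2 xz3.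
set J := (`[x0 - z, x0 + z]%classic : set R) in iJ eJ.
have s0 t : 0 <= t <= w -> 0 <= sn w 0 t <= 1.
  move=> tw; rewrite sE; apply/andP; split; last exact: sin_le1.
  by apply: sin_ge0_pi; have := thi t tw; rewrite in_itv.
have M0 : 0 <= M by exact: le_trans (normr_ge0 _) (UM x0 xw).
(* Three zones: close to x0 the product is at least mm sg r'^n, between z and d it is nonnegative,
   and beyond d it is at least - M r^n. *)
have lower n t : 0 <= t <= w ->
    mm * sg * r' ^+ n * \1_J t - M * r ^+ n <= U t * (sn w 0 t * P t ^+ n).
  move=> tw; have /andP[s00 s01] := s0 t tw; have /andP[P0 P1] := P_itv t.
  have Mr : 0 <= M * r ^+ n by rewrite mulr_ge0// exprn_ge0.
  have Pn0 : 0 <= P t ^+ n by exact: exprn_ge0.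
  have [tz|tz] := leP `|t - x0| z.
    have [hP hs] := near t tw tz; have hU := Ud t tw (le_lt_trans tz zd).
    apply: (@le_trans _ _ (mm * sg * r' ^+ n)).
      have i1 : \1_J t <= 1 :> R by rewrite indicE lern1 leq_b1.
      have A0 : 0 <= mm * sg * r' ^+ n by rewrite !mulr_ge0 ?exprn_ge0// ltW.
      by rewrite lerBlDr (le_trans (ler_piMr A0 i1))// lerDl.
    rewrite -mulrA ler_pM ?(ltW m0)//.
      by rewrite mulr_ge0 ?exprn_ge0// ltW.
    apply: ler_pM hs _; [exact: ltW|by rewrite exprn_ge0// ltW|].
    by rewrite lerXn2r// nnegrE ltW.
  have -> : \1_J t = 0 :> R.
    rewrite indicE memNset// /J /= in_itv /= => /andP[? ?]; move: tz.
    by rewrite ltNge ler_norml lerBlDl lerBrDl => /negP; apply; apply/andP.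
  rewrite mulr0 sub0r; have [td|td] := ltP `|t - x0| d.
    apply: (@le_trans _ _ 0); first by rewrite oppr_le0.
    by rewrite !mulr_ge0// (le_trans (ltW m0)) ?Ud.
  have : `|U t * (sn w 0 t * P t ^+ n)| <= M * r ^+ n.
    rewrite normrM ler_pM// ?UM// ger0_norm ?mulr_ge0//.
    rewrite -[leRHS]mul1r ler_pM// lerXn2r ?nnegrE//; exact: far.
  by rewrite ler_norml => /andP[].
have key n : mm * sg * r' ^+ n * (2 * z) <= M * r ^+ n * w.
  have := congr1 (@complex.Re R) (moment_zero 0 0 n).
  rewrite [X in X = _ -> _](_ : _ = \int[leb]_(t in `[0, w]) (U t * (sn w 0 t * P t ^+ n))); last first.
    rewrite /cintegral [LHS]/=; apply: eq_Rintegral => t _.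
    by rewrite cReM /= mulr0 subr0 expr0 mulr1.
  rewrite cRe0 => e0; have iJ' := rintZ (mm * sg * r' ^+ n) iJ.
  have ilow := rintB iJ' (rint_cst w (M * r ^+ n)).
  have imom : rintegrable w (fun t => U t * (sn w 0 t * P t ^+ n)).
    have := (integrable_moment 0 0 n).1; congr rintegrable; apply/funext => t.
    by rewrite cReM /= mulr0 subr0 expr0 mulr1.
  have := le_rint ilow imom (lower n).
  rewrite e0 RintegralB; [|exact: measurable_itv|exact: iJ'|exact: rint_cst].
  rewrite RintegralZl; [|exact: measurable_itv|exact: iJ].
  rewrite eJ (Rintegral_cc_cst _ (ltW w0)) subr_le0.
  by rewrite (_ : x0 + z - (x0 - z) = 2 * z)//; ring.
pose e := mm * sg * (2 * z) / (M * w + 1).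
have Mw : 0 < M * w + 1 by rewrite ltr_wpDl// mulr_ge0// ltW.
have e0 : 0 < e by rewrite divr_gt0// !mulr_gt0.
have q0 : 0 <= r / r' by rewrite divr_ge0// ltW.
have q1 : r / r' < 1 by rewrite ltr_pdivrMr// mul1r.
have [n hn] := expr_small q0 q1 e0.
have rn0 : 0 < r' ^+ n by rewrite exprn_gt0.
move: hn; rewrite expr_div_n ltr_pdivrMr// /e mulrAC ltr_pdivlMr//.
have := key n; have : 0 <= r ^+ n by exact: exprn_ge0.
move=> h4 h5; rewrite [ltRHS](_ : _ = mm * sg * r' ^+ n * (2 * z)); last by ring.
move=> h6; have := lt_le_trans h6 h5.
by rewrite mulrDr mulr1 mulrA (mulrC (r ^+ n)) ltNge lerDl h4.
Qed.

End peak.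

(** [peak] is applied to u times the conjugate of u(x), whose real part at x is |u(x)|^2; the end
    points follow by continuity. *)
Lemma sine_complete u c : (forall x, 0 <= x <= w -> ccont w u x) ->
  (forall x, 0 <= x <= w -> normc (u x) <= c) -> (forall j, coef w u j = 0) ->
  forall x, 0 <= x <= w -> u x = 0.
Proof.
move=> cu bu hu.
have nz : (2 / w)%:C != 0 :> R[i].
  by rewrite -normc_eq0 normc_real normr_eq0 mulf_neq0 ?invr_eq0 ?gt_eqF.
have mom j : cintegral w (fun t => u t * (sn w j t)%:C) = 0.
  by have /eqP := hu j; rewrite mulf_eq0 (negbTE nz) => /eqP.
have iu : cintegrable w u by exact: (cint_bounded (ccont_meas w0 cu) bu).
have inner x : 0 < x < w -> u x = 0.
  move=> xw; pose z := (u x)^*.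
  have cz s : 0 <= s <= w -> ccont w (fun t => z * u t) s.
    move=> sw e e0; have z0 : 0 < normc z + 1 by rewrite ltr_wpDl ?normc_ge0.
    have [d d0 hd] := cu s sw _ (divr_gt0 e0 z0); exists d => // t tw td.
    rewrite -mulrBr normcM; have := hd t tw td; rewrite ler_pdivlMr// => h.
    by apply: le_trans h; rewrite mulrC ler_wpM2l ?normc_ge0// lerDl.
  have bz t : 0 <= t <= w -> normc (z * u t) <= normc z * c.
    by move=> /bu h; rewrite normcM ler_wpM2l ?normc_ge0.
  have hz j : cintegral w (fun t => z * u t * (sn w j t)%:C) = 0.
    rewrite -[RHS](mulr0 z) -[in RHS](mom j) -cintegralZ; last exact: cint_sn.
    by congr cintegral; apply/funext => t; rewrite mulrA.
  have := peak cz bz hz xw; rewrite cReM cReJ cImJ mulNr opprK -!expr2 -normc_sqr => h.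
  apply/eqP; rewrite -normc_eq0 -sqrf_eq0 eq_le h sqr_ge0//.
move=> x xw; apply: normc_small => e e0.
have [d d0 hd] := cu x xw _ e0.
have /andP[x0 x1] := xw.
have [t tw td] : exists2 t, 0 < t < w & `|t - x| < d.
  pose s := Num.min d w / 4.
  have m0 : 0 < Num.min d w by rewrite lt_min d0.
  have [md mw] : Num.min d w <= d /\ Num.min d w <= w by rewrite !ge_min !lexx orbT.
  have [xh|xh] := leP x (w / 2).
    exists (x + s); first by rewrite /s; apply/andP; split; lra.
    by rewrite addrAC subrr add0r gtr0_norm /s; lra.
  exists (x - s); first by rewrite /s; apply/andP; split; lra.
  by rewrite addrAC subrr add0r normrN gtr0_norm /s; lra.
have tw' : 0 <= t <= w by move: tw => /andP[? ?]; rewrite !ltW.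
by have := hd t tw' td; rewrite (inner t tw) sub0r normcN.
Qed.

End completeness.

(** * Sobolev functions and the Green function *)

Section sobolev.
Context {R : realType}.
Variable w : R.
Hypothesis w0 : 0 < w.
Notation leb := (@lebesgue_measure R).
Implicit Types (x t c : R) (f g h y u : R -> R[i]) (i j m p : nat).

Lemma in_L2_ae f g : cmeas w f -> ae_eq_on w f g -> in_L2 w g -> in_L2 w f.
Proof.
move=> mf fg gL2; apply/in_L2P; split => //.
have /in_L2P[mg ig] := gL2.
have mf2 := cmeas_normc2 mf; have mg2 := cmeas_normc2 mg.
apply/integrableP; split; first exact/measurable_EFinP.
have /integrableP[_] := ig; apply: le_lt_trans; rewrite le_eqVlt; apply/orP; left; apply/eqP.
apply: ae_eq_integral.
- exact: measurable_itv.
- by apply/measurableT_comp => //; exact/measurable_EFinP.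
- by apply/measurableT_comp => //; exact/measurable_EFinP.
- by rewrite /ae_eq; apply: (aeS fg) => t e /in_cc ht; rewrite /= e// in_itv.
Qed.

Lemma AC_ext f g : (forall t, 0 <= t <= w -> f t = g t) ->
  abs_continuous w f -> abs_continuous w g.
Proof.
move=> fg hf e /hf[d d0 hd]; exists d => // n a b hab tr lt.
apply: le_lt_trans (hd n a b hab tr lt); apply: ler_sum => i _.
have [a0 ab bw] := hab i.
by rewrite !fg// ?a0 ?bw ?(le_trans ab)// (le_trans a0).
Qed.

(** Downward from order p: an absolutely continuous derivative is bounded, so the function it comes
    from is Lipschitz. *)
Lemma sobolev_AC p y : in_Sobolev w p.+1 y ->
  forall i, (i <= p)%N -> abs_continuous w (deriven_on w i y).
Proof.
move=> [hd hA _] i ip; rewrite -(subKn ip); move: (p - i)%N (leq_subr i p) => m.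
elim: m => [|m ih] mp; first by rewrite subn0.
have lt : (p - m.+1 < p)%N by rewrite ltn_subrL /= (leq_trans _ mp).
apply: (hasd_AC w0 ((derivable_hasd w0 _).1 (hd _ lt))).
rewrite -[derive_on _ _]/(deriven_on w (p - m.+1).+1 y) subnSK//.
by apply: AC_bounded => //; apply: ih; exact: ltnW.
Qed.

Lemma sobolev_L2 p y : in_Sobolev w p.+1 y ->
  forall i, (i <= p.+1)%N -> in_L2 w (deriven_on w i y).
Proof.
move=> hy i; rewrite leq_eqVlt => /orP[/eqP->|]; first by case: hy.
move=> /(sobolev_AC hy) h; have [c hc] := AC_bounded w0 h.
exact: (L2_bounded (ccont_meas w0 (AC_ccont h)) hc).
Qed.

Lemma sobolev_hasd p y : in_Sobolev w p.+1 y -> forall i, (i <= p)%N ->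
  {ae leb, forall x, 0 <= x <= w -> hasd w (deriven_on w i y) x (deriven_on w i.+1 y x)}.
Proof.
move=> hy i /(sobolev_AC hy)/(AC_density w0)[g [_ _ h]].
apply: (aeS h) => x hx xw; rewrite -[deriven_on w i.+1 y x]/(derive_on w (deriven_on w i y) x).
by rewrite (hasd_derive w0 xw (hx xw)); exact: hx.
Qed.

(** Two integrations by parts: the first boundary term vanishes with the sine at both ends, the
    second with the boundary values of the function. *)
Lemma coef_second_derivative p y i j : in_Sobolev w p.+1 y -> (i < p)%N ->
  deriven_on w i y 0 = 0 -> deriven_on w i y w = 0 ->
  coef w (deriven_on w i.+2 y) j = - (freq w j ^+ 2)%:C * coef w (deriven_on w i y) j.
Proof.
move=> hy ip y0 yw; set om := freq w j.
have hs x : 0 <= x <= w -> hasd w (fun t => (sn w j t)%:C) x (om * cos (om * x))%:C.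
  by move=> _; exact: hasd_sin.
have hc x : 0 <= x <= w ->
    hasd w (fun t => (om * cos (om * t))%:C) x (- om ^+ 2 * sn w j x)%:C.
  move=> _; have := hasdZ om%:C (hasd_cos w om x).
  rewrite -rmorphM /= mulrN mulrA -expr2 -mulNr.
  rewrite (_ : (fun t => (om * cos (om * t))%:C) = fun t => om%:C * (cos (om * t))%:C)//.
  by apply/funext => t; rewrite rmorphM.
have mc : cmeas w (fun t => (om * cos (om * t))%:C).
  rewrite (_ : (fun _ => _) = fun t => om%:C * (cos (om * t))%:C).
    exact: cmeasZ (cos_meas w0 om).
  by apply/funext => t; rewrite rmorphM.
have ms : cmeas w (fun t => (- om ^+ 2 * sn w j t)%:C).
  rewrite (_ : (fun _ => _) = fun t => (- om ^+ 2)%:C * (sn w j t)%:C).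
    exact: cmeasZ (sn_meas w0 j).
  by apply/funext => t; rewrite rmorphM.
have bc x : 0 <= x <= w -> normc (om * cos (om * x))%:C <= `|om|.
  by move=> _; rewrite normc_real normrM ler_piMr ?cos_max.
have bs x : 0 <= x <= w -> normc (- om ^+ 2 * sn w j x)%:C <= `|- om ^+ 2|.
  by move=> _; rewrite normc_real normrM ler_piMr ?sin_max.
have i2 := L2_cint (sobolev_L2 hy (ip : i.+2 <= p.+1)%N).
have i1 := L2_cint (sobolev_L2 hy (ltnW ip : i.+1 <= p.+1)%N).
have i0 := L2_cint (sobolev_L2 hy (leqW (ltnW ip))).
have E1 := integration_by_parts_AC w0 (sobolev_AC hy ip) i2 (sobolev_hasd hy ip) hs mc bc.
have E2 := integration_by_parts_AC w0 (sobolev_AC hy (ltnW ip)) i1 (sobolev_hasd hy (ltnW ip)) hc ms bs.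
rewrite /coef E1 sn_w// sn_0 !mulr0 subrr sub0r E2 y0 yw !mul0r subrr sub0r opprK.
rewrite mulrCA; congr (_ * _); rewrite -cintegralZ; last exact: cint_sn.
by congr cintegral; apply/funext => t; rewrite mulrCA -rmorphN -rmorphM.
Qed.

Lemma coef_even_derivative k y i j : (0 < k)%N -> D_dir k w y -> (i <= k)%N ->
  coef w (deriven_on w (2 * i) y) j = ((-1) ^+ i * freq w j ^+ (2 * i))%:C * coef w y j.
Proof.
move=> k0 [hy hb]; elim: i => [|i ih] ik; first by rewrite muln0 !expr0 mul1r mul1r.
have [b0 bw] := hb i ik.
have E : (2 * k = (2 * k).-1.+1)%N by rewrite prednK// muln_gt0.
rewrite E in hy; rewrite mulnS add2n (coef_second_derivative _ hy)//.
  rewrite ih ?(ltnW ik)// mulrA -rmorphN -rmorphM /=; congr (_%:C * _).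
  by rewrite !exprS; ring.
by move: ik; lia.
Qed.

(** A certificate for Sobolev membership: the derivatives are given explicitly and matched with the
    iterated [derive_on] by uniqueness on [0, w], at the top order only almost everywhere. *)
Lemma sobolev_chain p (d : nat -> R -> R[i]) h :
  (forall m, (m < p)%N -> forall x, 0 <= x <= w -> hasd w (d m) x (d m.+1 x)) ->
  abs_continuous w (d p) ->
  {ae leb, forall x, 0 <= x <= w -> hasd w (d p) x (h x)} -> in_L2 w h ->
  [/\ in_Sobolev w p.+1 (d 0%N),
      forall m, (m <= p)%N -> forall x, 0 <= x <= w -> deriven_on w m (d 0%N) x = d m x &
      ae_eq_on w (deriven_on w p.+1 (d 0%N)) h].
Proof.
move=> hd hA hh hL2.
have E m : (m <= p)%N -> forall x, 0 <= x <= w -> deriven_on w m (d 0%N) x = d m x.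
  elim: m => [//|m ih] mp x xw; rewrite -[LHS]/(derive_on w (deriven_on w m (d 0%N)) x).
  apply: (hasd_derive w0 xw).
  by apply: hasd_ext xw _ (hd m mp x xw) => t tw; rewrite ih// ltnW.
have A : abs_continuous w (deriven_on w p (d 0%N)).
  by apply: AC_ext hA => t tw; rewrite E.
have ae : ae_eq_on w (deriven_on w p.+1 (d 0%N)) h.
  apply: (ae_eq_onS hh) => x xw hx; rewrite -[LHS]/(derive_on w (deriven_on w p (d 0%N)) x).
  apply: (hasd_derive w0 xw).
  by apply: hasd_ext xw _ (hx xw) => t tw; rewrite E.
split => //; split => //.
  move=> i ip; apply/(derivable_hasd w0) => x xw.
  rewrite -[derive_on _ _ x]/(deriven_on w i.+1 (d 0%N) x) E//.
  by apply: hasd_ext xw _ (hd i ip x xw) => t tw; rewrite E// ltnW.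
by apply: in_L2_ae ae hL2; apply: derive_on_meas => //; exact: AC_ccont.
Qed.

End sobolev.

(** * The inverse of the second derivative with Dirichlet conditions *)

Section green.
Context {R : realType}.
Variable w : R.
Hypothesis w0 : 0 < w.
Notation leb := (@lebesgue_measure R).
Implicit Types (x t c : R) (f g h y u : R -> R[i]) (i j m p : nat).

(* [green g] is the solution of y'' = g, y(0) = y(w) = 0. *)
Definition green_mean g := cintegral w (fun t => cintegral t g) / w%:C.
Definition green_deriv g x := cintegral x g - green_mean g.
Definition green g x := cintegral x (fun t => cintegral t g) - x%:C * green_mean g.

Lemma cintegral_0 g : cintegral 0 g = 0.
Proof.
by rewrite /cintegral /Rintegral set_itv1 !integral_set1.
Qed.

Lemma green_0 g : green g 0 = 0.
Proof. by rewrite /green cintegral_0 mul0r subrr. Qed.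

Lemma green_w g : green g w = 0.
Proof.
rewrite /green /green_mean mulrC divfK ?subrr//.
by rewrite -normc_eq0 normc_real normr_eq0 gt_eqF.
Qed.

Lemma primitive_AC g : cintegrable w g -> abs_continuous w (fun x => cintegral x g).
Proof.
move=> /(cintegral_AC 0); congr abs_continuous; apply/funext => x; exact: subr0.
Qed.

Lemma primitive_int g : cintegrable w g -> cintegrable w (fun x => cintegral x g).
Proof.
move=> ig; have [c hc] := cintegral_bounded ig.
exact: (cint_bounded (ccont_meas w0 (AC_ccont (primitive_AC ig))) hc).
Qed.

Lemma green_hasd g x : cintegrable w g -> 0 <= x <= w -> hasd w (green g) x (green_deriv g x).
Proof.
move=> ig xw; have c1 := AC_ccont (primitive_AC ig) xw.
have h1 := cintegral_hasd xw (primitive_int ig) c1.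
have hid : hasd w (fun t => t%:C) x (1 : R)%:C by apply: hasd_real; exact: is_derive_id.
have := hasdB h1 (hasdM hid (hasd_cst w x (green_mean g))).
by rewrite mulr0 addr0 mul1r.
Qed.

Lemma green_deriv_AC g : cintegrable w g -> abs_continuous w (green_deriv g).
Proof. exact: cintegral_AC. Qed.

Lemma green_deriv_hasd g x : cintegrable w g -> 0 <= x <= w -> ccont w g x ->
  hasd w (green_deriv g) x (g x).
Proof.
move=> ig xw cg; have := hasdB (cintegral_hasd xw ig cg) (hasd_cst w x (green_mean g)).
by rewrite subr0.
Qed.

Lemma green_deriv_hasd_ae g : cintegrable w g ->
  {ae leb, forall x, 0 <= x <= w -> hasd w (green_deriv g) x (g x)}.
Proof.
move=> ig; apply: (aeS (cintegral_hasd_ae w0 ig)) => x hx xw.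
by have := hasdB (hx xw) (hasd_cst w x (green_mean g)); rewrite subr0.
Qed.

Lemma green_ccont g x : cintegrable w g -> 0 <= x <= w -> ccont w (green g) x.
Proof. by move=> ig xw; exact: hasd_ccont (green_hasd ig xw). Qed.

Lemma green_int g : cintegrable w g -> cintegrable w (green g).
Proof.
move=> ig; have hA : abs_continuous w (green g).
  apply: (hasd_AC w0 (fun x xw => green_hasd ig xw)).
  by apply: (AC_bounded w0); exact: green_deriv_AC.
have [c hc] := AC_bounded w0 hA.
exact: (cint_bounded (ccont_meas w0 (AC_ccont hA)) hc).
Qed.

Lemma green_iter k h : (0 < k)%N -> in_L2 w h ->
  exists2 y, D_dir k w y & ae_eq_on w (deriven_on w (2 * k) y) h.
Proof.
move=> k0 hL2; pose u i := iter i green h.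
have iu i : cintegrable w (u i).
  by elim: i => [|i ih]; [exact: L2_cint|exact: green_int].
(* The derivative of order 2 i is [green] iterated k - i times on h, and that of order 2 i + 1 is
   [green_deriv] of the iterate k - i - 1. *)
pose d m := if odd m then green_deriv (u (k - m./2).-1) else u (k - m./2)%N.
have kk : (2 * k = (2 * k).-1.+1)%N by rewrite prednK// muln_gt0.
have op : odd (2 * k).-1 by have := congr1 odd kk; rewrite mul2n odd_double /= => /esym/negbFE.
have hp : (2 * k).-1./2 = k.-1.
  by move: k0 {kk op d}; case: k => // k _; rewrite mulnS /= mul2n uphalf_double.
have dp : d (2 * k).-1 = green_deriv h.
  rewrite /d op hp; congr green_deriv; rewrite (_ : (k - k.-1).-1 = 0%N)//.
  by case: (k) k0 => // n _; rewrite subSn// subnn.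
have [||| |hS hE hae] := @sobolev_chain R w w0 (2 * k).-1 d h.
- move=> m mp x xw; rewrite /d /=.
  have mk : (m./2 < k)%N by move: mp; lia.
  case: ifPn => om /=.
    rewrite uphalf_half om add1n subnS.
    apply: green_deriv_hasd => //.
    (* Below the top order the next function is again a value of [green], hence continuous; h,
       merely in L_2, appears only at the top. *)
    have : (0 < (k - m./2).-1)%N.
      by move: mp om; lia.
    by case: (_.-1) => // n _; apply: green_ccont.
  rewrite uphalf_half (negbTE om) add0n /u.
  have -> : (k - m./2 = (k - m./2).-1.+1)%N by rewrite prednK// subn_gt0.
  exact: green_hasd.
- by rewrite dp; apply: green_deriv_AC; exact: L2_cint.
- by rewrite dp; apply: green_deriv_hasd_ae; exact: L2_cint.
- exact: hL2.
exists (d 0%N); last by rewrite kk.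
split; first by rewrite kk.
move=> i ik; have i2 : (2 * i <= (2 * k).-1)%N by move: ik; lia.
have dE : d (2 * i)%N = green (u (k - i).-1).
  rewrite /d mul2n odd_double doubleK.
  have -> : (k - i = (k - i).-1.+1)%N by rewrite prednK// subn_gt0.
  by [].
by rewrite !hE ?lexx ?(ltW w0)// dE green_0 green_w.
Qed.

End green.

(** * The Dirichlet operator on sine coefficients *)

Lemma sum_inv_sqr {R : realType} N : \sum_(i < N) (i.+1%:R ^+ 2)^-1 <= 2 :> R.
Proof.
(* The bound 2 - 1 / (N + 1) survives induction because 1 / (x + 1)^2 <= 1 / x - 1 / (x + 1). *)
suff : \sum_(i < N.+1) (i.+1%:R ^+ 2)^-1 <= 2 - N.+1%:R^-1 :> R.
  rewrite big_ord_recr /= => h; have : 0 < (N.+1%:R : R)^-1 by rewrite invr_gt0 ltr0n.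
  have : 0 < ((N.+1%:R : R) ^+ 2)^-1 by rewrite invr_gt0 exprn_gt0// ltr0n.
  by move: h; move: (\sum_(i < N) _) (N.+1%:R ^- 2) (N.+1%:R^-1) => s a b; lra.
elim: N => [|N ih]; first by rewrite big_ord1 expr1n invr1; lra.
rewrite big_ord_recr /=; apply: le_trans (lerD ih (lexx _)) _.
have n0 : 0 < N.+1%:R :> R by rewrite ltr0n.
rewrite -[N.+2%:R]natr1; set x : R := N.+1%:R in n0 *.
have -> : x^-1 = (x + 1)^-1 + (x * (x + 1))^-1 by field; apply/andP; split; rewrite gt_eqF// addr_gt0.
have : ((x + 1) ^+ 2)^-1 <= (x * (x + 1))^-1.
  by rewrite lef_pV2 ?posrE ?mulr_gt0 ?exprn_gt0 ?addr_gt0// expr2 ler_pM2r ?addr_gt0// lerDl.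
by move: (x + 1)^-1 (x * (x + 1))^-1 ((x + 1) ^- 2) => a b c; lra.
Qed.

Section bridge.
Context {R : realType}.
Variables (k : nat) (w : R) (q : R -> R[i]).
Hypotheses (k1 : (1 < k)%N) (w0 : 0 < w) (hq : in_L2 w q).
Notation leb := (@lebesgue_measure R).
Implicit Types (f y : R -> R[i]) (v : nat -> R[i]) (l : R[i]) (i j : nat).

Definition diag j : R := freq w j ^+ (2 * k).
Definition potential j i : R[i] := coef w (fun t => q t * (sn w i t)%:C) j.
Definition potential_bound : R := 2 / w * (2 * \int[leb]_(t in `[0, w]) normc (q t)).
Definition diag_bound : R := (pi / w) ^- (2 * k) * 2.

Let iq : cintegrable w q := L2_cint hq.

Lemma freq_gt0 j : 0 < freq w j.
Proof. by rewrite /freq divr_gt0// mulr_gt0 ?pi_gt0. Qed.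

Lemma diag_gt0 j : 0 < diag j.
Proof. by rewrite exprn_gt0 ?freq_gt0. Qed.

Lemma diagE j : diag j = (pi / w) ^+ (2 * k) * j.+1%:R ^+ (2 * k).
Proof. by rewrite /diag /freq -exprMn mulrAC. Qed.

Lemma diag_sum N : \sum_(i < N) (diag i)^-1 <= diag_bound.
Proof.
have p0 : 0 < (pi / w : R) by rewrite divr_gt0 ?pi_gt0.
apply: (@le_trans _ _ ((pi / w) ^- (2 * k) * \sum_(i < N) (i.+1%:R ^+ 2)^-1)).
  rewrite mulr_sumr; apply: ler_sum => i _.
  rewrite diagE invfM ler_pM2l ?invr_gt0 ?exprn_gt0//.
  rewrite lef_pV2 ?posrE ?exprn_gt0// ler_weXn2l ?ler1n//.
  by rewrite leq_pmulr// ltnW.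
by rewrite ler_wpM2l ?invr_ge0 ?exprn_ge0 ?(ltW p0)// sum_inv_sqr.
Qed.

Lemma potentialE j i : potential j i = (2 / w)%:C *
  cintegral w (fun t => q t * (sn w i t)%:C * (sn w j t)%:C).
Proof. by []. Qed.

Lemma potential_sym j i : potential j i = potential i j.
Proof. by rewrite !potentialE; congr (_ * cintegral _ _); apply/funext => t; rewrite mulrAC. Qed.

Lemma potential_le j i : normc (potential j i) <= potential_bound.
Proof.
rewrite potentialE normcM normc_real ger0_norm ?divr_ge0 ?(ltW w0)//.
rewrite ler_pM2l ?divr_gt0//; apply: cintegral_le; [exact: (cint_sn w0 j (cint_sn w0 i iq))|exact: cint_normc|].
move=> t _; rewrite -mulrA normcM ler_piMr ?normc_ge0//.
by rewrite normcM mulr_ile1 ?normc_ge0 ?normc_sin.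
Qed.

Lemma k2 : (2 * k = (2 * k).-1.+1)%N. Proof. by move: k1; lia. Qed.

Lemma dir_sobolev y : D_dir k w y -> in_Sobolev w (2 * k).-1.+1 y.
Proof. by case=> h _; rewrite -k2. Qed.

Lemma dir_AC y : D_dir k w y -> abs_continuous w y.
Proof. by move=> /dir_sobolev/(sobolev_AC w0)/(_ 0%N (leq0n _)). Qed.

Lemma dir_L2 y : D_dir k w y -> in_L2 w y.
Proof. by move=> /dir_sobolev/(sobolev_L2 w0)/(_ 0%N (leq0n _)). Qed.

Lemma dir_top_L2 y : D_dir k w y -> in_L2 w (deriven_on w (2 * k) y).
Proof. by case=> -[]. Qed.

Lemma dir_top_coef y j : D_dir k w y ->
  coef w (deriven_on w (2 * k) y) j = ((-1) ^+ k)%:C * ((diag j)%:C * coef w y j).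
Proof.
move=> hy; rewrite (coef_even_derivative w0 _ (ltnW k1) hy (leqnn k)).
by rewrite rmorphM mulrA.
Qed.

(** Up to sign a_j times the j-th coefficient of y is the j-th coefficient of y^(2k), bounded since
    y^(2k) is in L_2. *)
Lemma dir_inX y : D_dir k w y -> inX diag (coef w y).
Proof.
move=> hy; exists (4 * norm_L2 w (deriven_on w (2 * k) y)) => i.
apply: le_trans (coef_bound w0 i (dir_top_L2 hy)).
rewrite dir_top_coef// !normcM !normc_real normrX normrN1 expr1n mul1r.
by rewrite [`|diag i|]gtr0_norm ?diag_gt0.
Qed.

Lemma inX_series v : inX diag v -> exists c, csummable v c.
Proof. exact: (inX_summable diag_gt0 diag_sum). Qed.

(** Both sides are continuous with the same sine coefficients, so completeness gives equality at
    every point of [0, w]. *)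
Lemma dir_series y : D_dir k w y ->
  forall x, 0 <= x <= w -> y x = sine_series w (coef w y) x.
Proof.
move=> hy; have [c hc] := inX_series (dir_inX hy).
have cy := AC_ccont (dir_AC hy); have [c' hc'] := AC_bounded w0 (dir_AC hy).
have iy := L2_cint (dir_L2 hy).
pose u x := y x - sine_series w (coef w y) x.
have cs x := sine_series_ccont w x hc.
have is_ : cintegrable w (sine_series w (coef w y)).
  by apply: (cint_bounded (sine_series_meas w0 hc)) => t _; exact: sine_series_bound hc.
have cu x : 0 <= x <= w -> ccont w u x.
  move=> xw e e0; have e2 : 0 < e / 2 by rewrite divr_gt0.
  have [d d0 hd] := cy x xw _ e2; have [d' d'0 hd'] := cs x _ e2.
  exists (Num.min d d') => [|t tw]; first by rewrite lt_min d0.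
  rewrite lt_min => /andP[/(hd t tw) h1 /(hd' t tw) h2].
  rewrite (_ : u t - u x = (y t - y x) - (sine_series w (coef w y) t - sine_series w (coef w y) x)).
    by rewrite (le_trans (normcB _ _))// (splitr e) lerD.
  by rewrite /u; ring.
have bu x : 0 <= x <= w -> normc (u x) <= c' + c.
  by move=> xw; rewrite (le_trans (normcB _ _))// lerD ?hc' ?(sine_series_bound w x hc).
have hu j : coef w u j = 0.
  by rewrite /u coefB// (coef_sine_series w0 _ hc) subrr.
by move=> x xw; apply/eqP; rewrite -subr_eq0; apply/eqP; exact: (sine_complete w0 cu bu hu).
Qed.

Lemma L_dir_L2 y : D_dir k w y -> in_L2 w (L_dir k w q y).
Proof.
move=> hy; have [c hc] := AC_bounded w0 (dir_AC hy).
apply: L2B; first by apply: L2Z; exact: dir_top_L2.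
exact: (L2M hq (L2_meas (dir_L2 hy)) hc).
Qed.

Lemma shifted_L2 y l : D_dir k w y -> in_L2 w (shifted (L_dir k w q) l y).
Proof. by move=> hy; apply: L2B; [exact: L_dir_L2|apply: L2Z; exact: dir_L2]. Qed.

Lemma coef_L_dir y j : D_dir k w y ->
  coef w (L_dir k w q y) j = Lseq diag potential (coef w y) j.
Proof.
move=> hy; have [c hc] := inX_series (dir_inX hy).
have itop := L2_cint (dir_top_L2 hy).
have [b hb] := AC_bounded w0 (dir_AC hy).
have iqy : cintegrable w (fun t => q t * y t) by exact: (cintM iq (L2_meas (dir_L2 hy)) hb).
rewrite /L_dir coefB//; last exact: cintZ.
rewrite coefZ// dir_top_coef// mulrA -[(-1) ^+ k](_ : ((-1) ^+ k)%:C = _); last first.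
  by rewrite rmorphXn rmorphN rmorph1.
rewrite -rmorphM /= -exprMn mulrNN mulr1 expr1n mul1r /Lseq; congr (_ - _).
rewrite -(coef_mul_sine_series w0 j iq hc); apply: coef_eq => t tw.
by rewrite (dir_series hy tw).
Qed.

Lemma coef_shifted y l j : D_dir k w y ->
  coef w (shifted (L_dir k w q) l y) j = Lseq diag potential (coef w y) j - l * coef w y j.
Proof.
move=> hy; have i1 := L2_cint (L_dir_L2 hy); have i2 := L2_cint (dir_L2 hy).
by rewrite /shifted coefB// ?coefZ// ?coef_L_dir//; exact: cintZ.
Qed.

(** The sine series y0 of v is not known to have 2 k derivatives, so it only serves to form h = f +
    l y0 + q y0. The Green function solves (-1)^k y^(2k) = h; comparing coefficients shows that y
    has the coefficients v, hence equals y0, and the equation for y follows. *)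
Lemma dir_solve f v l : in_L2 w f -> inX diag v ->
  (forall j, Lseq diag potential v j - l * v j = coef w f j) ->
  exists y, [/\ D_dir k w y, coef w y =1 v & ae_eq_on w (shifted (L_dir k w q) l y) f].
Proof.
move=> fL2 vX hv; have [c hc] := inX_series vX.
pose y0 := sine_series w v.
have my0 := sine_series_meas w0 hc.
have by0 t : normc (y0 t) <= c := sine_series_bound w t hc.
have L0 : in_L2 w y0 by apply: (L2_bounded my0) => t _; exact: by0.
have Lq : in_L2 w (fun t => q t * y0 t) by apply: (L2M hq my0) => t _; exact: by0.
pose h t := f t + l * y0 t + q t * y0 t.
have Lf0 : in_L2 w (fun t => f t + l * y0 t) by apply: L2D => //; exact: L2Z.
have hL2 : in_L2 w h by exact: L2D.
have sgn2 : (-1) ^+ k * (-1) ^+ k = 1 :> R[i].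
  by rewrite -exprMn mulrNN mulr1 expr1n.
have sgnC : (-1) ^+ k = ((-1) ^+ k)%:C :> R[i].
  by rewrite rmorphXn rmorphN rmorph1.
have [y hy hae] := green_iter w0 (ltnW k1) (L2Z ((-1) ^+ k) hL2).
have iy0 := L2_cint L0.
have hcoef j : coef w h j = coef w f j + l * v j + csum (fun i => potential j i * v i).
  rewrite /h coefD ?coefD ?coefZ//; last first.
  - exact: L2_cint.
  - exact: L2_cint.
  - exact: cintZ.
  - exact: L2_cint.
  by rewrite (coef_sine_series w0 j hc) (coef_mul_sine_series w0 j iq hc).
have yv : coef w y =1 v.
  move=> j; have := dir_top_coef j hy.
  rewrite (coef_ae w0 j (L2_meas (dir_top_L2 hy)) (L2_meas (L2Z ((-1) ^+ k) hL2)) hae).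
  rewrite (coefZ w0); last exact: L2_cint.
  rewrite -sgnC => /(congr1 (fun z => (-1) ^+ k * z)); rewrite 2!(mulrA ((-1) ^+ k) ((-1) ^+ k)) sgn2 !mul1r.
  rewrite hcoef -hv /Lseq => e.
  have nz : (diag j)%:C != 0 :> R[i].
    by rewrite -normc_eq0 normc_real normr_eq0 gt_eqF ?diag_gt0.
  by apply: (mulfI nz); rewrite -e; ring.
exists y; split => //.
have E := dir_series hy; rewrite (funext yv) in E.
apply: (ae_eq_onS hae) => t tw; rewrite in_itv => /(_ tw) ht.
by rewrite /shifted /L_dir ht mulrA sgn2 mul1r E// /h -/y0; ring.
Qed.

Lemma norm_L2_le f c : cmeas w f -> 0 <= c ->
  (forall t, 0 <= t <= w -> normc (f t) <= c) -> norm_L2 w f <= c.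
Proof.
move=> mf c0 hc; have /in_L2P[_ i2] := L2_bounded mf hc.
rewrite -[leRHS]ger0_norm// -sqrtr_sqr ler_wsqrtr// /inner_L2 cReM /= mul0r subr0.
rewrite ler_pdivrMl//; apply: le_trans (_ : \int[leb]_(t in `[0, w]) (c ^+ 2) <= _).
  rewrite [leLHS](_ : _ = \int[leb]_(t in `[0, w]) normc (f t) ^+ 2).
    apply: le_rint => //; first exact: rint_cst.
    by move=> t /hc h; rewrite lerXn2r ?nnegrE ?normc_ge0.
  apply: eq_Rintegral => t _; rewrite normc_sqr cReM cReJ cImJ.
  by rewrite mulrN opprK !expr2.
by rewrite (Rintegral_cc_cst _ (ltW w0)) mulrC.
Qed.

Lemma norm_L2_ge0 f : 0 <= norm_L2 w f. Proof. exact: sqrtr_ge0. Qed.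

End bridge.

(** * Gaps of the diagonal and decay of the two row sums *)

Section estimates.
Context {R : realType}.
Variables (k : nat) (w : R) (q : R -> R[i]).
Hypotheses (k1 : (1 < k)%N) (w0 : 0 < w) (hq : in_L2 w q).
Notation leb := (@lebesgue_measure R).
Notation a := (diag k w).
Implicit Types (i j n N : nat).

Lemma sum_inv_dist n N :
  \sum_(i < N) (if (i == n :> nat) then 0 else ((i%:R - n%:R) ^+ 2)^-1) <= 4 :> R.
Proof.
pose F i : R := if i == n then 0 else ((i%:R - n%:R) ^+ 2)^-1.
have F0 i : 0 <= F i by rewrite /F; case: ifP => // _; rewrite invr_ge0 sqr_ge0.
apply: (@le_trans _ _ (\sum_(i < n.+1 + N) F i)).
  rewrite addnC big_split_ord /= lerDl; exact: sumr_ge0.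
rewrite big_split_ord /= big_ord_recr /= {2}/F eqxx addr0.
rewrite (_ : 4 = 2 + 2 :> R); last by ring.
apply: lerD.
  rewrite (reindex_inj rev_ord_inj) /=; apply: le_trans (sum_inv_sqr n).
  apply: ler_sum => i _; rewrite /F ifN_eq; last by have := ltn_ord i; lia.
  by rewrite natrB// (_ : n%:R - i.+1%:R - n%:R = - i.+1%:R :> R) ?sqrrN//; ring.
apply: le_trans (sum_inv_sqr N); apply: ler_sum => i _.
rewrite /F ifN_eq; last by lia.
by rewrite (_ : (n.+1 + i)%:R - n%:R = i.+1%:R)// addSnnS natrD addrAC subrr add0r.
Qed.

Lemma exprB_ge (x y : R) p : 0 <= x -> x <= y -> (y - x) * y ^+ p <= y ^+ p.+1 - x ^+ p.+1.
Proof.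
move=> x0 xy; rewrite mulrBl -exprS lerD2l lerN2 exprS ler_wpM2l// lerXn2r// nnegrE//.
exact: le_trans xy.
Qed.

Lemma dist_expr_ge i n p : `|i%:R - n.+1%:R| * n.+1%:R ^+ p <= `|i%:R ^+ p.+1 - n.+1%:R ^+ p.+1| :> R.
Proof.
have n0 : 0 <= n.+1%:R :> R by exact: ler0n.
have i0 : 0 <= i%:R :> R by exact: ler0n.
have [h|/ltW h] := leP (i%:R : R) n.+1%:R.
  rewrite distrC ger0_norm ?subr_ge0// distrC ger0_norm ?subr_ge0 ?lerXn2r ?nnegrE//.
  exact: exprB_ge.
rewrite ger0_norm ?subr_ge0// ger0_norm ?subr_ge0 ?lerXn2r ?nnegrE//.
apply: le_trans (exprB_ge p n0 h); rewrite ler_wpM2l ?subr_ge0// lerXn2r ?nnegrE//.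
Qed.

(** Compared with [dist_expr_ge], one factor max(i, n + 1) is bounded below by the distance of i to
    n + 1. A power of n is lost, but the reciprocal becomes summable in i without any decay of B. *)
Lemma dist_expr_ge2 i n p :
  (i%:R - n.+1%:R) ^+ 2 * n.+1%:R ^+ p <= `|i%:R ^+ p.+2 - n.+1%:R ^+ p.+2| :> R.
Proof.
have n0 : 0 <= n.+1%:R :> R by exact: ler0n.
have i0 : 0 <= i%:R :> R by exact: ler0n.
have [h|/ltW h] := leP (i%:R : R) n.+1%:R.
  apply: le_trans (dist_expr_ge i n p.+1).
  rewrite -real_normK ?num_real// expr2 -mulrA ler_wpM2l// exprS ler_wpM2r ?exprn_ge0//.
  by rewrite distrC ger0_norm ?subr_ge0//; lra.
rewrite ger0_norm ?subr_ge0 ?lerXn2r ?nnegrE//.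
apply: le_trans (exprB_ge p.+1 n0 h); rewrite expr2 -mulrA ler_wpM2l ?subr_ge0//.
rewrite exprS ler_pM ?subr_ge0 ?exprn_ge0//; first by lra.
by rewrite lerXn2r ?nnegrE.
Qed.

Let A : R := (pi / w) ^+ (2 * k).

Lemma A_gt0 : 0 < A.
Proof. by rewrite exprn_gt0// divr_gt0 ?pi_gt0. Qed.

Lemma diag_dist i n : `|a i - a n| = A * `|i.+1%:R ^+ (2 * k) - n.+1%:R ^+ (2 * k)|.
Proof. by rewrite !diagE -/A -mulrBr normrM (ger0_norm (ltW A_gt0)). Qed.

Lemma diag_mono i j : (i < j)%N -> a i < a j.
Proof.
move=> ij; rewrite !diagE ltr_pM2l ?A_gt0// ltrXn2r ?nnegrE ?ler0n ?ltr_nat//.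
by move: k1; lia.
Qed.

Lemma diag_unbounded (c : R) : exists n, c < a n.
Proof.
exists (Num.bound (`|c| / A)).
have h : `|c| / A < (Num.bound (`|c| / A)).+1%:R.
  apply: (@lt_trans _ _ (Num.bound (`|c| / A))%:R); last by rewrite ltr_nat.
  by apply: archi_boundP; rewrite divr_ge0// ltW// A_gt0.
rewrite diagE -/A; apply: le_lt_trans (ler_norm c) _.
move: h; rewrite ltr_pdivrMr ?A_gt0// mulrC => /lt_le_trans; apply.
rewrite ler_pM2l ?A_gt0//; apply: ler_eXnr; last by rewrite ler1n.
by move: k1; lia.
Qed.

(** 8 = 2 * 4: the 2 undoes the halving in [half_gap] and 4 is the bound of [sum_inv_dist]. The
    exponent is positive because k > 1. *)
Definition gap_bound n : R := 8 / A / n.+1%:R ^+ (2 * k - 2).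

Lemma gap_sum n N :
  \sum_(i < N) (if (i == n :> nat) then 0 else (half_gap a n i)^-1) <= gap_bound n.
Proof.
have n0 : 0 < n.+1%:R ^+ (2 * k - 2) :> R by rewrite exprn_gt0 ?ltr0n.
apply: (@le_trans _ _ (\sum_(i < N) (2 / A / n.+1%:R ^+ (2 * k - 2) *
    (if (i == n :> nat) then 0 else ((i%:R - n%:R) ^+ 2)^-1)))); last first.
  rewrite -mulr_sumr /gap_bound (_ : 8 = 2 * 4); last by ring.
  rewrite (_ : 2 * 4 / A / _ = 2 / A / n.+1%:R ^+ (2 * k - 2) * 4); last by ring.
  by rewrite ler_wpM2l ?divr_ge0 ?(ltW A_gt0) ?(ltW n0)// sum_inv_dist.
apply: ler_sum => i _; case: eqVneq => [_|ni]; first by rewrite mulr0.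
rewrite /half_gap (negbTE ni) diag_dist invf_div.
have -> (x y : R) : 2 / A / x / y = 2 / (A * (y * x)) by rewrite !invfM; ring.
rewrite ler_wpM2l// lef_pV2 ?posrE.
- rewrite ler_pM2l ?A_gt0//.
  have -> : i%:R - n%:R = i.+1%:R - n.+1%:R :> R by rewrite -!natr1; ring.
  apply: le_trans (dist_expr_ge2 i.+1 n (2 * k - 2)) _.
  by rewrite (_ : (2 * k - 2).+2 = 2 * k)%N//; move: k1; lia.
- by rewrite -diag_dist normr_gt0 subr_eq0; case: ltngtP ni => // /diag_mono h _; rewrite ?(lt_eqF h)// gt_eqF.
- apply: mulr_gt0; [exact: A_gt0|apply: mulr_gt0 => //].
  by rewrite lt_neqAle sqr_ge0 andbT eq_sym sqrf_eq0 subr_eq0 eqr_nat.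
Qed.

Definition bessel_bound : R := 2 / w * \int[leb]_(t in `[0, w]) normc (q t) ^+ 2.

Lemma potential_row j N : \sum_(i < N) normc (potential w q j i) ^+ 2 <= bessel_bound.
Proof.
have Lj : in_L2 w (fun t => q t * (sn w j t)%:C).
  by apply: (L2M hq (sn_meas w0 j)) => t _; exact: normc_sin.
under eq_bigr => i _ do rewrite potential_sym//.
apply: le_trans (bessel w0 N Lj) _; rewrite ler_pM2l ?divr_gt0//.
have /in_L2P[_ i1] := Lj; have /in_L2P[_ i2] := hq.
apply: le_rint => // t _; rewrite normcM exprMn ler_piMr ?sqr_ge0//.
by rewrite exprn_ile1 ?normc_ge0 ?normc_sin.
Qed.

Definition eps_bound n : R := (bessel_bound + 4) / A / n.+1%:R ^+ (2 * k - 1).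

(** With b = |B_ji| and e = |i - n| one has 2 b / e <= b^2 + 1 / e^2: Bessel's inequality bounds the
    first sum and inverse squares the second, while the full factor of order n^(2k-1) of the gap is
    kept. *)
Lemma eps_sum n j N :
  \sum_(i < N) (if (i == n :> nat) then 0 else normc (potential w q j i) / half_gap a n i)
    <= eps_bound n.
Proof.
have n0 : 0 < n.+1%:R ^+ (2 * k - 1) :> R by rewrite exprn_gt0 ?ltr0n.
pose s i : R := if (i == n :> nat) then 0 else ((i%:R - n%:R) ^+ 2)^-1.
apply: (@le_trans _ _ (\sum_(i < N) ((A * n.+1%:R ^+ (2 * k - 1))^-1 *
    (normc (potential w q j i) ^+ 2 + s i)))); last first.
  rewrite -mulr_sumr big_split /= /eps_bound -mulrA -invfM mulrC.
  rewrite ler_wpM2r ?invr_ge0 ?mulr_ge0 ?(ltW A_gt0) ?(ltW n0)//.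
  by rewrite lerD ?potential_row// sum_inv_dist.
apply: ler_sum => i _; rewrite /s; case: eqVneq => [_|ni].
  by rewrite mulr_ge0 ?invr_ge0 ?addr0 ?sqr_ge0// mulr_ge0 ?(ltW A_gt0) ?(ltW n0).
rewrite /half_gap (negbTE ni) diag_dist; set b := normc _.
have b0 : 0 <= b by exact: normc_ge0.
have dE : i.+1%:R - n.+1%:R = i%:R - n%:R :> R by rewrite -!natr1; ring.
set d : R := i%:R - n%:R in dE *.
have d0 : 0 < `|d| by rewrite normr_gt0 subr_eq0 eqr_nat.
have h := dist_expr_ge i.+1 n (2 * k - 1).
rewrite (_ : (2 * k - 1).+1 = 2 * k)%N in h; last by move: k1; lia.
rewrite dE in h; set X : R := `|_ ^+ _ - _| in h *.
have X0 : 0 < X by apply: lt_le_trans h; rewrite mulr_gt0.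
have A0 := A_gt0.
have An : 0 < A * n.+1%:R ^+ (2 * k - 1) by rewrite mulr_gt0.
rewrite -(real_normK (num_real d)); set e := `|d| in d0 h *.
apply: (@le_trans _ _ (b * (2 / (A * (e * n.+1%:R ^+ (2 * k - 1)))))).
  rewrite ler_wpM2l// invf_div ler_wpM2l// lef_pV2 ?posrE ?mulr_gt0//.
  by rewrite ler_pM2l.
rewrite (_ : b * _ = (A * n.+1%:R ^+ (2 * k - 1))^-1 * (2 * b / e)); last first.
  by field; rewrite !gt_eqF.
rewrite ler_wpM2l ?invr_ge0 ?(ltW An)//.
have : 0 <= (b - e^-1) ^+ 2 by exact: sqr_ge0.
by rewrite sqrrB exprVn mulr2n; lra.
Qed.

Lemma gap_small (M : R) : 0 <= M -> exists2 m : nat, (0 < m)%N &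
  forall n, (m <= n.+1)%N -> M * gap_bound n <= 1 / 4.
Proof.
(* 32 = 8 * 4, from the 8 of [gap_bound] and the required 1 / 4. *)
move=> M0; exists (Num.bound (32 * M / A)).+1 => // n mn.
have A0 := A_gt0.
have n0 : 0 < n.+1%:R ^+ (2 * k - 2) :> R by rewrite exprn_gt0 ?ltr0n.
rewrite /gap_bound mulrA ler_pdivrMr// mulrA.
have h : 32 * M / A <= n.+1%:R ^+ (2 * k - 2).
  apply: (@le_trans _ _ n.+1%:R).
    apply: (@le_trans _ _ (Num.bound (32 * M / A))%:R); last by rewrite ler_nat ltnW.
    by apply/ltW/archi_boundP; rewrite divr_ge0 ?(ltW A0)// mulr_ge0.
  by apply: ler_eXnr; [move: k1; lia|rewrite ler1n].
have -> : M * 8 / A = 1 / 4 * (32 * M / A) by field; rewrite gt_eqF.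
by rewrite ler_wpM2l.
Qed.

End estimates.

(** A family of distinct elements of maximal length exhausts F; the point of F serves as the default
    entry of the empty family. *)
Lemma finite_family (T : choiceType) (F : set T) n :
  (forall p (mu : nat -> T), (forall i, (i < p)%N -> F (mu i)) ->
     (forall i j, (i < p)%N -> (j < p)%N -> mu i = mu j -> i = j) -> (p <= n)%N) ->
  F !=set0 ->
  exists p (mu : nat -> T), (p <= n)%N /\ F = [set mu i | i in `I_p].
Proof.
move=> h [x0 Fx0].
pose P p := `[< exists mu : nat -> T, (forall i, (i < p)%N -> F (mu i)) /\
     (forall i j, (i < p)%N -> (j < p)%N -> mu i = mu j -> i = j) >].
have P0 : exists p, P p by exists 0%N; apply/asboolP; exists (fun=> x0).
have Pn p : P p -> (p <= n)%N by move=> /asboolP[mu [h1 h2]]; exact: h h1 h2.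
case: (ex_maxnP P0 Pn) => p /[dup] /Pn pn /asboolP[mu [h1 h2]] hmax.
exists p, mu; split => //; apply/seteqP; split=> [x Fx|_ [i ip <-]]; last exact: h1.
apply: contrapT => hx; have : P p.+1.
  apply/asboolP; exists (fun i => if i == p then x else mu i); split=> [i|i j].
    by case: eqVneq => // ip; rewrite ltnS leq_eqVlt (negbTE ip) => /h1.
  rewrite !ltnS; case: eqVneq => [->|ni]; case: eqVneq => [->|nj] //.
  - move=> _; rewrite leq_eqVlt (negbTE nj) /= => jp e; exfalso; apply: hx.
    by exists j.
  - rewrite leq_eqVlt (negbTE ni) /= => ip _ e; exfalso; apply: hx.
    by exists i.
  - rewrite leq_eqVlt (negbTE ni) /= => ip.
    by rewrite leq_eqVlt (negbTE nj) /= => jp; exact: h2.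
by move=> /hmax; rewrite ltnn.
Qed.

(** * Transfer from sequences to functions; discreteness of the spectrum *)

Section spectrum.
Context {R : realType}.
Variables (k : nat) (w : R) (q : R -> R[i]).
Hypotheses (k1 : (1 < k)%N) (w0 : 0 < w) (hq : in_L2 w q).
Notation a := (diag k w).
Notation B := (potential w q).
Notation Mq := (potential_bound w q).
Notation D := (D_dir k w).
Notation T := (L_dir k w q).
Implicit Types (f y : R -> R[i]) (v : nat -> R[i]) (l : R[i]) (i j p n : nat).

Let a0 := diag_gt0 k w0.
Let sa := diag_sum k1 w0.
Let hB := potential_le w0 hq.

Lemma coef_zero f j : cmeas w f -> ae_eq_on w f (fun=> 0) -> coef w f j = 0.
Proof.
move=> mf h; rewrite (coef_ae w0 j mf (cmeas_cst w 0) h).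
rewrite -[RHS](mulr0 ((2 / w)%:C)); congr (_ * _).
by rewrite -[RHS](mul0r (cintegral w (fun=> 0))) -cintegralZ; [congr cintegral; apply/funext => t; rewrite !mul0r|exact: cint_cst].
Qed.

Lemma dir_ae0 y : D y -> (forall j, coef w y j = 0) -> ae_eq_on w y (fun=> 0).
Proof.
move=> hy h; apply: eq_on_ae => t tw; rewrite (dir_series k1 w0 hy tw) /sine_series.
by rewrite -[RHS]csum0; congr csum; apply/funext => j; rewrite h mul0r.
Qed.

Lemma Lseq_zero l j : Lseq a B (fun=> 0) j - l * 0 = 0.
Proof.
rewrite /Lseq !mulr0 subr0 sub0r -[RHS]oppr0; congr (- _).
by rewrite -[RHS]csum0; congr csum; apply/funext => i; rewrite mulr0.
Qed.

Lemma L2_zero : in_L2 w (fun=> 0 : R[i]).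
Proof. by apply: (@L2_bounded _ _ _ 0) => [|t _]; [exact: cmeas_cst|rewrite normc0]. Qed.

Lemma norm_L2_ae f g : cmeas w f -> cmeas w g -> ae_eq_on w f g -> norm_L2 w f = norm_L2 w g.
Proof.
move=> mf mg fg; rewrite /norm_L2 /inner_L2; congr (Num.sqrt (complex.Re (_ * _))).
have mJ h : cmeas w h -> cmeas w (fun t => (h t)^*).
  move=> [hr hi]; split.
    by apply: (eq_measurable_fun (fun t => complex.Re (h t))) => // t _; rewrite cReJ.
  apply: (eq_measurable_fun (fun t => - complex.Im (h t))) => [t _|]; first by rewrite cImJ.
  by apply: measurableT_comp.
apply: ae_eq_cintegral; [by apply: cmeasM => //; exact: mJ..|].
by apply: (ae_eq_onS fg) => t tw h; rewrite h// in_itv.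
Qed.

Lemma iseig_dir l v : eigseq a B l v -> exists y,
  [/\ D y, coef w y =1 v & ae_eq_on w (shifted T l y) (fun=> 0)].
Proof.
move=> [vX hv]; apply: (dir_solve k1 w0 hq L2_zero vX) => j.
by rewrite hv subrr coef_zero//; exact: eq_on_ae.
Qed.

Lemma eigenvalueE l : eigenvalue w D T l <-> iseig a B l.
Proof.
split=> [[y [hy ny ey]]|[v hv [j nj]]].
  exists (coef w y); last first.
    apply: contrapT => h; apply: ny; apply: dir_ae0 => // j.
    by apply: contrapT => hj; apply: h; exists j; apply/eqP.
  split; first exact: dir_inX.
  move=> j; rewrite -(coef_L_dir k1 w0 hq j hy) -(coefZ w0 _ _ (L2_cint (dir_L2 k1 w0 hy))).
  by apply: coef_ae ey; [exact: w0|apply: L2_meas; exact: L_dir_L2|apply: cmeasZ; exact: L2_meas (dir_L2 k1 w0 hy)].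
have [y [hy yv ey]] := iseig_dir hv; exists y; split => //.
  move=> h; move/eqP: nj; apply; rewrite -yv; apply: coef_zero => //.
  exact: L2_meas (dir_L2 k1 w0 hy).
by apply: (ae_eq_onS ey) => t tw; rewrite in_itv => /(_ tw) /eqP; rewrite subr_eq0 => /eqP.
Qed.

Lemma seq_unique l v v' : ~ iseig a B l -> inX a v -> inX a v' ->
  (forall j, Lseq a B v j - l * v j = Lseq a B v' j - l * v' j) -> v =1 v'.
Proof.
move=> nl vX v'X h j; apply: contrapT => ne; apply: nl.
have v'N : inX a (fun i => -1 * v' i) by exact: inXZ.
exists (fun i => v i + -1 * v' i).
  split; first exact: inXD.
  move=> i; rewrite (LseqD a0 sa hB)// (LseqZ a0 sa hB)//.
  apply/eqP; rewrite -subr_eq0; apply/eqP; have := h i; move=> /eqP; rewrite -subr_eq0 => /eqP <-.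
  by ring.
by exists j; rewrite mulN1r subr_eq0; apply/eqP.
Qed.

(** An eigensequence lifts to a function with zero image, contradicting the bounded inverse.
    Otherwise the Fredholm solution is lifted by [dir_solve], and uniqueness of its coefficients
    gives uniqueness of the function. *)
Lemma resolventE l : resolvent_set w D T l <-> ~ iseig a B l.
Proof.
split=> [[_ [C hC]] [v hv [j nj]]|nl].
  have [y [hy yv ey]] := iseig_dir hv.
  have ms := L2_meas (shifted_L2 k1 w0 hq l hy).
  have n0 : norm_L2 w (shifted T l y) <= 0.
    rewrite (norm_L2_ae ms (cmeas_cst w 0) ey).
    by apply: (norm_L2_le w0); [exact: cmeas_cst|exact: lexx|move=> t _; rewrite normc0].
  have ns : norm_L2 w (shifted T l y) = 0 by apply/eqP; rewrite eq_le n0 norm_L2_ge0.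
  have := hC y hy; rewrite ns mulr0 => ny.
  have := coef_bound w0 j (dir_L2 k1 w0 hy); rewrite yv => /le_trans.
  move=> /(_ 0); rewrite pmulr_rle0// => /(_ ny); rewrite le_eqVlt ltNge normc_ge0 orbF.
  by rewrite normc_eq0; move: nj => /negbTE ->.
have [C C0 hC] := seq_fredholm a0 sa hB nl.
have bnd f : in_L2 w f -> bounded (coef w f) (4 * norm_L2 w f).
  by move=> fL2 j; exact: coef_bound.
split=> [f fL2|].
  have [v hv1 hv2] := hC _ _ (bnd f fL2).
  have vX : inX a v by exists (C * (4 * norm_L2 w f)).
  have [y [hy yv ey]] := dir_solve k1 w0 hq fL2 vX hv2.
  exists y; split => // z hz ez; apply: eq_on_ae => t tw.
  rewrite (dir_series k1 w0 hy tw) (dir_series k1 w0 hz tw).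
  suff -> : coef w z = coef w y by [].
  apply/funext; apply: (seq_unique nl); [exact: dir_inX|exact: dir_inX|] => j.
  rewrite -[LHS](coef_shifted k1 w0 hq l j hz) -[RHS](coef_shifted k1 w0 hq l j hy).
  apply: coef_ae; [exact: w0|exact: L2_meas (shifted_L2 k1 w0 hq l hz)|exact: L2_meas (shifted_L2 k1 w0 hq l hy)|].
  by apply: ae_eq_on_trans ez _; exact: ae_eq_on_sym.
(* 4 bounds sine coefficients by the norm, C is the Fredholm constant and [diag_bound] bounds the
   sums of 1 / a_j; the norm of y is at most the resulting uniform bound of its sine series. *)
exists (diag_bound k w * (C * 4)) => y hy; have yL2 := dir_L2 k1 w0 hy.
have sL2 := shifted_L2 k1 w0 hq l hy; set N := norm_L2 w (shifted T l y).
have [v hv1 hv2] := hC _ _ (bnd _ sL2).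
have vX : inX a v by exists (C * (4 * N)).
have yv : coef w y =1 v.
  apply: (seq_unique nl) => // [|j]; first exact: dir_inX.
  by rewrite hv2 coef_shifted.
have N0 : 0 <= N by exact: norm_L2_ge0.
have CN : 0 <= C * 4 * N by rewrite !mulr_ge0.
have hs : csummable (coef w y) (diag_bound k w * (C * 4 * N)).
  apply: (@csummable_dom _ _ (fun i => (a i)^-1 * (C * 4 * N))) => [i|n].
    by rewrite yv ler_pdivlMl ?a0// -mulrA hv1.
  by rewrite -mulr_suml ler_wpM2r.
rewrite -mulrA; apply: (norm_L2_le w0); first exact: L2_meas.
  by rewrite mulr_ge0// (csummable_ge0 (_ : csummable (fun=> 0) _))// => n; rewrite big1 ?normc0// (le_trans _ (sa 0))// big_ord0.
by move=> t tw; rewrite (dir_series k1 w0 hy tw); exact: sine_series_bound hs.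
Qed.

Lemma spectrumE : spectrum w D T = [set l | iseig a B l].
Proof.
apply/seteqP; split=> l /=; rewrite /spectrum /setC /=.
  by move=> h; apply: contrapT => nl; apply: h; apply/resolventE.
by move=> h /resolventE.
Qed.

Section with_index.
Variable m : nat.
Hypotheses (m0 : (0 < m)%N) (hm : forall n, (m <= n.+1)%N -> Mq * gap_bound k w n <= 1 / 4).

Let amono := diag_mono k1 w0.
Let aunb := diag_unbounded k1 w0.
Let hgap := gap_sum k1 w0.

Lemma eig_family (F : set R[i]) n : (m <= n)%N ->
  (forall l, F l -> iseig a B l /\ complex.Re l < midpoint a n) ->
  exists p (mu : nat -> R[i]), (p <= n)%N /\ F = [set mu i | i in `I_p].
Proof.
move=> mn hF; have [->|/set0P F0] := eqVneq F set0.
  by exists 0%N, (fun=> 0); split => //; rewrite II0 image_set0.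
apply: finite_family F0 => p mu h1 h2.
by apply: (halfplane_count a0 sa hB amono m0 hgap hm mn) h2 => i /h1 /hF[].
Qed.

Lemma eig_isolated l : exists2 d, 0 < d &
  forall mu, iseig a B mu -> normc (mu - l) < d -> mu = l.
Proof.
(* The added 1 puts the unit disc around l into a half-plane with finitely many eigenvalues. *)
have [n mn hn] := midpoint_unbounded amono aunb m0 (complex.Re l + 1).
pose F := [set mu | [/\ iseig a B mu, complex.Re mu < midpoint a n & mu != l]].
have [p [mu [_ FE]]] := @eig_family F n mn (fun mu '(And3 h1 h2 _) => conj h1 h2).
have [d d0 hd] : exists2 d : R, 0 < d & forall i, (i < p)%N -> d <= normc (mu i - l).
  have hp i : (i < p)%N -> 0 < normc (mu i - l).
    move=> ip; have : F (mu i) by rewrite FE; exists i.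
    by case=> _ _; rewrite -subr_eq0 => /normc_gt0.
  elim: p {FE} hp => [|p ih] hp; first by exists 1.
  have [d d0 hd] := ih (fun i ip => hp i (leqW ip)).
  exists (Num.min d (normc (mu p - l))); first by rewrite lt_min d0 hp.
  move=> i; rewrite ltnS leq_eqVlt => /orP[/eqP->|/hd h]; first by rewrite ge_min lexx orbT.
  by rewrite ge_min h.
exists (Num.min d 1) => [|nu hnu]; first by rewrite lt_min d0 ltr01.
rewrite lt_min => /andP[nd n1]; apply: contrapT => ne.
have : F nu.
  split => //; last exact/eqP.
  apply: lt_trans hn; rewrite -ltrBlDl; apply: le_lt_trans n1.
  by rewrite -cReB (le_trans (ler_norm _))// ler_Re.
by rewrite FE => -[i ip ei]; have := hd i ip; rewrite ei leNgt nd.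
Qed.

Lemma root_vector_chain l y : root_vector w D T l y ->
  ae_eq_on w y (fun=> 0) \/
  (D y /\ exists p z, chain a B l p z /\ forall j, coef w y j = z 0%N j).
Proof.
move=> [p [z [<- zp hz]]]; case: p zp hz => [|p] zp hz; first by left.
right; split; first by have [] := hz 0%N isT.
(* From index p + 1 on the functions are no longer known to lie in the domain, and the first of them
   vanishes almost everywhere; their coefficients are replaced by 0. *)
pose c i := if (i < p.+1)%N then coef w (z i) else fun=> 0.
exists p.+1, c; split; last by [].
split=> [i|i j|i j pi].
- rewrite /c; case: ltnP => ip; first by apply: dir_inX => //; have [] := hz i ip.
  by exists 0 => j; rewrite normc0 mulr0.
- rewrite /c; have [ip|ip] := ltnP i p.+1; last first.
    by rewrite ltnNge (leq_trans ip (leqnSn i)) /= Lseq_zero.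
  have [Di ei] := hz i ip; rewrite -(coef_shifted k1 w0 hq l j Di).
  have ms := L2_meas (shifted_L2 k1 w0 hq l Di).
  case: ltnP => ip1.
    have [Di1 _] := hz i.+1 ip1; apply: coef_ae ei => //.
    exact: L2_meas (dir_L2 k1 w0 Di1).
  apply: coef_zero => //; apply: ae_eq_on_trans ei _.
  by rewrite (_ : i.+1 = p.+1)//; apply/eqP; rewrite eqn_leq ip1 ip.
- by rewrite /c ltnNge pi.
Qed.

Lemma chain_combo l p p' z z' (c : R[i]) : chain a B l p z -> chain a B l p' z' ->
  chain a B l (maxn p p') (fun i j => z i j - c * z' i j).
Proof.
move=> [h1 h2 h3] [h1' h2' h3'].
have E i j : z i j - c * z' i j = z i j + (- c) * z' i j by rewrite mulNr.
have X i : inX a (fun j => z i j - c * z' i j).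
  rewrite (_ : (fun j => _) = fun j => z i j + (- c) * z' i j); last exact/funext.
  by apply: inXD => //; exact: inXZ.
split=> [//|i j|i j]; last first.
  by rewrite geq_max => /andP[pi p'i]; rewrite h3// h3'// mulr0 subr0.
rewrite (_ : (fun j => _) = fun j => z i j + (- c) * z' i j); last exact/funext.
rewrite (LseqD a0 sa hB)//; last exact: inXZ.
by rewrite (LseqZ a0 sa hB)// -h2 -h2'; ring.
Qed.

(** Right of Re l there is a cut [midpoint n]; the initial terms of the chains at l form a space on
    which the first n coordinates are injective, so finitely many of them span it. *)
Lemma dir_finite_alg_mult l : finite_alg_mult w D T l.
Proof.
have [n mn hn] := midpoint_unbounded amono aunb m0 (complex.Re l).
pose W := [set v | exists p z, chain a B l p z /\ v = z 0%N].
have [d [e [We hW]]] : exists (d : nat) (e : 'I_d -> nat -> R[i]), (forall i : 'I_d, W (e i)) /\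
    forall x, W x -> exists co : 'I_d -> R[i], forall j, x j = \sum_(i < d) co i * e i j.
  apply: (@finite_span _ n W W) => // [x y z [p [c [hc ->]]] [p' [c' [hc' ->]]]|x [p [c [hc ->]]]].
    by exists (maxn p p'), (fun i j => c i j - z * c' i j); split => //; exact: chain_combo.
  exact: (halfplane_chain_inj a0 sa hB amono m0 hgap hm mn hn hc).
exists d, (fun i : 'I_d => sine_series w (e i)) => y /root_vector_chain[h|[hy [p [z [hc yz]]]]].
  exists (fun=> 0); apply: ae_eq_on_trans h _; apply: eq_on_ae => t _.
  by rewrite big1// => i _; rewrite mul0r.
have [co hco] : exists co : 'I_d -> R[i], forall j, coef w y j = \sum_(i < d) co i * e i j.
  have [|co hco] := hW (z 0%N); first by exists p, z.
  by exists co => j; rewrite yz.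
exists co; apply: eq_on_ae => t tw; rewrite (dir_series k1 w0 hy tw) /sine_series.
have es (i : 'I_d) : exists c, csummable (e i) c.
  by have [p' [z' [[h _ _] ->]]] := We i; exact: (inX_series k1 w0 (h 0%N)).
have es' (i : 'I_d) : exists c, csummable (fun j => co i * (e i j * (sn w j t)%:C)) c.
  have [c hc'] := es i; exists (normc (co i) * c); apply: csummableZ.
  exact: sine_summable.
rewrite (_ : (fun j => _) = fun j => \sum_(i < d) co i * (e i j * (sn w j t)%:C)).
  rewrite csum_sum//; apply: eq_bigr => i _; have [c hc'] := es i.
  by rewrite (csumZ _ (sine_summable w t hc')).
by apply/funext => j; rewrite hco mulr_suml; apply: eq_bigr => i _; rewrite mulrA.
Qed.

Lemma ball_nbhs (l : R[i]^o) d : 0 < d -> nbhs l [set z : R[i]^o | normc (z - l) < d].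
Proof.
move=> d0; have : (fun z : R[i] => z) x @[x --> (l : R[i]^o)] --> (l : R[i]^o) by exact: cvg_id.
by move=> /cvg_normcP/(_ d d0).
Qed.

Lemma dir_discrete : discrete_spectrum w D T.
Proof.
split.
  apply/seteqP; split=> // l hl; have [d d0 hd] := eig_isolated l.
  have [mu [ne]] := hl _ (ball_nbhs l d0).
  by rewrite spectrumE /= => hmu /hd => /(_ hmu) e; rewrite e eqxx in ne.
move=> l hl; have el : iseig a B l by move: hl; rewrite spectrumE.
split; [|exact/eigenvalueE|exact: dir_finite_alg_mult].
split; first exact: mem_set.
have [d d0 hd] := eig_isolated l; exists [set z | normc (z - l) < d]; first exact: ball_nbhs.
rewrite spectrumE; apply/seteqP; split=> [z [/= zd zE]|_ ->]; first exact: hd.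
by split => //=; rewrite subrr normc0.
Qed.

End with_index.
End spectrum.

(** * The asymptotic formula *)

Section asymptotics.
Context {R : realType}.
Variables (k : nat) (w : R) (q : R -> R[i]).
Hypotheses (k1 : (1 < k)%N) (w0 : 0 < w) (hq : in_L2 w q).
Notation a := (diag k w).
Notation B := (potential w q).
Implicit Types (i j n : nat).

Lemma potential_cos i j : (i <= j)%N -> B j i =
  ((Num.sqrt 2)^-1)%:C * (cos_coef w q (j - i) - cos_coef w q (i + j).+2).
Proof.
move=> ij; have iq := L2_cint hq.
pose c n := cintegral w (fun t => q t * (cos (pi * n%:R * t / w))%:C).
have ic n : cintegrable w (fun t => q t * (cos (pi * n%:R * t / w))%:C).
  have := cint_cos w0 (pi * n%:R / w) iq; congr cintegrable.
  by apply/funext => t; congr (_ * (cos _)%:C); ring.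
have s2 : Num.sqrt 2 != 0 :> R by rewrite gt_eqF// sqrtr_gt0.
have -> : ((Num.sqrt 2)^-1)%:C * (cos_coef w q (j - i) - cos_coef w q (i + j).+2) =
    (w^-1)%:C * (c (j - i)%N - c (i + j).+2) :> R[i].
  rewrite /cos_coef -mulrBr mulrA -rmorphM /=; congr (_%:C * _).
  by rewrite mulrA mulVf// mul1r.
rewrite potentialE /c -cintegralB//.
rewrite (_ : (fun t => q t * (sn w i t)%:C * (sn w j t)%:C) =
   fun t => (2^-1)%:C * (q t * (cos (pi * (j - i)%:R * t / w))%:C -
                         q t * (cos (pi * (i + j).+2%:R * t / w))%:C)); last first.
  apply/funext => t; rewrite -mulrA -rmorphM sn_mul// -mulrBr mulrCA -rmorphB -rmorphM /=.
  congr (_ * _%:C); rewrite mulrC; congr (_ * (cos _ - cos _)); ring.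
rewrite cintegralZ; last exact: cintB.
rewrite mulrA -rmorphM /=; congr (_%:C * _); field.
by rewrite gt_eqF.
Qed.

Lemma potential_diag n : B n n = (w^-1)%:C * cintegral w q -
  (w^-1)%:C * cintegral w (fun t => q t * (cos (2 * pi * n.+1%:R / w * t))%:C).
Proof.
have iq := L2_cint hq; have ic := cint_cos w0 (2 * pi * n.+1%:R / w) iq.
rewrite -mulrBr -cintegralB// potentialE.
rewrite (_ : (fun t => q t * (sn w n t)%:C * (sn w n t)%:C) =
   fun t => (2^-1)%:C * (q t - q t * (cos (2 * pi * n.+1%:R / w * t))%:C)); last first.
  apply/funext => t; rewrite -mulrA -rmorphM sn_mul// subnn mulr0 mul0r mul0r cos0.
  have -> : pi * (n + n).+2%:R / w * t = 2 * pi * n.+1%:R / w * t.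
    by rewrite addnn -doubleS -mul2n natrM; ring.
  by rewrite rmorphM rmorphB rmorph1 /=; ring.
rewrite cintegralZ; last exact: cintB.
rewrite mulrA -rmorphM /=; congr (_%:C * _); field.
by rewrite gt_eqF.
Qed.

Lemma potential_sqr n i : B n i * B i n =
  (2^-1)%:C * (cos_coef w q `|n.+1 - i.+1|%N - cos_coef w q (n.+1 + i.+1)) ^+ 2.
Proof.
have s2 : ((Num.sqrt 2)^-1)%:C * ((Num.sqrt 2)^-1)%:C = (2^-1)%:C :> R[i].
  by rewrite -rmorphM /= -invfM -expr2 sqr_sqrtr.
have key u v : (u <= v)%N -> B v u * B v u =
    (2^-1)%:C * (cos_coef w q `|v.+1 - u.+1|%N - cos_coef w q (v.+1 + u.+1)) ^+ 2.
  move=> uv; rewrite potential_cos// mulrACA s2 expr2.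
  by rewrite distnEl// subSS addSn addnS (addnC v).
have [ni|/ltnW ni] := leqP i n.
  by rewrite (potential_sym w q i) key.
by rewrite (potential_sym w q n) key// distnC addnC.
Qed.

Lemma off_diagonal_summable n : exists c,
  csummable (fun i => if i == n then 0 else B n i * B i n / ((a i)%:C - (a n)%:C)) c.
Proof.
have M0 : 0 <= potential_bound w q.
  by apply: le_trans (potential_le w0 hq 0 0); exact: normc_ge0.
exists (potential_bound w q ^+ 2 * gap_bound k w n).
apply: (@csummable_dom _ _ (fun i => potential_bound w q ^+ 2 *
   (if i == n then 0 else (half_gap a n i)^-1))) => [i|N]; last first.
  by rewrite -mulr_sumr ler_wpM2l ?sqr_ge0// gap_sum.
case: eqVneq => [_|ni]; first by rewrite normc0 mulr0.
rewrite normcf normcM -rmorphB normc_real /half_gap (negbTE ni) invf_div.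
have d0 : 0 < `|a i - a n|.
  by rewrite normr_gt0 subr_eq0; case: ltngtP ni => // /(diag_mono k1 w0) h _; rewrite ?(lt_eqF h)// gt_eqF.
rewrite ler_pM ?mulr_ge0 ?normc_ge0 ?invr_ge0//.
  by rewrite expr2 ler_pM ?normc_ge0 ?potential_le.
by rewrite ler_peMl ?invr_ge0 ?(ltW d0)//; lra.
Qed.

(** The constant is c = 1 / (2 (pi / w)^(2k)): the 1 / 2 comes from [potential_sqr], the rest from
    the scaling of the diagonal. *)
Lemma correction_sumE n :
  csum (fun i => if i == n then 0 else B n i * B i n / ((a i)%:C - (a n)%:C)) =
  (w ^+ (2 * k) / (2 * pi ^+ (2 * k)))%:C * correction_sum k w q n.+1.
Proof.
set c : R[i] := (_ / _)%:C; set u := fun i => _.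
have [b hb] := off_diagonal_summable n; rewrite -/u in hb.
have p0 : pi != 0 :> R by rewrite gt_eqF ?pi_gt0.
have c0 : c != 0.
  rewrite /c -normc_eq0 normc_real normr_eq0 mulf_neq0 ?invr_eq0 ?mulf_neq0 ?expf_neq0//.
  by rewrite gt_eqF.
pose F j : R[i] := (cos_coef w q `|n.+1 - j|%N - cos_coef w q (n.+1 + j)) ^+ 2
      / (j%:R ^+ (2 * k) - n.+1%:R ^+ (2 * k)).
have uE i : c^-1 * u i = if i == n then 0 else F i.+1.
  rewrite /u; case: eqVneq => [_|ni]; first by rewrite mulr0.
  have natC x : (x%:R ^+ (2 * k))%:C = x%:R ^+ (2 * k) :> R[i].
    by rewrite rmorphXn rmorph_nat.
  have aC x : (a x)%:C = ((pi / w) ^+ (2 * k))%:C * x.+1%:R ^+ (2 * k) :> R[i].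
    by rewrite diagE -natC rmorphM.
  have dC : (a i)%:C - (a n)%:C = ((pi / w) ^+ (2 * k))%:C *
      (i.+1%:R ^+ (2 * k) - n.+1%:R ^+ (2 * k)) :> R[i] by rewrite !aC mulrBr.
  rewrite potential_sqr /F dC.
  have -> : (pi / w) ^+ (2 * k) = (2 * (w ^+ (2 * k) / (2 * pi ^+ (2 * k))))^-1 :> R.
    by rewrite expr_div_n; field; rewrite !expf_neq0// gt_eqF.
  have -> : (2 * (w ^+ (2 * k) / (2 * pi ^+ (2 * k))))^-1%:C = (2^-1)%:C * c^-1.
    by rewrite invfM rmorphM /= [in X in _ * X = _]fmorphV.
  have h2 : (2^-1)%:C != 0 :> R[i].
    by rewrite -normc_eq0 normc_real normr_eq0 invr_eq0.
  set X := (_ - _) ^+ 2; set Y := _ ^+ (2 * k) - _; rewrite !invfM invrK.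
  have -> : c^-1 * ((2^-1)%:C * X * ((2^-1)%:C^-1 * c / Y)) =
    (c^-1 * c) * ((2^-1)%:C * (2^-1)%:C^-1) * (X / Y) by ring.
  by rewrite mulVf// mulfV// !mul1r.
have -> : correction_sum k w q n.+1 = c^-1 * csum u.
  (* The displayed sum starts at j = 1, the sequence index at i = j - 1; after this shift the
     summability of u provides the limit in [correction_sum]. *)
  have H : (fun N : nat => \sum_(1 <= j < N | j != n.+1) F j : R[i]^o) @ \oo -->
      (c^-1 * csum u : R[i]^o).
    rewrite -(csumZ _ hb) -cvg_shiftS /=.
    have := csum_cvg (csummableZ c^-1 hb); apply: cvg_trans; apply: near_eq_cvg.
    apply: nearW => N /=; rewrite big_add1 big_mkord [RHS]big_mkcond /=.
    by apply: eq_bigr => i _; rewrite uE eqSS; case: eqP.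
  exact: (cvg_lim (@norm_hausdorff _ R[i]^o) H).
by rewrite mulVKf.
Qed.

Lemma lambda_mainE n : lambda_main k w q n.+1 = (a n)%:C - B n n -
  csum (fun i => if i == n then 0 else B n i * B i n / ((a i)%:C - (a n)%:C)).
Proof.
by rewrite correction_sumE /lambda_main potential_diag /diag /freq; ring.
Qed.

Lemma inv_sqr_series_cvg : cvgn (series (fun n => (n%:R^-1 : R) ^+ 2)).
Proof.
have h : rsummable (fun n => (n%:R^-1 : R) ^+ 2) 2.
  move=> N; apply: le_trans (sum_inv_sqr N).
  case: N => [|N]; first by rewrite !big_ord0.
  rewrite big_ord_recl /= invr0 expr0n normr0 add0r [leRHS]big_ord_recr /=.
  rewrite -[leLHS]addr0 lerD ?invr_ge0 ?sqr_ge0//.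
  by apply: ler_sum => i _; rewrite ger0_norm ?sqr_ge0// exprVn.
apply: cvgP; have := rsum_cvg h; apply: cvg_trans; apply: near_eq_cvg.
by apply: nearW => N; rewrite /series /= big_mkord.
Qed.

End asymptotics.

Theorem theorem4 (R : realType) (k : nat) (w : R) (q : R -> R[i])
    (hk : (1 < k)%N) (hw : 0 < w) (hq : in_L2 w q) :
  discrete_spectrum w (D_dir k w) (L_dir k w q) /\
  exists (m : nat) (S : set R[i]) (lambda eta : nat -> R[i]),
    [/\ (0 < m)%N /\ (S #<= `I_m)%card,
        spectrum w (D_dir k w) (L_dir k w q) =
          S `|` [set lambda n | n in [set n | (m < n)%N]],
        forall n, (m < n)%N -> lambda n = lambda_main k w q n + eta n,
        exists (C : R) (beta : nat -> R),
          [/\ 0 < C, cvgn (series (fun n => beta n ^+ 2)) &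
              forall n, (m < n)%N ->
                `|eta n| <= (C * beta n / n%:R ^+ (4 * k - 3))%:C] &
        BV_or_smooth w q ->
          exists2 C : R, 0 < C &
            forall n, (m < n)%N ->
              `|eta n| <= (C / n%:R ^+ (4 * k - 2))%:C].
Proof.
have sa := diag_sum hk hw; have hB := potential_le hw hq.
have M0 : 0 <= potential_bound w q by apply: le_trans (hB 0%N 0%N); exact: normc_ge0.
have [m m0 hm] := gap_small hk hw M0.
split; first exact: (dir_discrete hk hw hq m0 hm).
have symB j i : potential w q j i = potential w q i j := potential_sym w q j i.
have [lam [hlam1 hlam2]] := seq_spectrum (diag_gt0 k hw) sa hB symB (diag_mono hk hw)
  (diag_unbounded hk hw) m0 (gap_sum hk hw) (eps_sum hk hw hq) hm.
pose S := [set l | iseig (diag k w) (potential w q) l /\ complex.Re l < midpoint (diag k w) m].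
(* Sequences are indexed from 0 and frequencies from 1, hence the predecessor. *)
pose lambda n := lam n.-1; pose eta n := lambda n - lambda_main k w q n.
pose E : R := (bessel_bound w q + 4) / (pi / w) ^+ (2 * k).
(* 4 M eps_n^2 is the error in [seq_spectrum], and E is the numerator of [eps_bound]; the added 1
   makes C positive even when the potential bound vanishes. *)
pose C := 4 * potential_bound w q * E ^+ 2 + 1.
have C0 : 0 < C by rewrite ltr_wpDl// mulr_ge0 ?sqr_ge0// mulr_ge0.
have heta n : (m < n)%N -> normc (eta n) <= C / n%:R ^+ (4 * k - 2).
  case: n => // n; rewrite ltnS => mn; have [_] := hlam1 n mn.
  rewrite /eta /lambda /= lambda_mainE// => /le_trans; apply.
  rewrite /eps_bound -/E expr_div_n mulrA -exprM.
  rewrite (_ : ((2 * k - 1) * 2 = 4 * k - 2)%N); last by lia.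
  by rewrite ler_pM2r ?invr_gt0 ?exprn_gt0 ?ltr0n// lerDl.
exists m, S, lambda, eta; split.
- split => //.
  have [p [mu [pm ->]]] := eig_family hk hw hq m0 hm (leqnn m) (fun l (h : S l) => h).
  by apply: card_le_trans (card_image_le _ _) _; rewrite card_le_II.
- rewrite (spectrumE hk hw hq); apply/seteqP; split=> [l /= hl|l [[]//|[n mn <-]]].
    by have [h|[n mn ->]] := hlam2 l hl; [left|right; exists n.+1].
  by have [] := hlam1 n.-1; first by case: n mn.
- by move=> n _; rewrite /eta addrC subrK.
- exists C, (fun n => n%:R^-1); split => //; first exact: inv_sqr_series_cvg.
  move=> n mn; rewrite normrcE lecR; apply: le_trans (heta n mn) _.
  rewrite -mulrA -invfM -exprS (_ : (4 * k - 3).+1 = (4 * k - 2)%N)//; lia.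
- by move=> _; exists C => // n mn; rewrite normrcE lecR heta.
Qed.
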